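(* Let $n\ge2$, $k\ge1$. (1) The transfer matrix is the generating function of the noncommutative elementary symmetric functions: $T(u)=\sum_{r=0}^n e_r(a_0,\dots,a_{n-1})\,u^r$ as operators on $\mathcal H$. (2) $[T(u),T(v)]=0$ for all $u,v\in\mathbb C$; in particular the $e_r(a_0,\dots,a_{n-1})$ pairwise commute and the noncommutative Schur polynomials $s_\lambda(a_0,\dots,a_{n-1})$ are well defined. (3) The Bethe vectors $b(x_\sigma)$, $\sigma\in\mathfrak P_{\le n-1,k}$, form an orthogonal basis of $\mathcal H_k$ consisting of simultaneous eigenvectors of all $s_\lambda(a_0,\dots,a_{n-1})$. (4) The transformation matrix between the standard basis and the basis of Bethe vectors is expressed by Weyl characters evaluated at roots of unity: $$\langle\hat\lambda,b(x_\sigma)\rangle=\overline{\chi_\lambda(\xi_\sigma)}\qquad(\hat\lambda\in P_k^+,\ \lambda=\mathrm P(\hat\lambda),\ \sigma\in\mathfrak P_{\le n-1,k}),$$ and the combinatorial fusion product $\hat\lambda\circledast\hat\mu:=s_\lambda(a_0,\dots,a_{n-1})\hat\mu$ satisfies the Verlinde formula $$\hat\lambda\circledast\hat\mu=\sum_{\hat\nu\in P_k^+}\Big(\sum_{\hat\sigma\in P_k^+}\frac{\mathcal S_{\hat\lambda\hat\sigma}\mathcal S_{\hat\mu\hat\sigma}\mathcal S_{\hat\nu^*\hat\sigma}}{\mathcal S_{0\hat\sigma}}\Big)\hat\nu\qquad(\hat\lambda,\hat\mu\in P_k^+).$$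
   Context: $P_k^+$: tuples $\hat\lambda=(m_0,\dots,m_{n-1})\in\mathbb Z_{\ge0}^n$ with $\sum m_i=k$ (level $k$ dominant weights of $\widehat{\mathfrak{sl}}(n)$). $\mathcal H_k$: complex vector space with basis $P_k^+$; $\mathcal H=\bigoplus_{k\ge0}\mathcal H_k$, with the scalar product (antilinear in the first argument) making all basis vectors orthonormal; $\emptyset$ is the basis vector of $\mathcal H_0=\mathbb C$. $\mathfrak P_{\le r,c}$: partitions with at most $r$ rows and $c$ columns. $\mathrm P:P_k^+\to\mathfrak P_{\le n-1,k}$ is the bijection $\hat\lambda\mapsto\lambda$ with $\lambda_i-\lambda_{i+1}=m_i$ ($1\le i\le n-1$, $\lambda_n=0$). $\hat\nu^*$ is $\hat\nu$ with $m_i$ replaced by $m_{n-i}$ for $1\le i\le n-1$. Site indices are modulo $n$. $\varphi_i^*$ increases $m_i$ by one; $\varphi_i$ decreases $m_i$ by one, or gives $0$ if $m_i=0$. $a_i=\varphi_{i+1}^*\varphi_i$. For $1\le r\le n-1$, $e_r=\sum_{|I|=r}\prod_{i\in I}^{\circlearrowleft}a_i$ over $r$-subsets $I\subset\mathbb Z/n$, where in each product $a_{i+1}$ stands left of $a_i$ whenever $i,i+1\in I$ (choose $p\notin I$ and write factors left to right in the order $p-1,p-2,\dots,p+1$ mod $n$); $e_0=e_n=1$, $e_r=0$ otherwise. $s_\lambda(a_0,\dots,a_{n-1})=\det(e_{\lambda_i^t-i+j})$, $\lambda^t$ the transposed partition. Transfer matrix (phase model, with periodic boundary conditions): let $L_i(u)=\begin{pmatrix}1&u\varphi_i^*\\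 \varphi_i&u\end{pmatrix}$ for $i=1,\dots,n$ (with $\varphi_n=\varphi_0$), $M(u)=L_n(u)\cdots L_1(u)=\begin{pmatrix}A(u)&B(u)\\C(u)&D(u)\end{pmatrix}$ and $T(u)=A(u)+D(u)$. Bethe vectors: for $x=(x_1,\dots,x_k)$ with nonzero entries, $b(x)=B(x_1^{-1})\cdots B(x_k^{-1})\emptyset\in\mathcal H_k$. For $\sigma\in\mathfrak P_{\le n-1,k}$, $x_\sigma=\zeta^{|\sigma|/n}(\zeta^{I_1},\dots,\zeta^{I_k})$, where $\zeta^{t}:=e^{2\pi\iota t/(k+n)}$ and $(I_1,\dots,I_k)=I(\sigma^t)=(\frac{k+1}2+\sigma^t_k-k,\dots,\frac{k+1}2+\sigma_1^t-1)$. Characters: for $\xi\in\mathbb R^n$, $\chi_\lambda(\xi)=s_\lambda(e^{2\pi\iota\xi_1/(k+n)},\dots,e^{2\pi\iota\xi_n/(k+n)})$ with $s_\lambda$ the ordinary Schur polynomial. $\xi_\sigma=-(\sigma_i-\frac{|\sigma|}n+\frac{n+1}2-i)_{i=1,\dots,n}$ (with $\sigma_n=0$). Modular S-matrix: for $\hat\sigma\in P_k^+$ with $\sigma=\mathrm P(\hat\sigma)$, $\mathcal S_{0\hat\sigma}=\frac{1}{\sqrt{n(n+k)^{n-1}}}\prod_{1\le i<j\le n}|\zeta^{I_i(\sigma)}-\zeta^{I_j(\sigma)}|$, where $I(\sigma)=(\frac{n+1}2+\sigma_n-n,\dots,\frac{n+1}2+\sigma_1-1)$ is an $n$-tuple,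 and $\mathcal S_{\hat\lambda\hat\sigma}=\mathcal S_{0\hat\sigma}\,\chi_\lambda(\xi_\sigma)$. *)

(* Defs.v *)
From HB Require Import structures.
From mathcomp Require Import all_boot all_order all_fingroup all_algebra finmap.
From mathcomp Require Import boolp reals trigo.
From mathcomp Require Import complex.
From mathcomp.multinomials Require Import monalg.

Set Implicit Arguments.
Unset Strict Implicit.
Unset Printing Implicit Defensive.

Set Warnings "-redundant-canonical-projection".

Import Order.TTheory GRing.Theory Num.Theory.
Local Open Scope ring_scope.

Section Endo.
Variables (K : comNzRingType) (V : lmodType K).

Record endo := Endo {
  endo_fun :> V -> V;
  endo_linear : linear endo_fun
}.

Lemma endoP (f g : endo) : f =1 g -> f = g.
Proof.
case: f g => [f fl] [g gl] /= /funext fg; move: fl gl; rewrite fg => fl gl.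
by rewrite (Prop_irrelevance fl gl).
Qed.

HB.instance Definition _ := gen_eqMixin endo.
HB.instance Definition _ := gen_choiceMixin endo.

HB.instance Definition _ (f : endo) :=
  GRing.isLinear.Build K V V _ (endo_fun f) (endo_linear f).

Fact endo_zero_linear : linear (fun _ : V => 0 : V).
Proof. by move=> c u v; rewrite scaler0 addr0. Qed.
Fact endo_opp_linear (f : endo) : linear (fun v => - f v).
Proof. by move=> c u v; rewrite linearP opprD scalerN. Qed.
Fact endo_add_linear (f g : endo) : linear (fun v => f v + g v).
Proof. by move=> c u v; rewrite !linearP scalerDr addrACA. Qed.
Fact endo_scale_linear (a : K) (f : endo) : linear (fun v => a *: f v).
Proof. by move=> c u v; rewrite linearP scalerDr !scalerA mulrC. Qed.
Fact endo_one_linear : linear (fun v : V => v).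
Proof. by []. Qed.
Fact endo_mul_linear (f g : endo) : linear (fun v => f (g v)).
Proof. by move=> c u v; rewrite !linearP. Qed.

Definition endo_zero := Endo endo_zero_linear.
Definition endo_opp f := Endo (endo_opp_linear f).
Definition endo_add f g := Endo (endo_add_linear f g).
Definition endo_scale a f := Endo (endo_scale_linear a f).
Definition endo_one := Endo endo_one_linear.
Definition endo_mul f g := Endo (endo_mul_linear f g).

Fact endo_addA : associative endo_add.
Proof. by move=> f g h; apply: endoP => v /=; rewrite addrA. Qed.
Fact endo_addC : commutative endo_add.
Proof. by move=> f g; apply: endoP => v /=; rewrite addrC. Qed.
Fact endo_add0 : left_id endo_zero endo_add.
Proof. by move=> f; apply: endoP => v /=; rewrite add0r. Qed.
Fact endo_addN : left_inverse endo_zero endo_opp endo_add.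
Proof. by move=> f; apply: endoP => v /=; rewrite addNr. Qed.

HB.instance Definition _ :=
  GRing.isZmodule.Build endo endo_addA endo_addC endo_add0 endo_addN.

Fact endo_mulA : associative endo_mul.
Proof. by move=> f g h; apply: endoP. Qed.
Fact endo_mul1 : left_id endo_one endo_mul.
Proof. by move=> f; apply: endoP. Qed.
Fact endo_mulr1 : right_id endo_one endo_mul.
Proof. by move=> f; apply: endoP. Qed.
Fact endo_mulDl : left_distributive endo_mul +%R.
Proof. by move=> f g h; apply: endoP. Qed.
Fact endo_mulDr : right_distributive endo_mul +%R.
Proof. by move=> f g h; apply: endoP => v /=; rewrite linearD. Qed.

HB.instance Definition _ := GRing.Zmodule_isPzRing.Build endo
  endo_mulA endo_mul1 endo_mulr1 endo_mulDl endo_mulDr.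

Fact endo_scaleA a b (f : endo) :
  endo_scale a (endo_scale b f) = endo_scale (a * b) f.
Proof. by apply: endoP => v /=; rewrite scalerA. Qed.
Fact endo_scale1 : left_id 1 endo_scale.
Proof. by move=> f; apply: endoP => v /=; rewrite scale1r. Qed.
Fact endo_scaleDr : right_distributive endo_scale +%R.
Proof. by move=> a f g; apply: endoP => v /=; rewrite scalerDr. Qed.
Fact endo_scaleDl (f : endo) :
  {morph endo_scale^~ f : a b / a + b}.
Proof. by move=> a b; apply: endoP => v /=; rewrite scalerDl. Qed.

HB.instance Definition _ := GRing.Zmodule_isLmodule.Build K endo
  endo_scaleA endo_scale1 endo_scaleDr endo_scaleDl.

End Endo.

Section Lift.
Variables (I : choiceType) (K : comNzRingType) (V : lmodType K) (f : I -> V).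

Definition lift_fun (v : {malg K[I]}) : V := \sum_(m <- msupp v) v@_m *: f m.

Lemma lift_funw (v : {malg K[I]}) (D : {fset I}) :
  (msupp v `<=` D)%fset -> lift_fun v = \sum_(m <- D) v@_m *: f m.
Proof.
move=> vD; rewrite /lift_fun (big_fset_incl _ vD) //.
by move=> m _ /mcoeff_outdom ->; rewrite scale0r.
Qed.

Fact lift_linear : linear lift_fun.
Proof.
move=> c u v; pose D := (msupp (c *: u + v) `|` (msupp u `|` msupp v))%fset.
rewrite !(@lift_funw _ D); first last.
- by rewrite fsubsetUl.
- by rewrite /D fsubsetU // fsubsetUl orbT.
- by rewrite /D fsubsetU // fsubsetUr orbT.
rewrite scaler_sumr -big_split /=; apply: eq_bigr => m _.
by rewrite mcoeffD mcoeffZ scalerDl scalerA.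
Qed.
End Lift.

Definition lift_endo (I : choiceType) (K : comNzRingType)
  (f : I -> {malg K[I]}) : endo {malg K[I]} := Endo (lift_linear f).

(* A partition is a weakly decreasing sequence of natural numbers; trailing
   zeros are allowed and [nth 0 lam i] is the (i+1)-st part. *)
Definition is_partition (lam : seq nat) : bool := sorted geq lam.

Definition conj_part (lam : seq nat) : seq nat :=
  mkseq (fun j => count (fun p => j < p)%N lam) (head 0%N lam).

(* Partitions with at most [r] rows and [c] columns, padded with zeros to
   length [r]. *)
Definition box (r c : nat) : Type :=
  {t : r.-tuple 'I_c.+1 | is_partition (map val t)}.
HB.instance Definition _ r c := Finite.on (box r c).

Definition box_part r c (s : box r c) : seq nat := map val (val s).
Coercion box_part : box >-> seq.

Notation weight n := {ffun 'I_n -> nat}.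

Definition level n (m : weight n) : nat := (\sum_i m i)%N.

Definition Pk (n k : nat) : Type :=
  {m : {ffun 'I_n -> 'I_k.+1} | (\sum_i m i == k)%N}.
HB.instance Definition _ n k := Finite.on (Pk n k).

Definition Pk_weight n k (m : Pk n k) : weight n :=
  [ffun i => val (val m i)].
Coercion Pk_weight : Pk >-> finfun_of.

(* The bijection P: lam_i = m_i + m_(i+1) + ... + m_(n-1) for 1 <= i <= n-1,
   which is the solution of lam_i - lam_(i+1) = m_i with lam_n = 0. *)
Definition part_of_weight n (m : weight n) : seq nat :=
  mkseq (fun i => \sum_(j < n | (i < j)%N) m j)%N n.-1.

Fact ord_opp_subproof n (i : 'I_n) : ((n - i) %% n < n)%N.
Proof. by rewrite ltn_pmod // (leq_ltn_trans (leq0n i)). Qed.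
Definition ord_opp n (i : 'I_n) : 'I_n := Ordinal (ord_opp_subproof i).

Definition dual_weight n (m : weight n) : weight n := [ffun i => m (ord_opp i)].

Section PhaseModel.
Variables (R : realType) (n : nat).
Local Notation C := R[i].

(* The free module on all weights, i.e. the direct sum of the H_k. *)
Local Notation Hsp := {malg C[weight n]}.
Local Notation opH := (endo Hsp).

Definition ket (m : weight n) : Hsp := << m >>.
Definition vac : Hsp := ket [ffun=> 0%N].

Definition in_Hk (k : nat) (v : Hsp) : Prop :=
  forall m : weight n, m \in msupp v -> level m = k.

Definition dotH (u v : Hsp) : C := \sum_(m <- msupp u) (u@_m)^* * v@_m.

Definition incr (i : 'I_n) (m : weight n) : weight n :=
  [ffun j => if j == i then (m j).+1 else m j].
Definition decr (i : 'I_n) (m : weight n) : weight n :=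
  [ffun j => if j == i then (m j).-1 else m j].

Definition phi_star (i : 'I_n) : opH := lift_endo (fun m : weight n => ket (incr i m)).
Definition phi (i : 'I_n) : opH :=
  lift_endo (fun m : weight n => if m i == 0%N then 0 else ket (decr i m)).

(* [ordS] is the successor modulo n. *)
Definition aop (i : 'I_n) : opH := phi_star (ordS i) * phi i.

(* [rev (rot p.+1 (enum 'I_n))] is p, p-1, ..., p+1 modulo n; p itself is not
   in I. The value is only meaningful for a proper subset I, and then it does
   not depend on the choice of p outside I. *)
Definition cyc_prod (I : {set 'I_n}) : opH :=
  if [pick p | p \notin I] is Some p then
    \prod_(i <- rev (rot p.+1 (enum 'I_n)) | i \in I) aop i
  else 1.

Definition nce (r : int) : opH :=
  match r with
  | Posz r =>
      if (r == 0%N) || (r == n) then 1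
      else if (r < n)%N then \sum_(I : {set 'I_n} | #|I| == r) cyc_prod I
      else 0
  | Negz _ => 0
  end.

Definition ncschur_mx (lam : seq nat) : 'M[opH]_(head 0%N lam) :=
  \matrix_(i, j)
    nce ((nth 0%N (conj_part lam) i)%:Z - (i : nat)%:Z + (j : nat)%:Z).

(* The Leibniz formula, with the factors of each term in the order of rows. *)
Definition ncschur (lam : seq nat) : opH := \det (ncschur_mx lam).

Definition Lop (u : C) (i : 'I_n) : 'M[opH]_2 :=
  \matrix_(p, q)
    if p == 0 then (if q == 0 then 1 else u *: phi_star i)
    else (if q == 0 then phi i else u *: (1 : opH)).

(* [rev (rot 1 (enum 'I_n))] is 0, n-1, ..., 2, 1, where site 0 stands for
   site n. *)
Definition monodromy (u : C) : 'M[opH]_2 :=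
  \prod_(i <- rev (rot 1%N (enum 'I_n))) Lop u i.

Definition Aop (u : C) : opH := monodromy u 0 0.
Definition Bop (u : C) : opH := monodromy u 0 1.
Definition Cop (u : C) : opH := monodromy u 1 0.
Definition Dop (u : C) : opH := monodromy u 1 1.
Definition Top (u : C) : opH := Aop u + Dop u.

Definition bethe (k : nat) (x : 'I_k -> C) : Hsp :=
  (\prod_(j < k) Bop (x j)^-1) vac.

Definition expi (t : R) : C := (cos t +i* sin t)%C.

(* zeta^t for real t, where zeta = exp (2 pi i / (k + n)) *)
Definition zeta (k : nat) (t : R) : C := expi (2 * pi * t / (k + n)%:R).

(* With i counted from 0, [rev_ord i] is N - i - 1. *)
Definition Itup (N : nat) (mu : seq nat) (i : 'I_N) : R :=
  N.+1%:R / 2 + (nth 0%N mu (rev_ord i))%:R - (rev_ord i).+1%:R.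

Definition xpt (k : nat) (s : seq nat) (j : 'I_k) : C :=
  zeta k ((sumn s)%:R / n%:R) * zeta k (Itup (conj_part s) j).

Definition is_orthogonal_family (J : finType) (b : J -> Hsp) : Prop :=
  forall s t, s != t -> dotH (b s) (b t) = 0.

Definition is_basis_Hk (k : nat) (J : finType) (b : J -> Hsp) : Prop :=
  [/\ forall s, in_Hk k (b s),
      forall c : J -> C, \sum_s c s *: b s = 0 -> forall s, c s = 0 &
      forall v, in_Hk k v -> exists c : J -> C, v = \sum_s c s *: b s].

Definition is_eigenvector (f : opH) (v : Hsp) : Prop :=
  v <> 0 /\ exists c : C, f v = c *: v.

(* Boxes (i, j) of the Young diagram, counted from 0. *)
Definition cell (lam : seq nat) : Type :=
  {c : 'I_(size lam) * 'I_(head 0%N lam) | (c.2 < nth 0%N lam c.1)%N}.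
HB.instance Definition _ lam := Finite.on (cell lam).

Definition semistandard (lam : seq nat) (T : {ffun cell lam -> 'I_n}) : bool :=
  [forall c : cell lam, forall d : cell lam,
    (((val c).1 == (val d).1) && ((val c).2 < (val d).2)%N ==> (T c <= T d)%N)
    && (((val c).2 == (val d).2) && ((val c).1 < (val d).1)%N
        ==> (T c < T d)%N)].

Definition schur (lam : seq nat) (x : 'I_n -> C) : C :=
  \sum_(T : {ffun cell lam -> 'I_n} | semistandard T) \prod_c x (T c).

Definition chi (k : nat) (lam : seq nat) (xi : 'I_n -> R) : C :=
  schur lam (fun i => zeta k (xi i)).

Definition xi_pt (s : seq nat) (i : 'I_n) : R :=
  - ((nth 0%N s i)%:R - (sumn s)%:R / n%:R + n.+1%:R / 2 - i.+1%:R).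

Definition S0 (k : nat) (m : weight n) : C :=
  (sqrtC (n%:R * (n + k)%:R ^+ n.-1))^-1 *
  \prod_(i < n) \prod_(j < n | (i < j)%N)
    `|zeta k (Itup (part_of_weight m) i) - zeta k (Itup (part_of_weight m) j)|.

Definition Smx (k : nat) (l m : weight n) : C :=
  S0 k m * chi k (part_of_weight l) (xi_pt (part_of_weight m)).

Definition fusion (l m : weight n) : Hsp := ncschur (part_of_weight l) (ket m).

End PhaseModel.

Arguments ket {R n} m.
Arguments zeta {R} n k t.
Arguments xpt R n k s j : clear implicits.
Arguments xi_pt R n s i : clear implicits.
Arguments nce R n r : clear implicits.
Arguments ncschur_mx R n lam : clear implicits.
Arguments ncschur R n lam : clear implicits.
Arguments S0 R {n} k m.
Arguments Smx R {n} k l m.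
Arguments fusion R {n} l m.
Arguments Top {R} n u.
Arguments bethe {R} n {k} x.

(* Main.v *)
Require Import Defs.
From HB Require Import structures.
From mathcomp Require Import all_boot all_order all_fingroup all_algebra finmap.
From mathcomp Require Import boolp reals trigo.
From mathcomp Require Import complex.
From mathcomp.multinomials Require Import monalg.
From mathcomp Require Import zify ring lra.

Set Implicit Arguments.
Unset Strict Implicit.
Unset Printing Implicit Defensive.

Import Order.TTheory GRing.Theory Num.Theory.
Local Open Scope ring_scope.

(** Put N = n + k. For a polynomial p let [jt b c p] be the determinant of size
b with entries the coefficients of p of index c_i - i + j; when p is a product
of factors 1 + x_i X these are elementary symmetric polynomials of the x_i.
Both sides of the theorem are made of such determinants.

The operators. The matrix [Lop u i] has rank one, so the product that defines
the monodromy matrix telescopes: its entry A(u) is the product of the factors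
1 + u a_i over the sites i = n-1, ..., 1, and the other entries differ from it
only by creation and annihilation operators at the two ends
([monodromy_entry]). After expansion, A(u) collects the sets of moving
particles that do not contain site 0 and D(u) those that do, which proves (1)
([Top_nce]) and describes e_r by its coefficients ([nce_coef]).

Bethe vectors. A further factor 1 + z X in p turns [jt b c p] into a sum over
horizontal strips ([jt_branch]). Removing the largest letter of a tableau obeys
the same recursion, and so does the application of B(z). Therefore Schur
polynomials are determinants of elementary symmetric polynomials ([schur_jt]),
and the coefficients of a Bethe vector are determinants of the same kind, of
size n, in the inverses of the x_j ([bethe_coef]).

Complementary roots. Let y_i be the root of unity with exponent the i-th entry
of xi_sigma, and w_i its conjugate. A partition and its conjugate have
complementary sets of shifted parts ([maya_perm]); hence the numbers w_i
together with the -1/x_j, for x = x_sigma, are exactly the N-th roots of one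
constant ([roots_product]). Up to degree N the generating polynomial of the
1/x_j is thus inverse to the product of the 1 - w_i X, and the coefficients of
b(x_sigma) become quotients of alternants in w ([bethe_alt]), that is
conjugates of characters, by the dual Jacobi-Trudi identity
([dual_jacobi_trudi], [bethe_chi]).

Eigenvalues. The product of e_r(y) with an alternant in w is a sum of
alternants with shifted exponents. As w_i^N does not depend on i and the
product of the w_i is 1, the shifts that correspond to impossible moves vanish
and the others are the moves of particles around the cycle ([cyclic_pieri]). So
b(x_sigma) is an eigenvector of e_r with eigenvalue e_r(y) ([nce_bethe]).

Orthogonality and completeness. The adjoint of e_r is e_(n-r), because moving
the particles of a set of sites is inverse to moving those of the complement
([nce_adjoint]), and the eigenvalues separate the partitions sigma
([esym_yroot_inj]). A sum over all exponents of products of two alternants gives the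
norms ([sum_alt_alt], [S0_bethe_norm]). There are as many Bethe vectors as weights of
level k, so the orthogonality relations can be transposed into an expansion of
each basis vector ([ket_bethe]). Consequently an operator is determined by its
values on the Bethe vectors of all levels ([op_ext]), and (2) follows from the
commutativity of the eigenvalues.

The Verlinde formula. The eigenvalue of s_lambda on b(x_sigma) is
chi_lambda(xi_sigma) ([ncschur_val_schur]); applying s_lambda to the expansion
of a basis vector gives the formula, once chi at a dual weight is recognised as
the complex conjugate ([chi_dual], [verlinde]). *)

(** * Determinants attached to a generating polynomial *)

(** Membership extended to all natural numbers, so that the successor of the
last index needs no separate case. *)
Definition inset b (J : {set 'I_b}) (i : nat) : bool :=
  if insub i is Some j then j \in J else false.

Lemma inset_ord b (J : {set 'I_b}) (i : 'I_b) : inset J i = (i \in J).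
Proof. by rewrite /inset valK. Qed.

Lemma inset_out b (J : {set 'I_b}) i : (b <= i)%N -> inset J i = false.
Proof. by move=> bi; rewrite /inset insubF //; apply/negbTE; rewrite -leqNgt. Qed.

Lemma insetP b (J : {set 'I_b}) (i : nat) :
  reflect (exists2 j : 'I_b, j \in J & i = j :> nat) (inset J i).
Proof.
apply: (iffP idP) => [|[j jJ ->]]; last by rewrite inset_ord.
by rewrite /inset; case: insubP => // j _ ji jJ; exists j.
Qed.

(** With c the column lengths of a diagram, J is the set of columns that lose
one box; the condition says that the result is again a diagram, so that the
removed boxes form a horizontal strip. Comparing the last column with c b as
well makes every column of J nonempty. *)
Definition strip b (c : nat -> nat) (J : {set 'I_b}) : bool :=
  [forall i in J, ~~ inset J i.+1 ==> (c i.+1 < c i)%N].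

Lemma stripP b (c : nat -> nat) (J : {set 'I_b}) :
  reflect (forall i, inset J i -> ~~ inset J i.+1 -> (c i.+1 < c i)%N)
          (strip c J).
Proof.
apply: (iffP forall_inP) => [H i|H i iJ].
  by case/insetP => j jJ -> nJ; move: (H j jJ); rewrite nJ.
by apply/implyP; apply: H; rewrite inset_ord.
Qed.

Lemma strip_gt0 b (c : nat -> nat) (J : {set 'I_b}) i :
  {homo c : i j / (i <= j)%N >-> (j <= i)%N} -> strip c J -> inset J i ->
  (0 < c i)%N.
Proof.
move=> cle /stripP H; move: {2}(b - i)%N (leqnn (b - i)) => d.
elim: d i => [|d IH] i bd iJ.
  by move: iJ; rewrite inset_out // -subn_eq0 -leqn0.
case: (boolP (inset J i.+1)) => [iJ'|nJ].
  by apply: leq_trans (IH i.+1 _ iJ') (cle _ _ _) => //; lia.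
exact: leq_ltn_trans (leq0n _) (H i iJ nJ).
Qed.

Section JacobiTrudi.
Variable F : comNzRingType.
Implicit Types (p q : {poly F}) (c : nat -> nat).

(** Multilinearity of the determinant in the rows, all rows at once. *)
Lemma det_addmx b (A B : 'M[F]_b) :
  \det (A + B) =
  \sum_(J : {set 'I_b}) \det (\matrix_(i, j) (if i \in J then B i j else A i j)).
Proof.
under [RHS]eq_bigr => J _ do rewrite /determinant.
rewrite exchange_big /=; apply: eq_bigr => s _.
rewrite -mulr_sumr; congr (_ * _).
under eq_bigr => i _ do rewrite mxE addrC.
rewrite bigA_distr; apply: eq_bigr => J _.
by apply: eq_bigr => i _; rewrite mxE.
Qed.

(** The coefficient of p of index c_i - i + j, written without negative indices
by shifting p. *)
Definition jt b c p : F :=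
  \det (\matrix_(i < b, j < b) (p * 'X^i)`_(c i + j)%N).

Lemma eq_jt b c c' p : (forall i, (i < b)%N -> c i = c' i) ->
  jt b c p = jt b c' p.
Proof.
by move=> cc; congr (\det _); apply/matrixP=> i j; rewrite !mxE cc.
Qed.

(** By multilinearity in the rows, each row i may take the term z X of the new
factor, which lowers c_i by one. The choices that do not form a strip contribute
0: either two consecutive rows coincide, or the last row is zero. *)
Lemma jt_branch b c z p :
  {homo c : i j / (i <= j)%N >-> (j <= i)%N} -> c b = 0%N ->
  jt b c ((1 + z *: 'X) * p) =
  \sum_(J : {set 'I_b} | strip c J)
     z ^+ #|J| * jt b (fun i => (c i - inset J i)%N) p.
Proof.
move=> cle cb; rewrite /jt.
set A := \matrix_(i < b, j < b) (p * 'X^i)`_(c i + j)%N.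
set B := \matrix_(i < b, j < b) (z * (p * 'X^(i.+1))`_(c i + j)%N).
rewrite (_ : (\matrix_(i, j) _) = A + B); last first.
  apply/matrixP => i j; rewrite !mxE mulrDl mul1r mulrDl coefD.
  by rewrite -!scalerAl coefZ exprS ['X * p]mulrC mulrA.
rewrite det_addmx [RHS]big_mkcond /=; apply: eq_bigr => J _.
transitivity (z ^+ #|J| *
    \det (\matrix_(i < b, j < b) (p * 'X^(i + (i \in J)))`_(c i + j)%N)).
  rewrite /determinant mulr_sumr; apply: eq_bigr => s _.
  rewrite mulrCA; congr (_ * _); rewrite -(prodr_const (mem J) z) [\prod_(i in J) z]big_mkcond /=.
  rewrite -big_split /=; apply: eq_bigr => i _; rewrite !mxE.
  by case: (i \in J); rewrite ?addn1 ?addn0 ?mul1r.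
case: ifPn => [sJ | nsJ].
  congr (_ * \det _); apply/matrixP => i j; rewrite !mxE inset_ord.
  case: (boolP (i \in J)) => [iJ|_]; last by rewrite addn0 subn0.
  have ci : (0 < c i)%N by apply: strip_gt0 cle sJ _; rewrite inset_ord.
  by case: (c i) ci => // d _; rewrite addn1 !coefMXn addSn subn1 ltnS subSS.
rewrite (_ : \det _ = 0) ?mulr0 //.
(* The obstruction is an index i in J with i+1 outside J and c_(i+1) = c_i. *)
case/forallPn: nsJ => i; rewrite negb_imply => /andP [iJ]; rewrite negb_imply => /andP [niJ].
rewrite -leqNgt => cSi.
have ci : c i.+1 = c i by apply/eqP; rewrite eqn_leq cSi cle.
case: (ltnP i.+1 b) => [ib|bi].
  have ni : i != Ordinal ib by rewrite -val_eqE /= neq_ltn ltnSn.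
  apply: (determinant_alternate ni) => j; rewrite !mxE /= iJ.
  by move: niJ; rewrite -[i.+1]/(val (Ordinal ib)) inset_ord => /negbTE ->;
     rewrite ci addn1 addn0.
have bE : i.+1 = b by apply/eqP; rewrite eqn_leq bi ltn_ord.
rewrite (expand_det_row _ i) big1 // => j _; rewrite mxE iJ.
by rewrite addn1 coefMXn -ci bE cb add0n ltn_ord mul0r.
Qed.

Lemma jt1 b c : {homo c : i j / (i <= j)%N >-> (j <= i)%N} -> c b = 0%N ->
  jt b c 1 = (c 0 == 0)%N%:R.
Proof.
case: b => [|b] cle cb; first by rewrite /jt det_mx00 cb.
case: eqP => [c0|/eqP c0]; last first.
  rewrite /jt (expand_det_row _ 0) big1 // => j _.
  rewrite mxE mul1r coefXn /= -lt0n in c0 *.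
  by rewrite gtn_eqF ?mul0r // addn_gt0 c0.
have cE i : c i = 0%N by apply/eqP; rewrite -leqn0 -c0 cle.
rewrite /jt (_ : (\matrix_(i,j) _) = 1%:M) ?det1 //.
by apply/matrixP=> i j; rewrite !mxE cE mul1r coefXn add0n eq_sym.
Qed.

End JacobiTrudi.

(** * Tableaux and Schur polynomials as determinants *)

Section Grid.
Variables (a b : nat).
Implicit Types (c : nat -> nat) (i : 'I_a) (j : 'I_b).
Local Notation grid n := {ffun 'I_a * 'I_b -> 'I_n.+1}.

Definition entry n (T : grid n) i j : nat := T (i, j).

Lemma entry_inj n (T T' : grid n) :
  (forall i j, entry T i j = entry T' i j) -> T = T'.
Proof. by move=> TT; apply/ffunP => -[i j]; apply: val_inj; apply: TT. Qed.

Lemma entry_le n (T : grid n) i j : (entry T i j <= n)%N.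
Proof. by rewrite -ltnS ltn_ord. Qed.

(** A filling with letters below n of the diagram with column lengths c inside
an a x b rectangle. The letter n marks the boxes outside the diagram; with this
convention the rows are weakly increasing on the whole rectangle, and the shape
can vary without a change of type. *)
Definition tab n c (T : grid n) : bool :=
  [&& [forall i, forall j, (entry T i j < n)%N == (i < c j)%N],
      [forall i, forall j1 : 'I_b, forall j2 : 'I_b,
         (j1 <= j2)%N ==> (entry T i j1 <= entry T i j2)%N] &
      [forall j, forall i1 : 'I_a, forall i2 : 'I_a,
         (i1 < i2)%N && (entry T i2 j < n)%N ==> (entry T i1 j < entry T i2 j)%N]].

Lemma tabP n c (T : grid n) :
  reflect [/\ forall i j, (entry T i j < n)%N = (i < c j)%N,
              forall i (j1 j2 : 'I_b), (j1 <= j2)%N ->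
                 (entry T i j1 <= entry T i j2)%N &
              forall j (i1 i2 : 'I_a), (i1 < i2)%N -> (entry T i2 j < n)%N ->
                 (entry T i1 j < entry T i2 j)%N]
          (tab c T).
Proof.
apply: (iffP and3P) => [] [H1 H2 H3]; split.
- by move=> i j; move/forallP/(_ i)/forallP/(_ j)/eqP: H1.
- move=> i j1 j2.
  by move/forallP/(_ i)/forallP/(_ j1)/forallP/(_ j2)/implyP: H2.
- move=> j i1 i2 h1 h2.
  move/forallP/(_ j)/forallP/(_ i1)/forallP/(_ i2)/implyP: H3.
  by apply; rewrite h1.
- by apply/forallP => i; apply/forallP => j; apply/eqP.
- apply/forallP => i; apply/forallP => j1; apply/forallP => j2.
  by apply/implyP; apply: H2.
- apply/forallP => j; apply/forallP => i1; apply/forallP => i2.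
  by apply/implyP => /andP []; apply: H3.
Qed.

Section Branch.
Variables (n : nat) (c : nat -> nat).
Hypotheses (cle : {homo c : i j / (i <= j)%N >-> (j <= i)%N})
  (cb : c b = 0%N) (ca : forall l, (c l <= a)%N).

(** Boxes outside the smaller diagram receive the new letter n if they belong to
the diagram c, and the new filler n+1 otherwise. *)
Definition addlast (T : grid n) : grid n.+1 :=
  [ffun ij => if (T ij < n)%N then inord (T ij)
              else if (ij.1 < c ij.2)%N then inord n else ord_max].

Definition droplast (T : grid n.+1) : grid n :=
  [ffun ij => inord (minn (T ij) n)].

Definition lastcols (T : grid n.+1) : {set 'I_b} :=
  [set j | [exists i, entry T i j == n]].

Lemma addlastE (T : grid n) i j : entry (addlast T) i j =
  if (entry T i j < n)%N then entry T i j else if (i < c j)%N then n else n.+1.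
Proof.
rewrite /entry ffunE; case: ifP => h1; first by rewrite inordK // ltnS ltnW // ltnW.
by case: ifP => //; rewrite inordK.
Qed.

Lemma droplastE (T : grid n.+1) i j :
  entry (droplast T) i j = minn (entry T i j) n.
Proof. by rewrite /entry ffunE inordK // ltnS geq_minr. Qed.

Lemma addlastK : cancel addlast droplast.
Proof.
move=> T; apply: entry_inj => i j; rewrite droplastE addlastE.
by have := entry_le T i j; case: ifP => h1 h2; [lia | case: ifP => _; lia].
Qed.

Lemma droplastK (T : grid n.+1) : tab c T -> addlast (droplast T) = T.
Proof.
case/tabP => H1 _ _; apply: entry_inj => i j; rewrite addlastE !droplastE.
by have := entry_le T i j; have := H1 i j; repeat case: ifP; lia.
Qed.

Lemma lastcols_strip (T : grid n.+1) : tab c T -> strip c (lastcols T).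
Proof.
case/tabP => H1 H2 _; apply/stripP => _ /insetP [j + ->].
rewrite inE => /existsP [i /eqP Tij].
have ij : (i < c j)%N by rewrite -H1 Tij.
rewrite ltnNge => nJ; apply/negP => cj; case/negP: nJ.
have jb' : (j.+1 < b)%N.
  rewrite ltnNge; apply/negP => bj; have : (c j.+1 <= c b)%N by apply: cle.
  by rewrite cb; lia.
rewrite -[j.+1]/(val (Ordinal jb')) inset_ord inE; apply/existsP; exists i.
have h1 := H2 i j (Ordinal jb') (leqnSn j).
have h2 := H1 i (Ordinal jb'); rewrite (leq_trans ij cj) in h2.
by apply/eqP; move: h1 h2; rewrite Tij; lia.
Qed.

Lemma tab_addlast (J : {set 'I_b}) (T : grid n) : strip c J ->
  tab c (addlast T) && (lastcols (addlast T) == J)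
  = tab (fun l => (c l - inset J l)%N) T.
Proof.
move=> sJ; apply/idP/idP.
- case/andP => /tabP [H1 H2 H3] /eqP TJ; apply/tabP; split.
  + move=> i j; rewrite inset_ord.
    have := H1 i j; have := addlastE T i j; case: ifP => Tn /= E Hij.
    * case: (boolP (j \in J)) => jJ; last by rewrite subn0 -Hij E; lia.
      move: jJ; rewrite -TJ inE => /existsP [i0 /eqP Ti0].
      have h0 := H1 i0 j.
      have : ~~ (i0 < i)%N.
        by apply/negP => h; have := H3 j i0 i h; rewrite Ti0 E; lia.
      have : i0 != i :> nat by apply/eqP => /val_inj e; move: Ti0; rewrite e; lia.
      by rewrite Ti0 in h0; lia.
    * case: (boolP (i < c j)%N) Hij E => [ic Hij E|]; last by lia.
      have jJ : j \in J by rewrite -TJ inE; apply/existsP; exists i; rewrite E.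
      rewrite jJ; apply/esym/negbTE; rewrite -leqNgt; case: leqP => // ic1.
      have ia : (i.+1 < a)%N by have := ca j; lia.
      have h1 := H1 (Ordinal ia) j; have h2 := H3 j i (Ordinal ia) (leqnn _).
      by move: h1 h2; rewrite E /=; lia.
  + move=> i j1 j2 j12; have := H2 i j1 j2 j12; rewrite !addlastE /=.
    have := entry_le T i j1; have := entry_le T i j2.
    by have := cle j12; repeat case: ifP; lia.
  + move=> j i1 i2 i12 T2; have := H3 j i1 i2 i12; rewrite !addlastE /=.
    by rewrite T2; repeat case: ifP; lia.
- case/tabP => H1 H2 H3.
  have shp i j : (entry (addlast T) i j < n.+1)%N = (i < c j)%N.
    by rewrite addlastE /=; have := H1 i j; repeat case: ifP; lia.
  apply/andP; split.
    apply/tabP; split=> //.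
    + move=> i j1 j2 j12; have := H2 i j1 j2 j12; rewrite !addlastE /=.
      have := entry_le T i j1; have := entry_le T i j2.
      by have := cle j12; repeat case: ifP; lia.
    + move=> j i1 i2 i12; have := H3 j i1 i2 i12; rewrite !addlastE /=.
      have := H1 i1 j; have := H1 i2 j.
      by case: (inset J j); repeat case: ifP; lia.
  apply/eqP/setP => j; rewrite inE; apply/existsP/idP => [[i /eqP]|jJ].
    rewrite addlastE /=; have := H1 i j; rewrite inset_ord.
    by case: (j \in J) => //; repeat case: ifP; lia.
  have c0 : (0 < c j)%N by apply: strip_gt0 cle sJ _; rewrite inset_ord.
  have ia : ((c j).-1 < a)%N by have := ca j; lia.
  exists (Ordinal ia); apply/eqP; rewrite addlastE /=.
  have := H1 (Ordinal ia) j; rewrite inset_ord jJ /=.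
  by repeat case: ifP; lia.
Qed.

End Branch.

Section Sum.
Variables (F : comNzRingType) (x : nat -> F).

Definition tabsum n c : F :=
  \sum_(T : grid n | tab c T) 
    \prod_j \prod_(i | (entry T i j < n)%N) x (entry T i j).

(** The boxes of the largest letter n form a horizontal strip, and what remains
is a tableau in the smaller letters; this is the recursion of [jt_branch]. *)
Lemma tabsum_branch n c :
  {homo c : i j / (i <= j)%N >-> (j <= i)%N} -> c b = 0%N ->
  (forall l, (c l <= a)%N) ->
  tabsum n.+1 c =
  \sum_(J : {set 'I_b} | strip c J)
     x n ^+ #|J| * tabsum n (fun l => (c l - inset J l)%N).
Proof.
move=> cle cb ca; rewrite /tabsum.
rewrite (partition_big (@lastcols n) (strip c)) => [|T]; last first.
  exact: lastcols_strip.
apply: eq_bigr => J sJ.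
(* For a given strip, the tableau is recovered from its smaller letters. *)
rewrite (reindex_onto (addlast c) (@droplast n)) /=; last first.
  by move=> T /andP [hT _]; apply: droplastK.
have hK (T : grid n) : (droplast (addlast c T) == T) = true.
  by apply/eqP; apply: addlastK.
rewrite mulr_sumr; apply: eq_big => [T|T].
  by rewrite hK andbT tab_addlast.
rewrite hK andbT tab_addlast // => /tabP [H1 _ _].
rewrite -(prodr_const (mem J) (x n)) [\prod_(i in J) x n]big_mkcond -big_split /=.
apply: eq_bigr => j _.
rewrite (bigID (fun i => (entry T i j < n)%N)) /= mulrC; congr (_ * _); last first.
  apply: eq_big => [i|i /andP [_ h]]; rewrite addlastE; last by rewrite h.
  by case: ifP; lia.
rewrite (eq_bigr (fun _ => x n)) => [|i /andP [h1 h2]]; last first.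
  congr (x _); move: h1; rewrite addlastE (negbTE h2) /=.
  by case: ifP; lia.
(* The letter n occurs in column j exactly once if j is in J, never
   otherwise. *)
have shp i : (entry (addlast c T) i j < n.+1)%N && ~~ (entry T i j < n)%N =
    (c j - inset J j <= i < c j)%N.
  by rewrite addlastE /= H1; case: (inset J j); repeat case: ifP; lia.
rewrite (eq_bigl _ _ shp) inset_ord.
case: (boolP (j \in J)) => jJ; last by rewrite big_pred0 // => i; lia.
have c0 : (0 < c j)%N by apply: strip_gt0 cle sJ _; rewrite inset_ord.
have ia : ((c j).-1 < a)%N by have := ca j; lia.
rewrite (big_pred1 (Ordinal ia)) // => i /=.
by apply/idP/eqP => [h|->]; [apply: val_inj => /= | rewrite /=]; lia.
Qed.

Lemma tabsum_jt n c :
  {homo c : i j / (i <= j)%N >-> (j <= i)%N} -> c b = 0%N ->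
  (forall l, (c l <= a)%N) ->
  tabsum n c = jt b c (\prod_(i < n) (1 + x i *: 'X)).
Proof.
elim: n c => [|n IH] c cle cb ca; last first.
  rewrite tabsum_branch // big_ord_recr /= [X in jt _ _ X]mulrC jt_branch //.
  apply: eq_bigr => J sJ; congr (_ * _); apply: IH => [i j ij||j].
  - have := cle i j ij; case: (boolP (inset J i)) => iJ; last by lia.
    case: (boolP (inset J j)) => jJ; first by lia.
    (* If column i loses a box and column j does not, the lengths drop
       strictly somewhere between them, since the last removed column before
       j satisfies the strip condition. *)
    have : exists2 l, (i <= l < j)%N & (c l.+1 < c l)%N.
      elim: j ij jJ => [|j IHj] ij jJ.
        by move: ij jJ; rewrite leqn0 => /eqP i0; rewrite -i0 iJ.
      case: (ltngtP i j.+1) ij => // [{}ij _|e _]; last by rewrite -e iJ in jJ.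
      case: (boolP (inset J j)) => jJ'.
        by exists j; [lia | move/stripP: sJ; apply].
      by have [l h1 h2] := IHj ij jJ'; exists l => //; lia.
    case=> l /andP [il lj] lc.
    by have := cle _ _ il; have := cle _ _ lj; lia.
  - by rewrite cb.
  - by have := ca j; lia.
(* Without letters there is only the empty tableau, of empty shape. *)
rewrite big_ord0 jt1 // /tabsum.
rewrite (eq_bigr (fun _ => 1)) => [|T _]; last first.
  by rewrite big1 // => j _; rewrite big_pred0.
rewrite sumr_const; congr (_ *+ _).
pose T0 : grid 0 := [ffun => ord0].
have TE (T : grid 0) : T = T0.
  by apply/ffunP => ij; rewrite ffunE; apply: ord1.
transitivity #|[pred T : grid 0 | (T == T0) && (c 0 == 0)%N]|.
  apply: eq_card => T; rewrite !inE [T]TE eqxx /=; apply/tabP/eqP => [[H _ _]|c0].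
    apply/eqP; rewrite -leqn0 leqNgt; apply/negP => c0.
    have b0 : (0 < b)%N by case: (posnP b) => // b0; move: cb c0; rewrite b0 => ->.
    have a0 : (0 < a)%N := leq_trans c0 (ca 0%N).
    by have := H (Ordinal a0) (Ordinal b0); rewrite /= c0 ltn0.
  split=> [i j|i j1 j2 _|j i1 i2 _]; rewrite /entry ?ffunE ?ltn0 //.
  by have := cle 0%N j (leq0n j); lia.
case: (c 0 == 0)%N; last first.
  by rewrite eq_card0 // => T; rewrite !inE andbF.
by apply: etrans (card1 T0); apply: eq_card => T; rewrite !inE /= ?andbT.
Qed.

End Sum.
End Grid.

Lemma rev_leq_trans : transitive geq.
Proof. by move=> a b c ba cb; apply: leq_trans cb ba. Qed.

Lemma nth_conj_part lam j : is_partition lam ->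
  nth 0%N (conj_part lam) j = count (fun p => (j < p)%N) lam.
Proof.
move=> lamP; case: (ltnP j (head 0%N lam)) => jl; first by rewrite nth_mkseq.
rewrite nth_default ?size_mkseq //; apply/esym/eqP; rewrite -leqn0 leqNgt -has_count.
apply/hasPn => p; rewrite -leqNgt; case: lam jl lamP => //= q lam qj.
rewrite /is_partition /= => qlam; rewrite inE => /orP [/eqP -> //|plam].
apply: leq_trans qj.
by move/(order_path_min rev_leq_trans)/allP/(_ p plam): qlam.
Qed.

(** A box lies in the diagram if and only if its row is long enough, if and only
if its column is. *)
Lemma ltn_count_part lam i j : is_partition lam ->
  (i < count (fun p => (j < p)%N) lam)%N = (j < nth 0%N lam i)%N.
Proof.
elim: lam i => [|p lam IH] i lamP; first by rewrite nth_nil !ltn0.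
have lamP' : is_partition lam by apply: path_sorted lamP.
have pmin : all (geq p) lam by apply: order_path_min rev_leq_trans lamP.
have cnt0 : (p <= j)%N -> count (fun p => (j < p)%N) lam = 0%N.
  move=> pj; apply/eqP; rewrite -leqn0 leqNgt -has_count; apply/hasPn => q qlam.
  by rewrite -leqNgt; apply: leq_trans pj; apply: (allP pmin).
rewrite /=; case: (ltnP j p) => jp; [|rewrite cnt0 //]; rewrite ?add1n ?addn0; case: i => [|i] //=.
- by rewrite ltnS IH.
- by rewrite ltn0; apply/esym/negbTE; rewrite -leqNgt.
- rewrite ltn0; apply/esym/negbTE; rewrite -leqNgt.
  case: (ltnP i (size lam)) => il; last by rewrite nth_default.
  by apply: leq_trans jp; apply: (allP pmin); apply: mem_nth.
Qed.

Lemma count_homo lam :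
  {homo (fun j => count (fun p => (j < p)%N) lam) : i j / (i <= j)%N >-> (j <= i)%N}.
Proof. by move=> i j ij; apply: sub_count => p; apply: leq_ltn_trans. Qed.

Section TableauSchur.
Variables (R : realType) (n : nat) (lam : seq nat) (x : 'I_n.+1 -> R[i]).
Hypothesis lamP : is_partition lam.
Local Notation a := (size lam).
Local Notation b := (head 0%N lam).
Local Notation c := (fun j : nat => count (fun p => (j < p)%N) lam).
Local Notation grid := {ffun 'I_a * 'I_b -> 'I_n.+2}.

Definition to_grid (T : {ffun cell lam -> 'I_n.+1}) : grid :=
  [ffun ij => if insub ij is Some d then widen_ord (leqnSn _) (T d) else ord_max].

Definition of_grid (T : grid) : {ffun cell lam -> 'I_n.+1} :=
  [ffun d : cell lam => inord (T (val d))].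

Lemma cellE (i : 'I_a) (j : 'I_b) :
  (j < nth 0%N lam i)%N = (i < c j)%N.
Proof. by rewrite ltn_count_part. Qed.

Lemma to_gridE T (d : cell lam) : entry (to_grid T) (val d).1 (val d).2 = T d.
Proof. by rewrite /entry ffunE -surjective_pairing valK. Qed.

Lemma to_grid_out T (i : 'I_a) (j : 'I_b) : (j < nth 0%N lam i)%N = false ->
  entry (to_grid T) i j = n.+1.
Proof. by move=> h; rewrite /entry ffunE insubF. Qed.

Lemma to_gridK : cancel to_grid of_grid.
Proof.
move=> T; apply/ffunP => d; rewrite !ffunE valK; apply: val_inj.
by rewrite /= inordK.
Qed.

Lemma of_gridK (T : grid) : tab c T -> to_grid (of_grid T) = T.
Proof.
case/tabP => H _ _; apply: entry_inj => i j.
case: (boolP (j < nth 0%N lam i)%N) => ij.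
  pose d : cell lam := exist _ (i, j) ij.
  rewrite (to_gridE _ d) ffunE /= inordK //.
  by rewrite -/(entry T i j) H -cellE.
rewrite to_grid_out; last exact: negbTE.
by have := H i j; have := entry_le T i j; rewrite -cellE (negbTE ij); lia.
Qed.

Lemma semistandard_tab (T : {ffun cell lam -> 'I_n.+1}) :
  semistandard T = tab c (to_grid T).
Proof.
have shp i j : (entry (to_grid T) i j < n.+1)%N = (i < c j)%N.
  rewrite -cellE; case: (boolP (j < nth 0%N lam i)%N) => ij.
    by rewrite (to_gridE T (exist _ (i, j) ij)) ltn_ord.
  by rewrite to_grid_out ?ltnn //; apply: negbTE.
apply/idP/tabP => [/forallP sT|[_ H2 H3]].
  split=> // [i j1 j2 j12|j i1 i2 i12].
    case: (boolP (j2 < nth 0%N lam i)%N) => ij2; last first.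
      by rewrite [leqRHS]to_grid_out ?entry_le //; apply: negbTE.
    have ij1 : (j1 < nth 0%N lam i)%N by apply: leq_ltn_trans ij2.
    rewrite (to_gridE T (exist _ (i, j1) ij1)) (to_gridE T (exist _ (i, j2) ij2)).
    case: (ltngtP j1 j2) j12 => // [j12 _|/val_inj e _]; last first.
      by move: ij1; rewrite e => ij1; rewrite (bool_irrelevance ij1 ij2).
    have /forallP/(_ (exist _ (i, j2) ij2)) := sT (exist _ (i, j1) ij1).
    by rewrite /= eqxx j12 => /andP [].
  rewrite shp -cellE => ij2.
  have ij1 : (j < nth 0%N lam i1)%N.
    by rewrite cellE; apply: ltn_trans i12 _; rewrite -cellE.
  rewrite (to_gridE T (exist _ (i1, j) ij1)) (to_gridE T (exist _ (i2, j) ij2)).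
  have /forallP/(_ (exist _ (i2, j) ij2)) := sT (exist _ (i1, j) ij1).
  by rewrite /= eqxx i12 => /andP [_].
apply/forallP => d; apply/forallP => e; rewrite -!to_gridE.
apply/andP; split; apply/implyP => /andP [/eqP h1 h2].
  by rewrite h1; apply: H2; apply: ltnW.
rewrite h1; apply: H3 => //; rewrite shp -cellE; exact: (valP e).
Qed.

(** The sum over tableaux and the determinant satisfy the same recursion in the
number of letters ([tabsum_jt]); what remains is to pass from functions on the
boxes of the diagram to fillings of the bounding rectangle. *)
Lemma schur_jt :
  schur lam x = jt b (nth 0%N (conj_part lam)) (\prod_i (1 + x i *: 'X)).
Proof.
pose X i := x (inord i).
have cle := @count_homo lam.
have cb : c b = 0%N.
  by rewrite -nth_conj_part // nth_default // size_mkseq.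
have ca l : (c l <= a)%N by apply: count_size.
rewrite (eq_jt (c' := c)) => [|i _]; last exact: nth_conj_part.
rewrite (eq_bigr (fun i : 'I_n.+1 => 1 + X i *: 'X)) => [|i _]; last first.
  by rewrite /X inord_val.
rewrite -(tabsum_jt X _ cle cb ca) /tabsum /schur.
rewrite (reindex_onto to_grid of_grid) /=; last exact: of_gridK.
have hK T : (of_grid (to_grid T) == T) = true by apply/eqP/to_gridK.
apply: eq_big => [T|T sT]; first by rewrite hK andbT semistandard_tab.
rewrite pair_big_dep /=.
rewrite (reindex_omap (fun d : cell lam => ((val d).2, (val d).1))
           (fun ji => insub (ji.2, ji.1))) /=; last first.
  move=> [j i] /=; rewrite semistandard_tab in sT.
  by case/tabP: sT => -> _ _; rewrite -cellE => ij; rewrite insubT.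
apply: eq_big => [d|d _].
  by rewrite to_gridE ltn_ord -surjective_pairing valK eqxx.
by rewrite to_gridE /X inord_val.
Qed.

End TableauSchur.

(** * Alternants and the dual Jacobi-Trudi identity *)

Section Elementary.
Variables (F : comNzRingType) (n : nat) (y : 'I_n -> F).

Lemma coef_prod_1DX r : (\prod_i (1 + y i *: 'X))`_r =
  \sum_(I : {set 'I_n} | #|I| == r) \prod_(i in I) y i.
Proof.
under eq_bigr => i _ do rewrite addrC.
rewrite bigA_distr coef_sum [RHS]big_mkcond /=; apply: eq_bigr => I _.
have -> : \prod_i (if i \in I then y i *: 'X else 1) =
          (\prod_(i in I) y i) *: 'X^#|I| :> {poly F}.
  rewrite -big_mkcond /= -prodr_const.
  by rewrite -scaler_prod.
by rewrite coefZ coefXn eq_sym; case: eqP => _; rewrite ?mulr1 ?mulr0.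
Qed.

Lemma coef_prod_Xsub r : (r <= n)%N -> (\prod_i ('X - (y i)%:P))`_(n - r) =
  (-1) ^+ r * (\prod_i (1 + y i *: 'X))`_r.
Proof.
move=> rn; rewrite coef_prod_1DX mulr_sumr.
under eq_bigr => i _ do rewrite addrC -polyCN.
rewrite bigA_distr coef_sum [RHS]big_mkcond /=; apply: eq_bigr => I _.
have cI : (n - #|I| = #|[predC I]|)%N.
  by have := cardC (mem I); rewrite card_ord => {1}<-; rewrite addKn.
have -> : \prod_i (if i \in I then (- y i)%:P else 'X) =
          ((-1) ^+ #|I| * \prod_(i in I) y i) *: 'X^(n - #|I|) :> {poly F}.
  rewrite -prodrN (bigID (mem I)) /= -mul_polyC rmorph_prod; congr (_ * _).
    by apply: eq_bigr => i /= ->.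
  rewrite (eq_bigr (fun=> 'X)) => [|i /negbTE -> //]; rewrite prodr_const.
  by congr (_ ^+ _); rewrite cI; apply: eq_card.
have In : (#|I| <= n)%N by have := max_card (mem I); rewrite card_ord.
rewrite coefZ coefXn.
have -> : (n - r == n - #|I|)%N = (#|I| == r) by apply/eqP/eqP; lia.
by case: eqP => [->|_]; rewrite ?mulr1 ?mulr0.
Qed.

End Elementary.

(** The exponents c_j + n - 1 - j, with j counted from 0, are those of the
alternant whose quotient by the alternant of c = 0 is a Schur polynomial. *)
Definition alt (F : nzRingType) n (c : nat -> nat) (y : 'I_n -> F) : 'M[F]_n :=
  \matrix_(i, j) y i ^+ (c j + (n - j.+1)).

(** The matrix is triangular with 1 on the diagonal. *)
Lemma jt0 (F : comNzRingType) n (c : nat -> nat) (p : {poly F}) :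
  (forall i, (i < n)%N -> c i = 0%N) -> p`_0 = 1 -> jt n c p = 1.
Proof.
move=> c0 p0; rewrite /jt -det_tr det_trig => [|]; last first.
  apply/is_trig_mxP => i j ij; rewrite !mxE c0 // coefMXn add0n ij //.
by apply: big1 => i _; rewrite !mxE c0 // coefMXn add0n ltnn subnn.
Qed.

(** The hypothesis makes p, up to degree N, the generating series of the
complete symmetric polynomials of y, with q_i the product of the 1 - y_l X over
l different from i: the powers of y_i are the coefficients of p q_i. The
alternant then factors as the matrix of coefficients of the q_i times the matrix
of [jt], and the first factor does not depend on c. *)
Lemma alt_jt (F : comNzRingType) n N (y : 'I_n -> F) (p : {poly F})
    (q : 'I_n -> {poly F}) (c : nat -> nat) :
  (forall i, (size (q i) <= n)%N) -> p`_0 = 1 ->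
  (forall i m, (m < N)%N -> (p * q i)`_m = y i ^+ m) -> (n <= N)%N ->
  (forall j, (j < n)%N -> (c j + (n - j.+1) < N)%N) ->
  \det (alt c y) = \det (alt (fun=> 0%N) y) * jt n c p.
Proof.
move=> sq p0 pq nN cN.
(* The coefficients of the q_i, in decreasing order of the degree. *)
pose Q := \matrix_(i < n, t < n) (q i)`_(n - t.+1).
have main d : (forall j, (j < n)%N -> (d j + (n - j.+1) < N)%N) ->
    \det (alt d y) = \det Q * jt n d p.
  move=> dN; rewrite /jt -[X in _ = _ * X]det_tr -det_mulmx; congr (\det _).
  apply/matrixP => i j; rewrite !mxE.
  have dj := dN j (ltn_ord j); rewrite -pq //.
  transitivity ((p * 'X^j * q i)`_(d j + n.-1)).
    rewrite mulrAC coefMXn ltnNge; have := ltn_ord j => jn.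
    have -> : (j <= d j + n.-1)%N by lia.
    by rewrite /=; congr (_`_ _); lia.
  rewrite coefMr; have := ltn_ord j => jn.
  transitivity (\sum_(l < n) (p * 'X^j)`_(d j + n.-1 - l) * (q i)`_l).
    rewrite [RHS](big_ord_widen (d j + n.-1).+1
       (fun l => (p * 'X^j)`_(d j + n.-1 - l) * (q i)`_l)); last by lia.
    rewrite [RHS]big_mkcond /=; apply: eq_bigr => l _; case: ltnP => // nl.
    by rewrite [(q i)`_l]nth_default ?mulr0 //; apply: leq_trans (sq i) nl.
  rewrite (reindex_inj rev_ord_inj) /=; apply: eq_bigr => t _.
  rewrite !mxE mulrC; congr (_ * _`_ _); have := ltn_ord t; lia.
rewrite main // main => [|j jn]; last by lia.
by rewrite (@jt0 _ _ (fun=> 0%N)) // mulr1.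
Qed.

(** The parts of the conjugate of lam, for lam given as a function with n rows. *)
Definition conjc n (lam : nat -> nat) (j : nat) : nat :=
  (\sum_(i < n) (j < lam i))%N.

Lemma sum_ltn n m : (\sum_(i < n) (i < m))%N = minn m n.
Proof.
elim: n => [|n IH]; first by rewrite big_ord0; lia.
by rewrite big_ord_recr /= IH; case: ltnP; lia.
Qed.

(** The shifted parts of lam and the complementary values n + j - lam'_j exhaust
the integers below n + b, so they form a permutation. *)
Definition maya n b (lam : nat -> nat) (s : 'S_(n + b)) : Prop :=
  (forall i : 'I_n, s (lshift b i) = (lam i + (n - i.+1))%N :> nat) /\
  (forall j : 'I_b, (s (rshift n j) + conjc n lam j)%N = (n + j)%N).

Arguments maya : clear implicits.

(** Induction on the number of boxes: adding a corner box in row i exchanges the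
neighbouring values lam_i + n - i - 1 and its predecessor, one of which belongs
to the parts and the other to the complement. So the sign of the permutation
changes with each box; s0 is the permutation of the empty partition. *)
Lemma maya_perm n b : exists s0 : 'S_(n + b), forall lam : nat -> nat,
  {homo lam : i j / (i <= j)%N >-> (j <= i)%N} -> lam n = 0%N ->
  (lam 0 <= b)%N ->
  exists2 s, maya n b lam s &
    odd_perm s = odd (\sum_(i < n) lam i) (+) odd_perm s0.
Proof.
pose f (z : 'I_(n + b)) : 'I_(n + b) :=
  match split z with inl i => lshift b (rev_ord i) | inr j => rshift n j end.
have fK : cancel f f.
  move=> z; rewrite /f; case: (splitP z) => [i zi|j zj].
    by rewrite (unsplitK (inl _)) rev_ordK; apply: val_inj.
  by rewrite (unsplitK (inr _)); apply: val_inj.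
exists (perm (can_inj fK)) => lam.
move: {2}(\sum_(i < n) lam i)%N (erefl (\sum_(i < n) lam i)%N) => d.
elim: d lam => [|d IH] lam dE lamle lamn lamb.
  have lam0 (i : 'I_n) : lam i = 0%N.
    by move/eqP: dE; rewrite sum_nat_eq0 => /forall_inP/(_ i isT)/eqP.
  rewrite dE; exists (perm (can_inj fK)) => //; split=> [i|j].
    by rewrite permE /f (unsplitK (inl _)) /= lam0.
  rewrite permE /f (unsplitK (inr _)) /= /conjc big1 ?addn0 // => i _.
  by rewrite lam0.
(* Row i is the last nonempty row; its last box is a corner, in column j0. *)
have [i /andP [li li1]] : exists i : 'I_n, (0 < lam i)%N && (lam i.+1 == 0)%N.
  have [i0 li0] : exists i : 'I_n, (0 < lam i)%N.
    apply/existsP; rewrite -[[exists _, _]]negbK negb_exists.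
    apply/negP => /forallP H; move: dE; rewrite big1 // => i _.
    by apply/eqP; rewrite -leqn0 leqNgt.
  case: (@arg_maxnP _ i0 (fun i : 'I_n => 0 < lam i)%N val li0) => i li imax.
  exists i; rewrite li -leqn0 leqNgt /=; apply/negP => li1.
  case: (ltnP i.+1 n) => iN; last first.
    by have := lamle _ _ iN; rewrite lamn; lia.
  by have := imax (Ordinal iN) li1 => /=; lia.
pose mu l := (lam l - (l == i))%N.
have muE (l : 'I_n) : l != i -> mu l = lam l.
  by move=> li'; rewrite /mu val_eqE (negbTE li') subn0.
have muS : (\sum_(l < n) mu l)%N = d.
  apply/eqP; rewrite -eqSS -dE (bigD1 i) //= [in X in _ == X](bigD1 i) //=.
  rewrite (eq_bigr (fun l : 'I_n => lam l) muE) /mu eqxx -addSn.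
  by apply/eqP; congr (_ + _)%N; lia.
have jb : ((lam i).-1 < b)%N by have := lamle 0%N i (leq0n _); lia.
pose j0 := Ordinal jb.
have lamgt l : ((lam i).-1 < lam l)%N = (l < i.+1)%N.
  case: (ltnP l i.+1) => lei; first by have := lamle l i lei; lia.
  by have := lamle _ _ lei; move/eqP: li1; lia.
have conjj0 : conjc n lam j0 = i.+1.
  rewrite /conjc (eq_bigr (fun l : 'I_n => (l < i.+1)%N : nat)) => [|l _].
    by rewrite sum_ltn; have := ltn_ord i; lia.
  by rewrite lamgt.
have conj_mu j : conjc n lam j = (conjc n mu j + (j == j0 :> nat))%N.
  rewrite /conjc (bigD1 i) //= [in RHS](bigD1 i) //= /mu eqxx.
  rewrite [X in (_ + X = _)%N](eq_bigr (fun l : 'I_n => (j < mu l)%N : nat)).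
    by rewrite addnAC; congr (_ + _)%N; case: eqP; lia.
  by move=> l li'; rewrite muE.
have [|||s [s1 s2] sodd] := IH mu muS.
- move=> l m lm; rewrite /mu; have h1 := lamle _ _ lm.
  have h2 : l = i -> (l < m)%N -> lam m = 0%N.
    by move=> e; rewrite e => /lamle; move/eqP: li1; lia.
  by case: eqP => e1; case: eqP => e2; try lia; have := h2 e2; lia.
- by rewrite /mu lamn.
- by rewrite /mu; lia.
exists (tperm (lshift b i) (rshift n j0) * s)%g; last first.
  rewrite odd_permM odd_tperm eq_lrshift dE sodd muS /=.
  by rewrite addNb.
have s1i := s1 i; have s2j := s2 j0; rewrite /mu eqxx in s1i.
have := conj_mu j0; rewrite conjj0 eqxx => cmu.
split=> [l|j]; rewrite permM.
  case: (eqVneq l i) => [->|li'].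
    rewrite tpermL; have j0E : j0 = (lam i).-1 :> nat by []; have := ltn_ord i; lia.
  rewrite tpermD ?s1 ?muE // ?eq_lrshift ?eq_rlshift //.
  by rewrite (inj_eq (@lshift_inj _ _)) eq_sym.
case: (eqVneq j j0) => [->|jj0].
  by rewrite tpermR conjj0 s1i; have j0E : j0 = (lam i).-1 :> nat by []; have := ltn_ord i; lia.
rewrite tpermD ?eq_lrshift //; last by rewrite (inj_eq (@rshift_inj _ _)) eq_sym.
by rewrite conj_mu val_eqE (negbTE jj0) addn0.
Qed.

Lemma size_prod_Xsub (F : comNzRingType) n (y : 'I_n -> F) :
  size (\prod_i ('X - (y i)%:P)) = n.+1.
Proof. by rewrite size_prod_XsubC /index_enum -enumT size_enum_ord. Qed.

Lemma coef_prod_1DX_gt (F : comNzRingType) n (y : 'I_n -> F) r : (n < r)%N ->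
  (\prod_i (1 + y i *: 'X))`_r = 0.
Proof.
move=> nr; rewrite coef_prod_1DX big_pred0 // => I; apply/negbTE.
by have := max_card (mem I); rewrite card_ord; case: eqP => // ->; rewrite leqNgt nr.
Qed.

Lemma conjc_le n lam j : (conjc n lam j <= n)%N.
Proof.
rewrite -[leqRHS]card_ord -sum1_card; apply: leq_sum => i _; exact: leq_b1.
Qed.

Lemma sum_conjc n b lam : (forall i, (lam i <= b)%N) ->
  (\sum_(j < b) conjc n lam j = \sum_(i < n) lam i)%N.
Proof.
move=> lamb; rewrite exchange_big /=; apply: eq_bigr => i _.
by rewrite sum_ltn; have := lamb i; lia.
Qed.

Lemma det_scale_row_col (F : comNzRingType) b (u v : 'I_b -> F) (M : 'M[F]_b) :
  \det (\matrix_(j, l) (u j * v l * M j l)) = (\prod_j (u j * v j)) * \det M.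
Proof.
rewrite /determinant mulr_sumr; apply: eq_bigr => s _.
rewrite mulrCA; congr (_ * _); rewrite big_split /= [\prod_j v j](reindex_perm s).
by rewrite -!big_split /=; apply: eq_bigr => j _; rewrite mxE.
Qed.

Section DualJacobiTrudi.
Variables (F : comNzRingType) (n b : nat) (y : 'I_n -> F) (lam : nat -> nat).
Hypotheses (lamle : {homo lam : i j / (i <= j)%N >-> (j <= i)%N})
  (lamn : lam n = 0%N) (lamb : (lam 0 <= b)%N).

Let p : {poly F} := \prod_i ('X - (y i)%:P).
Let pn : p`_n = 1.
Proof.
by have := monic_prod_XsubC (index_enum 'I_n) xpredT y;
   rewrite monicE lead_coefE size_prod_Xsub => /eqP.
Qed.

Let V : 'M[F]_(n + b) := \matrix_(r, m)
  match split r with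
  | inl i => y i ^+ m
  | inr j => (m == rshift n j)%:R
  end.
Let Q : 'M[F]_(n + b, b) := \matrix_(m, l) (p * 'X^l)`_m.
Let U : 'M[F]_b := \matrix_(j, l) (p * 'X^l)`_(n + j).

Lemma det_unitriangular : \det U = 1.
Proof.
rewrite -det_tr det_trig => [|]; last first.
  apply/is_trig_mxP => i j ij; rewrite !mxE coefMXn; case: ifP => // _.
  by rewrite nth_default // size_prod_Xsub; have := ltn_ord j; lia.
apply: big1 => i _; rewrite !mxE coefMXn ltnNge leq_addl /= addnK.
exact: pn.
Qed.

Lemma vandermonde_kernel : V *m Q = col_mx 0 U.
Proof.
apply/matrixP => r l; rewrite !mxE; case: (splitP r) => [i ri|j rj].
  rewrite mxE; have -> : \sum_m V r m * Q m l = (p * 'X^l).[y i].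
    rewrite (@horner_coef_wide _ (n + b)); last first.
      apply: leq_trans (size_polyMleq _ _) _.
      by rewrite size_prod_Xsub size_polyXn; have := ltn_ord l; lia.
    apply: eq_bigr => m _; rewrite !mxE.
    rewrite (_ : r = lshift b i); last exact: val_inj.
    by rewrite (unsplitK (inl i)) mulrC.
  by rewrite hornerM horner_prod (bigD1 i) //= !hornerE subrr !mul0r.
rewrite (bigD1 (rshift n j)) //= big1 ?addr0 => [|m mj].
  rewrite !mxE (_ : r = rshift n j); last exact: val_inj.
  by rewrite (unsplitK (inr j)) eqxx mul1r.
rewrite !mxE (_ : r = rshift n j); last exact: val_inj.
by rewrite (unsplitK (inr j)) (negbTE mj) mul0r.
Qed.

(** Multiply the permuted V by the block triangular matrix G whose last columns
are those of Q: the determinant of G is the minor of Q, and the product is block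
triangular with the alternant and the unitriangular U on the diagonal. *)
Lemma maya_minor (mu : nat -> nat) (s : 'S_(n + b)) : maya n b mu s ->
  (forall j : 'I_b, (conjc n mu j <= n + j)%N) ->
  \det V * (-1) ^+ s *
    \det (\matrix_(j < b, l < b) (p * 'X^l)`_(n + j - conjc n mu j))
  = \det (alt mu y).
Proof.
move=> [s1 s2] cle.
pose Vs := col_perm s V; pose Qs := row_perm s Q.
have VQ : Vs *m Qs = col_mx 0 U.
  rewrite -vandermonde_kernel /Vs mul_col_perm; congr (_ *m _).
  by apply/matrixP => i j; rewrite !mxE permKV.
have detVs : \det Vs = \det V * (-1) ^+ s.
  by rewrite /Vs col_permE det_mulmx det_perm odd_permV.
have dQ : dsubmx Qs = \matrix_(j < b, l < b) (p * 'X^l)`_(n + j - conjc n mu j).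
  apply/matrixP => j l; rewrite !mxE; congr (_`_ _).
  by have := s2 j; have := cle j; lia.
have ulV : ulsubmx Vs = alt mu y.
  by apply/matrixP => i j; rewrite !mxE (unsplitK (inl i)) s1.
pose G : 'M[F]_(n + b) := block_mx 1%:M (usubmx Qs) 0 (dsubmx Qs).
have VG : Vs *m G = block_mx (ulsubmx Vs) 0 (dlsubmx Vs) U.
  rewrite /G block_mxEh mul_mx_row vsubmxK VQ.
  rewrite -[Vs in LHS]hsubmxK mul_row_col mulmx1 mulmx0 addr0.
  rewrite block_mxEh; congr row_mx.
  by rewrite -{1}[Vs]submxK block_mxEh row_mxKl.
rewrite -ulV -dQ -detVs; transitivity (\det (Vs *m G)).
  by rewrite det_mulmx /G det_ublock det1 mul1r.
by rewrite VG det_lblock det_unitriangular mulr1.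
Qed.

(** Multiples of the polynomial p with roots y_i span the linear relations
between the powers of the y_i, so a maximal minor of their Vandermonde matrix of
size n x (n + b), completed to a square matrix V by unit rows, equals, up to
sign, the complementary minor of the matrix Q of coefficients of p, ..., p
X^(b-1) ([maya_minor]). The exponents of the alternant of lam are complementary
to indices given by the conjugate partition ([maya_perm]). The remaining signs
come from the coefficients of p, which are signed elementary symmetric
polynomials, and cancel against the sign of the permutation. *)
Lemma dual_jacobi_trudi :
  \det (alt lam y) =
  \det (alt (fun=> 0%N) y) * jt b (conjc n lam) (\prod_i (1 + y i *: 'X)).
Proof.
have [s0 Hs0] := maya_perm n b.
have [s1 m1 o1] := Hs0 lam lamle lamn lamb.
have [||s2 m2 o2] := Hs0 (fun=> 0%N) _ (erefl _); [by []|by []|].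
have c0 j : conjc n (fun=> 0%N) j = 0%N by rewrite /conjc big1.
rewrite -(maya_minor m2) => [|j]; last by rewrite c0.
rewrite -(maya_minor m1) => [|j]; last by apply: leq_trans (conjc_le _ _ _) (leq_addr _ _).
have -> : \matrix_(j < b, l < b) (p * 'X^l)`_(n + j - conjc n (fun=> 0%N) j) = U.
  by apply/matrixP => j l; rewrite !mxE c0 subn0.
rewrite det_unitriangular mulr1 -!mulrA; congr (_ * _).
(* The sign of each entry is a product of a sign of its row and one of its
   column. *)
pose u (j : 'I_b) : F := (-1) ^+ (conjc n lam j + j).
pose v (l : 'I_b) : F := (-1) ^+ l.
have entryE (j l : 'I_b) : (p * 'X^l)`_(n + j - conjc n lam j) =
    u j * v l * (\prod_i (1 + y i *: 'X) * 'X^j)`_(conjc n lam j + l).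
  have cn := conjc_le n lam j; rewrite !coefMXn.
  case: (ltnP (conjc n lam j + l) j) => h1.
    rewrite mulr0; case: ifP => // _; rewrite nth_default // size_prod_Xsub; lia.
  case: ltnP => h2; first by rewrite coef_prod_1DX_gt ?mulr0 //; lia.
  have -> : (n + j - conjc n lam j - l = n - (conjc n lam j + l - j))%N by lia.
  rewrite coef_prod_Xsub; last by lia.
  rewrite /u /v -exprD; congr (_ * _); rewrite -[LHS]signr_odd -[RHS]signr_odd.
  by congr (_ ^+ nat_of_bool _); lia.
rewrite (_ : \matrix_(j < b, l < b) _ = \matrix_(j, l) (u j * v l *
    (\matrix_(j < b, l < b)
       (\prod_i (1 + y i *: 'X) * 'X^j)`_(conjc n lam j + l)) j l)); last first.
  by apply/matrixP => j l; rewrite !mxE entryE.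
rewrite det_scale_row_col -/(jt _ _ _) mulrA; congr (_ * _).
have -> : \prod_j (u j * v j) = (-1) ^+ odd (\sum_(i < n) lam i) :> F.
  rewrite signr_odd -(@sum_conjc n b) => [|i]; last exact: leq_trans (lamle _) lamb.
  rewrite -prodrXr; apply: eq_bigr => j _; rewrite /u /v -exprD.
  by rewrite -[LHS]signr_odd -[RHS]signr_odd; congr (_ ^+ nat_of_bool _); lia.
by rewrite o1 o2 [X in _ = (-1) ^+ (odd X (+) _)]big1 // addFb signr_addb
  mulrAC -signr_addb addbb mul1r.
Qed.

End DualJacobiTrudi.

(** * The monodromy matrix and the noncommutative elementary polynomials *)

Section Operators.
Variables (R : realType) (n' : nat).
Local Notation n := n'.+2.
Local Notation C := R[i].
Local Notation Hsp := {malg C[weight n]}.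
Local Notation opH := (endo Hsp).
Implicit Types (i j p : 'I_n) (m : weight n) (v : Hsp) (I J : {set 'I_n}) (u : C).

Lemma ordS_neq i : ordS i != i.
Proof.
apply/eqP => /(congr1 val) /=; have := ltn_ord i.
by case: (ltngtP i.+1 n) => // [h _|h]; [rewrite modn_small // | rewrite h modnn]; lia.
Qed.

Lemma lift_endo_coef (f : weight n -> Hsp) v m :
  (lift_endo f v)@_m = \sum_(m' <- msupp v) v@_m' * (f m')@_m.
Proof.
rewrite /= /lift_fun raddf_sum /=; apply: eq_bigr => m' _; exact: mcoeffZ.
Qed.

(** Operators are handled through their coefficients: an operator that sends
basis vectors injectively to basis vectors, or to 0, acts on coefficients by the
inverse substitution. *)
Lemma lift_endo_pullback (f : weight n -> Hsp) v m m0 :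
  (forall m', (f m')@_m = (m' == m0)%:R) -> (lift_endo f v)@_m = v@_m0.
Proof.
move=> fE; rewrite lift_endo_coef.
case: (boolP (m0 \in msupp v)) => m0v; last first.
  rewrite (mcoeff_outdom m0v) big_seq big1 // => m' m'v.
  by rewrite fE; case: eqP => [e|_]; [rewrite -e m'v in m0v|rewrite mulr0].
rewrite (big_rem m0) //= fE eqxx mulr1 big_seq big1 ?addr0 // => m'.
rewrite mem_rem_uniq ?fset_uniq // inE => /andP [/negbTE nm _].
by rewrite fE nm mulr0.
Qed.

Lemma ketE m m' : (ket m : Hsp)@_m' = (m == m')%:R.
Proof. by rewrite /ket mcoeffU. Qed.

Lemma phi_coef i v m : (phi R i v)@_m = v@_(incr i m).
Proof.
apply: lift_endo_pullback => m'; case: (eqVneq (m' i) 0%N) => m'i.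
  rewrite mcoeff0; case: eqP => // e; move: m'i.
  by rewrite e ffunE eqxx.
rewrite ketE; congr (_%:R : C); congr nat_of_bool; apply/eqP/eqP => [<-|->].
  by apply/ffunP => j; rewrite !ffunE; case: eqP => // ->; rewrite prednK // lt0n.
by apply/ffunP => j; rewrite !ffunE; case: eqP.
Qed.

Lemma phi_star_coef i v m :
  (phi_star R i v)@_m = if (0 < m i)%N then v@_(decr i m) else 0.
Proof.
case: ifP => mi.
  apply: lift_endo_pullback => m'; rewrite ketE; congr (_%:R : C); congr nat_of_bool.
  apply/eqP/eqP => [<-|->]; apply/ffunP => j; rewrite !ffunE; case: eqP => // -> .
  by rewrite prednK.
rewrite lift_endo_coef big1 // => m' _; rewrite ketE; case: eqP => [e|_].
  by move: mi; rewrite -e ffunE eqxx.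
by rewrite mulr0.
Qed.

Lemma endo_mulE (f g : opH) v : (f * g) v = f (g v). Proof. by []. Qed.

Lemma aop_coef i v m :
  (aop R i v)@_m =
  if (0 < m (ordS i))%N then v@_(incr i (decr (ordS i) m)) else 0.
Proof. by rewrite /aop endo_mulE phi_star_coef; case: ifP => // _; exact: phi_coef. Qed.

(** The configuration from which one gets m when each site of I sends one
particle to the next site. It is meaningful when [movable I m] holds; the
subtraction truncates otherwise. *)
Definition move_preimage I m : weight n :=
  [ffun j => (m j + (j \in I) - (ord_pred j \in I))%N].

(** The configuration m can result from the moves of I. A site that both
receives and sends imposes no condition, because in the order of the product it
receives first. *)
Definition movable I m : bool :=
  [forall j, (ord_pred j \in I) && (j \notin I) ==> (0 < m j)%N].

Lemma movableP I m : reflect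
  (forall j, ord_pred j \in I -> j \notin I -> (0 < m j)%N) (movable I m).
Proof.
apply: (iffP forallP) => [H j h1 h2|H j]; last by apply/implyP => /andP []; apply: H.
by move/implyP: (H j); apply; rewrite h1.
Qed.

(** The last move of a product, from site i, is undone before those of I. It
does not interfere with them if neither i nor i+1 sends a particle in I. *)
Lemma move_step I i m : i \notin I -> ordS i \notin I ->
  movable (i |: I) m =
    (0 < m (ordS i))%N && movable I (incr i (decr (ordS i) m)) /\
  ((0 < m (ordS i))%N ->
    move_preimage (i |: I) m = move_preimage I (incr i (decr (ordS i) m))).
Proof.
move=> iI SiI; have Sn := ordS_neq i.
have predE j : (ord_pred j == i) = (j == ordS i).
  by rewrite -(inj_eq (@ordS_inj _)) ord_predK.
split.
  apply/movableP/andP => [H|[m0 /movableP H] j].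
    have m0 : (0 < m (ordS i))%N.
      by apply: H; rewrite ?ordSK !inE ?eqxx // negb_or Sn.
    split=> //; apply/movableP => j h1 h2; rewrite !ffunE.
    case: (eqVneq j i) => // ji; case: (eqVneq j (ordS i)) => [e|_].
      by move: h1; rewrite e ordSK (negbTE iI).
    by apply: H; rewrite !inE ?h1 ?orbT // negb_or ji.
  rewrite !inE predE negb_or => /orP [/eqP -> //|h1] /andP [ji h2].
  have := H j h1 h2; rewrite !ffunE (negbTE ji).
  by case: eqP => // -> ; rewrite -subn1 subn_gt0 => /ltnW.
move=> m0; apply/ffunP => j; rewrite !ffunE !inE predE.
case: (eqVneq j i) => [->|ji].
  by rewrite eq_sym (negbTE Sn) (negbTE iI) /= addn0 addn1.
case: eqP => [->|_] //=.
by rewrite (negbTE SiI) ordSK (negbTE iI) /= subn0 !addn0 subn1.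
Qed.

Lemma movable0 m : movable set0 m.
Proof. by apply/movableP => j; rewrite inE. Qed.

Lemma move_preimage0 m : move_preimage set0 m = m.
Proof. by apply/ffunP => j; rewrite ffunE !inE addn0 subn0. Qed.

(** The condition on s says that no site is repeated and that i+1 never stands
to the right of i, which is the order required by [move_step]. *)
Lemma prod_aop_coef (s : seq 'I_n) v m :
  pairwise (fun i j => (j != i) && (j != ordS i)) s ->
  ((\prod_(i <- s) aop R i) v)@_m =
  if movable [set i in s] m then v@_(move_preimage [set i in s] m) else 0.
Proof.
elim: s m => [|i s IH] m.
  by rewrite big_nil set_nil movable0 move_preimage0.
rewrite pairwise_cons => /andP [/allP is_ ps].
have i1 : i \notin [set i in s].
  by rewrite inE; apply/negP => /is_; rewrite eqxx.
have i2 : ordS i \notin [set i in s].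
  by rewrite inE; apply/negP => /is_; rewrite eqxx andbF.
rewrite big_cons endo_mulE aop_coef set_cons.
have [-> H2] := move_step m i1 i2.
by case: ifP => //= m0; rewrite IH // H2.
Qed.

Lemma nth_cyc p x0 k : (k < n)%N ->
  nth x0 (rev (rot p.+1 (enum 'I_n))) k = ((p + n - k) %% n)%N :> nat.
Proof.
move=> kn; have pn := ltn_ord p.
rewrite nth_rev ?size_rot ?size_enum_ord // /rot nth_cat size_drop size_enum_ord.
case: ltnP => h.
  rewrite nth_drop nth_enum_ord; last by lia.
  by rewrite modn_small; lia.
rewrite nth_take; last by lia.
rewrite nth_enum_ord; last by lia.
have -> : (p + n - k = n + (p - k))%N by lia.
by rewrite modnDl modn_small; lia.
Qed.

Lemma cyc_pairwise p I : p \notin I ->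
  pairwise (fun i j => (j != i) && (j != ordS i))
    [seq i <- rev (rot p.+1 (enum 'I_n)) | i \in I].
Proof.
move=> pI; pose s := rev (rot p.+1 (enum 'I_n)).
have ss : size s = n by rewrite size_rev size_rot size_enum_ord.
rewrite (_ : [seq i <- _ | _] = [seq i <- behead s | i \in I]); last first.
  have : nth p s 0 = p.
    by apply: val_inj; rewrite /= nth_cyc // subn0 modnDr modn_small.
  rewrite -/s; case: s ss => //= a s _ ->.
  by rewrite (negbTE pI).
apply: pairwise_filter; apply/(pairwiseP p) => k l.
rewrite !inE size_behead ss /= => kn ln kl.
have neq a b : (b < a < b + n)%N -> (b %% n != a %% n)%N.
  case/andP => h1 h2; rewrite eq_sym eqn_mod_dvd; last exact: ltnW.
  by apply/negP => /dvdn_leq; lia.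
rewrite !nth_behead -!val_eqE /= !nth_cyc; [|lia|lia].
rewrite neq /=; last by lia.
by rewrite -[(_ %% _).+1]addn1 modnDml addn1 neq //; lia.
Qed.

(** The cyclic order started after a site outside I has the property needed for
[prod_aop_coef], whichever site is chosen. *)
Lemma cyc_prod_coef I v m : I != setT ->
  (cyc_prod R I v)@_m = if movable I m then v@_(move_preimage I m) else 0.
Proof.
move=> IT; rewrite /cyc_prod; case: pickP => [p pI|H]; last first.
  by case/eqP: IT; apply/setP => j; rewrite inE; apply/negPn; rewrite H.
rewrite -big_filter prod_aop_coef; last exact: cyc_pairwise.
suff -> : [set i in [seq i <- rev (rot p.+1 (enum 'I_n)) | i \in I]] = I by [].
by apply/setP => j; rewrite inE mem_filter mem_rev mem_rot mem_enum andbT.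
Qed.

Lemma endo_scalerAl u (f g : opH) : (u *: f) * g = u *: (f * g).
Proof. exact: endoP. Qed.

Lemma endo_scalerAr u (f g : opH) : f * (u *: g) = u *: (f * g).
Proof. by apply: endoP => v /=; rewrite linearZ. Qed.

Lemma endo_sumE (J : finType) (P : pred J) (f : J -> opH) v :
  (\sum_(s | P s) f s) v = \sum_(s | P s) f s v.
Proof. by elim/big_rec2: _ => // s y1 y2 _ <-. Qed.

Lemma endo_scaleE u (f : opH) v : (u *: f) v = u *: f v. Proof. by []. Qed.

Lemma prod_1Daop u (s : seq 'I_n) : uniq s ->
  \prod_(i <- s) (1 + u *: aop R i) =
  \sum_(I : {set 'I_n} | I \subset s)
     u ^+ #|I| *: \prod_(i <- [seq i <- s | i \in I]) aop R i.
Proof.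
elim: s => [|i s IH] /=.
  rewrite big_nil (big_pred1 set0) => [|I]; last first.
    by rewrite /= -subset0; apply: eq_subset_r => j; rewrite !inE.
  by rewrite cards0 expr0 scale1r big_nil.
case/andP => is_ us; rewrite big_cons IH // mulrDl mul1r.
rewrite [RHS](bigID (fun I : {set 'I_n} => i \in I)) /= [LHS]addrC; congr (_ + _).
  rewrite [RHS](reindex_onto (fun I : {set 'I_n} => i |: I) (fun I => I :\ i)) /=;
    last by move=> I /andP [_ iI]; rewrite setD1K.
  rewrite mulr_sumr; apply: eq_big => [I|I Is].
    rewrite setU11 andbT; apply/idP/andP => [Is|[Is /eqP e]].
      split; last first.
        rewrite setU1K //; apply/negP => /(subsetP Is); exact/negP.
      by apply/subsetP => j; rewrite !inE => /orP [->|/(subsetP Is) ->]; rewrite ?orbT.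
    apply/subsetP => j jI; have := subsetP Is j.
    rewrite !inE jI orbT => /(_ isT) /orP [/eqP ji|//].
    by move: jI; rewrite -e ji !inE eqxx.
  have iI : i \notin I by apply/negP => /(subsetP Is); exact/negP.
  rewrite setU11 /= big_cons cardsU1 iI add1n exprS -scalerA.
  rewrite endo_scalerAl endo_scalerAr; do 3! congr (_ _ _).
  rewrite !big_filter; rewrite big_seq_cond [RHS]big_seq_cond.
  apply: eq_bigl => j; case: (boolP (j \in s)) => //= js; rewrite !inE.
  by case: eqP js is_ => // -> ->.
apply: eq_big => [I|I Is]; last first.
  by case: ifP => // iI; move/(subsetP Is): iI => iI; rewrite iI in is_.
apply/idP/andP => [Is|[Is iI]].
  split; last by apply/negP => /(subsetP Is); exact/negP.
  by apply/subsetP => j /(subsetP Is); rewrite inE => ->; rewrite orbT.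
apply/subsetP => j jI; move/(subsetP Is): (jI); rewrite inE => /orP [/eqP e|//].
by rewrite -e jI in iI.
Qed.

(** The sites n-1, ..., 1, that is the order of the factors of the monodromy
matrix without the first one, which belongs to site 0. *)
Definition sites : seq 'I_n := behead (rev (rot 1 (enum 'I_n))).

Lemma rev_rot1 : rev (rot 1 (enum 'I_n)) = ord0 :: sites.
Proof.
have ss : size (rev (rot 1 (enum 'I_n))) = n by rewrite size_rev size_rot size_enum_ord.
have : nth ord0 (rev (rot 1 (enum 'I_n))) 0 = ord0.
  apply: val_inj; apply: etrans (@nth_cyc ord0 ord0 0 isT) _.
  by rewrite /= add0n subn0 modnn.
by rewrite /sites; case: (rev _) ss => //= a s _ ->.
Qed.

Lemma uniq_sites : uniq sites.
Proof.
have : uniq (ord0 :: sites) by rewrite -rev_rot1 rev_uniq rot_uniq enum_uniq.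
by case/andP.
Qed.

Lemma mem_sites i : (i \in sites) = (i != ord0).
Proof.
have : i \in ord0 :: sites by rewrite -rev_rot1 mem_rev mem_rot mem_enum.
have : ord0 \notin sites.
  have : uniq (ord0 :: sites) by rewrite -rev_rot1 rev_uniq rot_uniq enum_uniq.
  by case/andP.
rewrite inE; case: eqP => [-> /negbTE -> //|_ _ /= ->//].
Qed.

Lemma size_sites : size sites = n'.+1.
Proof. by rewrite size_behead size_rev size_rot size_enum_ord. Qed.

Lemma nth_sites k : (k < n'.+1)%N -> nth ord0 sites k = (n - k.+1)%N :> nat.
Proof.
move=> kn; rewrite nth_behead (@nth_cyc ord0) // add0n modn_small //; lia.
Qed.

Lemma path_sites : path (fun i j => i == ordS j) ord0 sites.
Proof.
apply/(pathP ord0) => k; rewrite size_sites => kn.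
apply/eqP/val_inj; rewrite /= nth_sites //.
case: k kn => [|k] kn /=; first by rewrite subn1 modnn.
by rewrite nth_sites; [rewrite modn_small; lia | lia].
Qed.

Lemma last_sites : last ord0 sites = inord 1.
Proof.
apply: val_inj; rewrite /= -nth_last size_sites nth_sites // inordK //=; lia.
Qed.

(** This relation makes the matrices [Lop u i] of rank one. *)
Lemma phiK i : phi R i * phi_star R i = 1.
Proof.
apply: endoP => v; apply/malgP => m; rewrite endo_mulE phi_coef phi_star_coef.
rewrite ffunE eqxx /=; congr (_@__); apply/ffunP => j; rewrite !ffunE.
by case: eqP.
Qed.

Let cvec i (q : 'I_2) : opH := if q == 0 then 1 else phi R i.
Let rvec u i (q : 'I_2) : opH := if q == 0 then 1 else u *: phi_star R i.

(** Since the annihilation operator is a left inverse of the creation operator,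
the matrix is the column (1, phi) times the row (1, u phi-star). *)
Lemma Lop_rank1 u i (r q : 'I_2) : Lop u i r q = cvec i r * rvec u i q.
Proof.
rewrite mxE /cvec /rvec; case: eqP => _; case: eqP => _; rewrite ?mul1r ?mulr1 //.
by rewrite endo_scalerAr phiK.
Qed.

(** The row of one factor times the column of the next is the scalar 1 + u a_j. *)
Lemma prod_Lop u i (s : seq 'I_n) (r q : 'I_2) : path (fun i j => i == ordS j) i s ->
  (\prod_(j <- i :: s) Lop u j) r q =
  cvec i r * \prod_(j <- s) (1 + u *: aop R j) * rvec u (last i s) q.
Proof.
elim: s i r q => [|j s IH] i r q /=.
  by rewrite big_seq1 big_nil mulr1 Lop_rank1.
case/andP => /eqP ij js; rewrite big_cons mxE !big_ord_recl big_ord0 addr0.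
rewrite !IH // !Lop_rank1 big_cons.
have <- : rvec u i 0 * cvec j 0 + rvec u i 1 * cvec j 1 = 1 + u *: aop R j.
  by rewrite /rvec /cvec /= mulr1 endo_scalerAl /aop ij.
by rewrite mulrDl mulrDr mulrDl !mulrA.
Qed.

Lemma monodromy_entry u (r q : 'I_2) : monodromy n u r q =
  cvec ord0 r * \prod_(j <- sites) (1 + u *: aop R j) * rvec u (inord 1) q.
Proof.
by rewrite /monodromy rev_rot1 prod_Lop ?path_sites // last_sites.
Qed.

Lemma sites_coef I v m : ord0 \notin I ->
  ((\prod_(i <- [seq i <- sites | i \in I]) aop R i) v)@_m =
  if movable I m then v@_(move_preimage I m) else 0.
Proof.
move=> I0; rewrite prod_aop_coef.
  suff -> : [set i in [seq i <- sites | i \in I]] = I by [].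
  apply/setP => j; rewrite inE mem_filter mem_sites.
  by case: (boolP (j \in I)) => //= jI; apply: contraNneq I0 => <-.
have := cyc_pairwise I0; rewrite rev_rot1 /= (negbTE I0).
by [].
Qed.

Lemma prod_sites_coef u v m :
  ((\prod_(j <- sites) (1 + u *: aop R j)) v)@_m =
  \sum_(I : {set 'I_n} | ord0 \notin I)
     u ^+ #|I| * (if movable I m then v@_(move_preimage I m) else 0).
Proof.
rewrite prod_1Daop ?uniq_sites // endo_sumE raddf_sum /=.
apply: eq_big => [I|I Is].
  apply/subsetP/idP => [H|I0 j jI].
    by apply/negP => /H; rewrite mem_sites eqxx.
  by rewrite mem_sites; apply: contraNneq I0 => <-.
apply: etrans (mcoeffZ _ _ _) _; rewrite sites_coef //.
by apply/negP => /(subsetP Is); rewrite mem_sites eqxx.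
Qed.

Lemma Aop_coef u v m : (Aop n u v)@_m =
  \sum_(I : {set 'I_n} | ord0 \notin I)
     u ^+ #|I| * (if movable I m then v@_(move_preimage I m) else 0).
Proof.
by rewrite /Aop monodromy_entry /cvec /rvec /= prod_sites_coef.
Qed.

Lemma ordS0 : ordS ord0 = inord 1 :> 'I_n.
Proof. by apply: val_inj; rewrite /= inordK // modn_small. Qed.

(** The particle created at site 1 comes in through site 0, so it is recorded as
a move out of site 0: this turns sets without site 0 into sets with it, and the
exponent of u into their cardinality. *)
Lemma Bop_coef0 u v m : (Bop n u v)@_m =
  \sum_(I : {set 'I_n} | ord0 \in I)
     u ^+ #|I| *
     (let w := move_preimage (I :\ ord0) m in
      if movable (I :\ ord0) m && (0 < w (inord 1))%N
      then v@_(decr (inord 1) w) else 0).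
Proof.
rewrite /Bop monodromy_entry /cvec /rvec /= prod_sites_coef.
rewrite [RHS](reindex_onto (fun I : {set 'I_n} => ord0 |: I) (fun I => I :\ ord0)) /=;
  last by move=> I I0; rewrite setD1K.
apply: eq_big => [I|I I0].
  rewrite setU11 /=; apply/idP/eqP => [I0|<-]; last by rewrite !inE eqxx.
  by rewrite setU1K.
rewrite setU1K // cardsU1 I0 add1n exprSr -mulrA; congr (_ * _).
case: ifP => //= _; last by rewrite mulr0.
apply: etrans (mcoeffZ _ _ _) _; rewrite phi_star_coef.
by case: ifP.
Qed.

(** In D(u) a particle is first put on site 1 and, after all moves, one is taken
from site 0; together this is the move a_0. *)
Lemma move_preimage_incr0 I m : ord0 \notin I ->
  (if movable I (incr ord0 m) && (0 < move_preimage I (incr ord0 m) (inord 1))%N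
   then decr (inord 1) (move_preimage I (incr ord0 m)) else m) =
  (if movable (ord0 |: I) m then move_preimage (ord0 |: I) m else m) /\
  movable I (incr ord0 m) && (0 < move_preimage I (incr ord0 m) (inord 1))%N =
  movable (ord0 |: I) m.
Proof.
move=> I0; have S0 := ordS0.
have predE j : (ord_pred j == ord0) = (j == inord 1).
  by rewrite -(inj_eq (@ordS_inj _)) ord_predK S0.
have n10 : (inord 1 == ord0 :> 'I_n) = false.
  by rewrite -S0; apply/negbTE/ordS_neq.
have p1 : ord_pred (inord 1) = ord0 :> 'I_n by rewrite -S0 ordSK.
have mE : movable I (incr ord0 m) && (0 < move_preimage I (incr ord0 m) (inord 1))%N =
    movable (ord0 |: I) m.
  rewrite ffunE p1 (negbTE I0) subn0 ffunE n10.
  apply/andP/movableP => [[/movableP H h] j|H].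
    rewrite !inE predE negb_or => /orP [/eqP ->|h1] /andP [j0 h2].
      by move: h; rewrite (negbTE h2) addn0.
    by have := H j h1 h2; rewrite ffunE (negbTE j0).
  split; last first.
    case: (boolP (inord 1 \in I)) => h; first by rewrite addn1.
    by rewrite addn0; apply: H; rewrite !inE ?p1 ?eqxx // n10.
  apply/movableP => j h1 h2; rewrite ffunE; case: (eqVneq j ord0) => // j0.
  by apply: H; rewrite !inE ?h1 ?orbT // negb_or j0.
split=> //; rewrite mE; case: ifP => // _.
apply/ffunP => j; rewrite !ffunE !inE predE.
case: (eqVneq j ord0) => [->|j0].
  by rewrite eq_sym n10 (negbTE I0) /= addn0 addn1.
by case: eqP => [->|_] //=; rewrite p1 (negbTE I0) subn0 subn1.
Qed.

Lemma Dop_coef u v m : (Dop n u v)@_m =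
  \sum_(I : {set 'I_n} | ord0 \in I)
     u ^+ #|I| * (if movable I m then v@_(move_preimage I m) else 0).
Proof.
rewrite /Dop monodromy_entry /cvec /rvec /= phi_coef prod_sites_coef.
rewrite [RHS](reindex_onto (fun I : {set 'I_n} => ord0 |: I) (fun I => I :\ ord0)) /=;
  last by move=> I I0; rewrite setD1K.
apply: eq_big => [I|I I0].
  rewrite setU11 /=; apply/idP/eqP => [I0|<-]; last by rewrite !inE eqxx.
  by rewrite setU1K.
rewrite cardsU1 I0 add1n exprSr -mulrA; congr (_ * _).
have [E H] := move_preimage_incr0 m I0; rewrite -H in E *.
case: (movable I _) E => /= E; last by rewrite mulr0.
rewrite mcoeffZ phi_star_coef; case: ifP E => _ E; first by rewrite E.
by rewrite mulr0.
Qed.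

Lemma Top_coef u v m : (Top n u v)@_m =
  \sum_(I : {set 'I_n})
     u ^+ #|I| * (if movable I m then v@_(move_preimage I m) else 0).
Proof.
rewrite /Top /= mcoeffD Aop_coef Dop_coef addrC.
by rewrite [RHS](bigID (fun I : {set 'I_n} => ord0 \in I)).
Qed.

Lemma movable_setT m : movable setT m.
Proof. by apply/movableP => j _; rewrite inE. Qed.

Lemma move_preimage_setT m : move_preimage setT m = m.
Proof. by apply/ffunP => j; rewrite ffunE !inE addnK. Qed.

(** The conventions for e_0 and e_n fit: the moves of all sites at once leave
every configuration unchanged and are never blocked. *)
Lemma nce_coef (r : nat) v m : (nce R n r v)@_m =
  \sum_(I : {set 'I_n} | #|I| == r) (if movable I m then v@_(move_preimage I m) else 0).
Proof.
rewrite /nce; case: (eqVneq r 0%N) => [->|r0] /=.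
  rewrite (big_pred1 set0) => [|I]; last by rewrite /= cards_eq0.
  by rewrite movable0 move_preimage0.
case: (eqVneq r n) => [->|rn] /=.
  rewrite (big_pred1 setT) => [|I]; first by rewrite movable_setT move_preimage_setT.
  apply/eqP/eqP => [h|->]; last by rewrite cardsT card_ord.
  by apply/eqP; rewrite eqEcard subsetT cardsT card_ord h /=.
case: ltnP => rn'.
  rewrite endo_sumE raddf_sum /=; apply: eq_bigr => I /eqP Ir.
  rewrite cyc_prod_coef //; apply: contraNneq rn => e.
  by rewrite -Ir e cardsT card_ord.
rewrite big_pred0 ?mcoeff0 // => I; apply/negbTE.
have : (#|I| <= n)%N by have := max_card (mem I); rewrite card_ord.
by case: eqP => // -> h; case/negP: rn; rewrite eqn_leq h.
Qed.

Lemma Top_nce u : Top n u = \sum_(r < n.+1) u ^+ r *: nce R n r.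
Proof.
apply: endoP => v; apply/malgP => m.
rewrite Top_coef endo_sumE raddf_sum /=.
have card_lt (I : {set 'I_n}) : (#|I| < n.+1)%N.
  by rewrite ltnS; have := max_card (mem I); rewrite card_ord.
rewrite (partition_big (fun I : {set 'I_n} => Ordinal (card_lt I)) xpredT) //=.
apply: eq_bigr => r _; apply: etrans (esym (mcoeffZ _ _ _)).
rewrite nce_coef mulr_sumr; apply: eq_big => [I|I /eqP <-] //.
Qed.

End Operators.

(** * Coefficients of Bethe vectors *)

Section Bethe.
Variables (R : realType) (n' : nat).
Local Notation n := n'.+2.
Local Notation C := R[i].
Local Notation Hsp := {malg C[weight n]}.
Implicit Types (i j : 'I_n) (m : weight n) (v : Hsp) (I : {set 'I_n}).

(** The number of particles at the sites i+1, ..., n-1, 0 in this order. So tail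
m 0 is the level, and for i < n, tail m i exceeds the part of index i of the
partition of m by the number of particles at site 0. Undoing the move of a
particle out of site i lowers tail m i by one, so sets of moves become strips. *)
Definition tail m (i : nat) : nat :=
  if (i < n)%N then (\sum_(j < n | (i < j)%N) m j + m ord0)%N else 0%N.

Lemma tail_out m (i : nat) : (n <= i)%N -> tail m i = 0%N.
Proof. by rewrite /tail leqNgt => /negbTE ->. Qed.

Lemma ordS_last i : (n <= i.+1)%N -> ordS i = ord0.
Proof.
move=> iN; have e : i.+1 = n by have := ltn_ord i; lia.
by apply: val_inj; rewrite /= e modnn.
Qed.

Lemma tailS m i : tail m i = (m (ordS i) + tail m i.+1)%N.
Proof.
rewrite /tail ltn_ord; case: ltnP => [iN|ni].
  rewrite addnA; congr (_ + _)%N.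
  rewrite (bigD1 (ordS i)) /= ?modn_small //; congr (_ + _)%N.
  apply: eq_bigl => j; rewrite -val_eqE /= modn_small //; lia.
rewrite ordS_last // big_pred0 ?add0n ?addn0 // => j; have := ltn_ord j; lia.
Qed.

Lemma tail_homo m : {homo tail m : i j / (i <= j)%N >-> (j <= i)%N}.
Proof.
apply: (homo_leq (r := fun a b => (b <= a)%N)) => // [a b c ba cb|i].
  exact: leq_trans cb ba.
rewrite /=; case: (ltnP i n) => iN; last by rewrite !tail_out // ltnW.
by rewrite [leqRHS](tailS m (Ordinal iN)) leq_addl.
Qed.

Lemma tail_n m : tail m n = 0%N. Proof. exact: tail_out. Qed.

Lemma tail0 m : tail m 0 = level m.
Proof.
rewrite /tail /= /level addnC [RHS](bigD1 ord0) //=; congr (_ + _)%N.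
by apply: eq_bigl => j; rewrite lt0n.
Qed.

Lemma tail_strip m I :
  strip (tail m) I = [forall i in I, ~~ inset I i.+1 ==> (0 < m (ordS i))%N].
Proof.
apply: eq_forallb => i; rewrite [tail m i]tailS.
by rewrite -{1}[tail m i.+1]add0n ltn_add2r.
Qed.

Lemma inset_ordS I i : inset I i.+1 = (ordS i \in I) && (ordS i != ord0).
Proof.
case: (ltnP i.+1 n) => iN.
  have e : ordS i = Ordinal iN by apply: val_inj; rewrite /= modn_small.
  by rewrite e -[i.+1]/(val (Ordinal iN)) inset_ord andbT.
by rewrite inset_out // ordS_last // eqxx andbF.
Qed.

(** Differences of the tails determine the tails, which vanish from n on. *)
Lemma tail_rec (m m' : weight n) I :
  (forall i, (m' (ordS i) + (i \in I) = m (ordS i) + inset I i.+1)%N) ->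
  forall i : nat, tail m' i = (tail m i - inset I i)%N.
Proof.
move=> H; suff T d (i : nat) : (n - i)%N = d -> (tail m' i + inset I i = tail m i)%N.
  by move=> i; rewrite -(T _ i erefl) addnK.
elim: d i => [|d IH] i di.
  by rewrite !tail_out ?inset_out //; lia.
have iN : (i < n)%N by lia.
have := tailS m (Ordinal iN); have := tailS m' (Ordinal iN).
have := inset_ord I (Ordinal iN); have := IH i.+1; have := H (Ordinal iN).
by rewrite /=; lia.
Qed.

(** The configuration from which B(u) produces m, for the moves of I without
site 0 and a new particle at site 1. *)
Definition bop_preimage I m : weight n := decr (inord 1) (move_preimage (I :\ ord0) m).

(** The moves in B(u) are possible exactly when I is a horizontal strip of the
diagram with column lengths tail m, and undoing them removes this strip. *)
Lemma bop_preimageE I m : ord0 \in I ->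
  movable (I :\ ord0) m && (0 < move_preimage (I :\ ord0) m (inord 1))%N =
    strip (tail m) I /\
  (strip (tail m) I ->
   forall i, (bop_preimage I m (ordS i) + (i \in I) = m (ordS i) + inset I i.+1)%N).
Proof.
move=> I0; have S0 := @ordS0 n'.
have p1 : ord_pred (inord 1) = ord0 :> 'I_n by rewrite -S0 ordSK.
have n10 : (inord 1 == ord0 :> 'I_n) = false.
  by rewrite -S0; apply/negbTE/ordS_neq.
have sE : movable (I :\ ord0) m && (0 < move_preimage (I :\ ord0) m (inord 1))%N =
    strip (tail m) I.
  rewrite tail_strip ffunE p1 !inE eqxx n10 subn0 /=.
  apply/andP/forall_inP => [[/movableP H h] i iI|H].
    apply/implyP; rewrite inset_ordS => Si.
    case: (eqVneq i ord0) => [e|i0].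
      move: Si h; rewrite e S0 n10 andbT => /negbTE ->.
      by rewrite addn0.
    by apply: H; rewrite ?ordSK !inE ?i0 // andbC.
  split; last first.
    have := H ord0 I0; rewrite inset_ordS S0 n10 andbT.
    by case: (inord 1 \in I) => /= h; [rewrite addn1 | rewrite addn0].
  apply/movableP => j; rewrite !inE => /andP [_ h1] h2.
  have := H _ h1; rewrite inset_ordS ord_predK; move/implyP; apply.
  by rewrite andbC.
split=> // sI i; rewrite /bop_preimage !ffunE ordSK !inE inset_ordS.
have := sI; rewrite -sE => /andP [_]; rewrite ffunE p1 !inE eqxx n10 subn0 /=.
move: sI; rewrite tail_strip => /forall_inP/(_ i).
rewrite inset_ordS -S0 (inj_eq (@ordS_inj _)).
case: (eqVneq i ord0) => [->|i0] /=.
  by rewrite I0 S0 !andbT => /(_ isT); case: (inord 1 \in I) => /=; lia.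
rewrite [(_ != _) && _]andbC.
by case: (i \in I) => [/(_ isT)|_]; case: (_ && _) => //=; lia.
Qed.

Lemma Bop_coef u v m : (Bop n u v)@_m =
  \sum_(I : {set 'I_n} | (ord0 \in I) && strip (tail m) I)
     u ^+ #|I| * v@_(bop_preimage I m).
Proof.
rewrite Bop_coef0 big_mkcondr /=; apply: eq_bigr => I I0.
have [-> _] := bop_preimageE m I0.
by case: ifP => _ //=; rewrite mulr0.
Qed.

Lemma level_bop_preimage I m : ord0 \in I -> strip (tail m) I ->
  (level (bop_preimage I m)).+1 = level m.
Proof.
move=> I0 sI; rewrite -!tail0 (tail_rec (I := I) (m := m)); last first.
  by have [_] := bop_preimageE m I0; apply.
have : (0 < tail m 0)%N.
  by apply: strip_gt0 (@tail_homo m) sI _; rewrite -[0%N]/(val (ord0 : 'I_n)) inset_ord.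
by rewrite -[0%N]/(val (ord0 : 'I_n)) inset_ord I0; lia.
Qed.

Lemma size_prod_1DX k (z : 'I_k -> C) :
  (size (\prod_j (1 + z j *: 'X))%R <= k.+1)%N.
Proof.
by apply/leq_sizeP => j kj; rewrite coef_prod_1DX_gt.
Qed.

(** Both sides satisfy the recursion of [jt_branch]. The strips in B(u) contain
the index 0; the other strips of the recursion contribute nothing, since they
leave a first row with indices at least k+1, above the degree k of the
polynomial. *)
Lemma bethe_coef k (x : 'I_k -> C) m : (bethe n x)@_m =
  if level m == k then jt n (tail m) (\prod_j (1 + (x j)^-1 *: 'X)) else 0.
Proof.
elim: k x m => [|k IH] x m; rewrite /bethe.
  rewrite !big_ord0 /= ketE jt1 ?tail_n //; last exact: tail_homo.
  rewrite tail0; case: eqP => [<-|nm].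
    by rewrite /level big1 // => i _; rewrite ffunE.
  case: eqP => // lm; case: nm; apply/ffunP => i; rewrite ffunE.
  by move/eqP: lm; rewrite sum_nat_eq0 => /forall_inP/(_ i isT)/eqP.
rewrite big_ord_recl endo_mulE Bop_coef.
pose y := \prod_(j < k) (1 + (x (lift ord0 j))^-1 *: 'X).
rewrite (eq_bigr (fun I : {set 'I_n} => (x ord0)^-1 ^+ #|I| *
   (if level m == k.+1 then jt n (tail (bop_preimage I m)) y else 0)));
  last first.
  move=> I /andP [I0 sI].
  by rewrite -/(bethe n (fun l : 'I_k => x (lift ord0 l))) IH -eqSS level_bop_preimage.
case: eqP => [lm|_]; last by rewrite big1 // => I _; rewrite mulr0.
rewrite big_ord_recl jt_branch ?tail_n //; last exact: tail_homo.
rewrite [RHS](bigID (fun I : {set 'I_n} => ord0 \in I)) /= [X in _ = _ + X]big1.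
  rewrite addr0; apply: eq_big => [I|I /andP [I0 sI]]; first by rewrite andbC.
  congr (_ * _); apply: eq_jt => i _; apply: tail_rec.
  by have [_] := bop_preimageE m I0; apply.
move=> I /andP [_ I0]; rewrite /jt (expand_det_row _ ord0) big1 ?mulr0 // => j _.
rewrite mxE expr0 mulr1 -[X in inset I X]/(val (ord0 : 'I_n)) inset_ord (negbTE I0) subn0.
rewrite tail0 lm nth_default ?mul0r //.
by apply: leq_trans (size_prod_1DX _) _; rewrite leq_addr.
Qed.

End Bethe.

(** * A Pieri rule on the cycle of sites *)

Section MoveTail.
Variable n' : nat.
Local Notation n := n'.+2.
Implicit Types (m : weight n) (I : {set 'I_n}).

Lemma move_preimageS I m (i : 'I_n) : movable I m ->
  (move_preimage I m (ordS i) + (i \in I) = m (ordS i) + (ordS i \in I))%N.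
Proof.
move=> /movableP H; rewrite ffunE ordSK; have := H (ordS i); rewrite ordSK.
by case: (i \in I) => [/(_ isT)|_]; case: (_ \in I) => /=; [|move/(_ isT)| |]; lia.
Qed.

(** Undoing a move out of site i lowers the tail of index i. Site 0 is counted
in every tail, so undoing a move out of it also raises all of them. *)
Lemma tail_move_preimage I m (i : 'I_n) : movable I m ->
  (tail (move_preimage I m) i + (i \in I) = tail m i + (ord0 \in I))%N.
Proof.
move=> mI; have [d di] : exists d, (n - i)%N = d.+1.
  by exists (n - i).-1; have := ltn_ord i; lia.
elim: d i di => [|d IH] i di.
  have iN : (n <= i.+1)%N by lia.
  have := move_preimageS i mI; rewrite !tailS !(@tail_out _ _ i.+1) // (ordS_last iN); lia.
have iN : (i.+1 < n)%N by lia.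
have e : ordS i = i.+1 :> nat by rewrite /= modn_small.
have := move_preimageS i mI; have := IH (ordS i); rewrite e tailS [tail m i]tailS; lia.
Qed.

Lemma level_move_preimage I m : movable I m -> level (move_preimage I m) = level m.
Proof. by move=> mI; have := tail_move_preimage ord0 mI; rewrite /= !tail0; lia. Qed.

End MoveTail.

Section Pieri.
Variables (F : fieldType) (n' k : nat).
Local Notation n := n'.+2.
Variables (y w : 'I_n -> F) (c : F).
Hypotheses (yw : forall i, y i * w i = 1) (prod_w : \prod_i w i = 1)
  (per : forall i, w i ^+ (n + k) = c).
Implicit Types (m : weight n) (I : {set 'I_n}).

Let shifted I m : 'M[F]_n := \matrix_(a, j)
  ((if j \in I then y a else 1) * w a ^+ (tail m j + (n - j.+1))).

(** Multiplying column j by y lowers its exponent by one. If site 0 is in I, all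
tails are raised by one, which multiplies row a by w_a, and the product of the
w_a is 1. *)
Lemma shifted_movable I m : movable I m ->
  \det (alt (tail (move_preimage I m)) w) = \det (shifted I m).
Proof.
move=> mI; pose s := ord0 \in I.
have -> : alt (tail (move_preimage I m)) w =
    \matrix_(a, j) (w a ^+ s * 1 * shifted I m a j).
  apply/matrixP => a j; rewrite !mxE mulr1; have := tail_move_preimage j mI.
  rewrite -/s => H; transitivity ((if j \in I then y a else 1) *
     w a ^+ (tail (move_preimage I m) j + (j \in I) + (n - j.+1))).
    case: (j \in I); last by rewrite mul1r addn0.
    by rewrite addn1 addSn exprS mulrA yw mul1r.
  by rewrite H addnAC exprD [RHS]mulrC mulrA.
rewrite det_scale_row_col (eq_bigr (fun a => w a ^+ s)) => [|a _]; last by rewrite mulr1.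
by rewrite prodrXl prod_w expr1n mul1r.
Qed.

(** The moves are impossible because of an empty site j outside I with j-1 in I.
The columns j-1 and j then have the same exponent after the shift. When j = 0
the two exponents differ by N and the columns are proportional. *)
Lemma shifted_stuck I m : level m = k -> ~~ movable I m -> \det (shifted I m) = 0.
Proof.
move=> mk; rewrite /movable => /forallPn [j]; rewrite negb_imply -leqNgt leqn0.
case/andP => /andP [pI jI] /eqP mj; pose i := ord_pred j.
have Si : ordS i = j by rewrite /i ord_predK.
have ij : i != j by rewrite -Si eq_sym ordS_neq.
rewrite -det_tr; case: (ltnP i.+1 n) => iN.
  have ji : j = i.+1 :> nat by rewrite -Si /= modn_small.
  apply: (determinant_alternate ij) => a; rewrite !mxE pI (negbTE jI) mul1r.
  rewrite (tailS _ i) Si mj add0n -ji.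
  have -> : (tail m j + (n - j) = (tail m j + (n - j.+1)).+1)%N.
    by have := ltn_ord j; lia.
  by rewrite exprS mulrA yw mul1r.
have j0 : j = ord0 by rewrite -Si ordS_last.
have ti : (tail m i + (n - i.+1) = 0)%N.
  rewrite (tailS _ i) Si mj tail_out //; have := ltn_ord i; lia.
(* Column 0 has exponent N - 1, so it is c times the powers w^(-1) = y;
   column n-1 has exponent 0 and, after the shift, is y as well. *)
pose M : 'M[F]_n := \matrix_(l, a) (if l == j then y a else (shifted I m)^T l a).
have -> : (shifted I m)^T = \matrix_(l, a) ((if l == j then c else 1) * 1 * M l a).
  apply/matrixP => l a; rewrite 3!mxE [M l a]mxE mulr1.
  case: eqP => [->|_]; last by rewrite !mxE mul1r.
  rewrite (negbTE jI) mul1r j0 tail0 mk -(per a).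
  have -> : (n + k = (k + (n - 1)).+1)%N by lia.
  by rewrite exprS mulrC mulrA yw mul1r.
rewrite det_scale_row_col (_ : \det M = 0) ?mulr0 //.
apply: (determinant_alternate ij) => a; rewrite !mxE (negbTE ij) eqxx pI ti.
by rewrite mulr1.
Qed.

(** Expand e_r(y) and the alternant: a set of rows is carried to a set of
columns by the permutation of each term, so the sum over sets of rows becomes a
sum over sets of columns that are shifted. *)
Lemma cyclic_pieri r m : level m = k ->
  \sum_(I : {set 'I_n} | #|I| == r)
     (if movable I m then \det (alt (tail (move_preimage I m)) w) else 0) =
  (\prod_i (1 + y i *: 'X))`_r * \det (alt (tail m) w).
Proof.
move=> mk; transitivity (\sum_(I : {set 'I_n} | #|I| == r) \det (shifted I m)).
  apply: eq_bigr => I _; case: ifPn => mI; first exact: shifted_movable.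
  by rewrite shifted_stuck.
rewrite coef_prod_1DX mulr_sumr /determinant exchange_big /=.
apply: eq_bigr => s _; rewrite mulrCA mulr_suml -mulr_sumr; congr (_ * _).
rewrite (reindex_inj (imset_inj (@perm_inj _ s))) /=.
apply: eq_big => [I|I _]; first by rewrite card_imset //; apply: perm_inj.
rewrite [X in X * _]big_mkcond -big_split /=; apply: eq_bigr => a _.
by rewrite !mxE mem_imset //; apply: perm_inj.
Qed.

End Pieri.

(** * Roots of unity *)

Section Zeta.
Variables (R : realType) (n k : nat).
Hypothesis N0 : (0 < k + n)%N.
Local Notation C := R[i].
Implicit Types (t u : R).

Lemma expiD t u : expi (t + u) = expi t * expi u :> C.
Proof.
rewrite /expi cosD sinD /GRing.mul /=; congr (_ +i* _)%C.
by rewrite addrC.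
Qed.

Lemma expi0 : expi 0 = 1 :> C.
Proof. by rewrite /expi cos0 sin0. Qed.

Lemma expi_conj t : (expi t)^* = expi (- t) :> C.
Proof. by rewrite /expi cosN sinN. Qed.

Lemma expi_2pi : expi (2 * pi) = 1 :> C.
Proof. by rewrite /expi mulr_natl cos2pi sin2pi. Qed.

Lemma expi_int (z : int) : expi (2 * pi * z%:~R) = 1 :> C.
Proof.
have nat_case (a : nat) : expi (2 * pi * a%:R) = 1 :> C.
  elim: a => [|a IH]; first by rewrite mulr0 expi0.
  by rewrite -[a.+1%:R]natr1 mulrDr mulr1 expiD IH expi_2pi mulr1.
case: z => a; first exact: nat_case.
by rewrite NegzE mulrNz mulrN -expi_conj nat_case rmorph1.
Qed.

(** After reduction of t modulo 2 pi to r in [0, 2 pi), cos r = 1 forces sin (r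
/ 2) = 0, hence r = 0. *)
Lemma expi_eq1 t : expi t = 1 :> C -> exists z : int, t = 2 * pi * z%:~R.
Proof.
move=> e1; have pi0 : 0 < 2 * pi :> R by rewrite mulr_gt0 // pi_gt0.
pose z := Num.floor (t / (2 * pi)); exists z.
pose r := t - 2 * pi * z%:~R.
have /andP [r0 r2] : 0 <= r < 2 * pi.
  have /andP [h1 h2] := floor_itv (t / (2 * pi)).
  rewrite subr_ge0 ltrBlDl; apply/andP; split.
    by rewrite mulrC -ler_pdivlMr.
  by move: h2; rewrite intrD ltr_pdivrMr // -/z mulrDl mul1r [_ * z%:~R]mulrC.
have : expi r = 1 :> C.
  by rewrite /r expiD e1 -expi_conj expi_int rmorph1 mulr1.
rewrite /expi => -[cr _]; apply/eqP; rewrite -subr_eq0 -/r.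
have rE : r = (r / 2) *+ 2 by rewrite mulr2n -splitr.
have h2 : r / 2 < pi by rewrite ltr_pdivrMr // mulrC.
have : sin (r / 2) = 0.
  have c1 : cos (r / 2) ^+ 2 = 1.
    by move: cr; rewrite {1}rE cos_mulr2n mulr2n; lra.
  by apply/eqP; rewrite -sqrf_eq0 sin2cos2 c1 subrr.
move: r0; rewrite le_eqVlt => /orP [/eqP <- _ //|rp].
have /sin_gt0_pi : 0 < r / 2 < pi by rewrite h2 andbT divr_gt0.
by move=> + e; rewrite e ltxx.
Qed.

Local Notation N := ((k + n)%:R : R).
Local Notation Z := (@zeta R n k).
Let N_neq0 : N != 0. Proof. by rewrite pnatr_eq0 -lt0n. Qed.

Lemma zetaD t u : Z (t + u) = Z t * Z u.
Proof. by rewrite /zeta mulrDr mulrDl expiD. Qed.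

Lemma zeta0 : Z 0 = 1. Proof. by rewrite /zeta mulr0 mul0r expi0. Qed.

Lemma zeta_conj t : (Z t)^* = Z (- t).
Proof. by rewrite /zeta expi_conj mulrN mulNr. Qed.

Lemma zetaVl t : Z (- t) * Z t = 1.
Proof. by rewrite -zetaD addNr zeta0. Qed.

Lemma zeta_neq0 t : Z t != 0.
Proof. by apply/eqP => e; have := zetaVl t; rewrite e mulr0 => /esym/eqP; rewrite oner_eq0. Qed.

Lemma zetaN t : Z (- t) = (Z t)^-1.
Proof. by apply: (mulIf (zeta_neq0 t)); rewrite zetaVl mulVf ?zeta_neq0. Qed.

Lemma norm_zeta t : `|Z t| = 1.
Proof.
apply/eqP; rewrite -(@pexpr_eq1 _ _ 2) ?normr_ge0 //.
by rewrite normCK zeta_conj mulrC zetaVl.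
Qed.

Lemma zetaX t a : Z t ^+ a = Z (t * a%:R).
Proof.
elim: a => [|a IH]; first by rewrite mulr0 zeta0.
by rewrite exprSr IH -[a.+1%:R]natr1 mulrDr mulr1 zetaD.
Qed.

Lemma zeta_sum (J : finType) (f : J -> R) : \prod_j Z (f j) = Z (\sum_j f j).
Proof. by rewrite (big_morph _ zetaD zeta0). Qed.

Lemma zeta_int (z : int) : Z (N * z%:~R) = 1.
Proof. by rewrite /zeta mulrA mulrAC mulfK // expi_int. Qed.

Lemma zeta_eq1 t : Z t = 1 -> exists z : int, t = N * z%:~R.
Proof.
move=> /expi_eq1 [z e]; exists z.
have pi0 : 2 * pi != 0 :> R by rewrite mulf_neq0 // lt0r_neq0 // pi_gt0.
by apply: (mulfI pi0); rewrite mulrCA -e [RHS]mulrC divfK.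
Qed.

(** This turns the sign of -1/x_j into an exponent, which makes up for the half
integers in the tuple I. *)
Lemma zeta_half : Z (N / 2) = - 1.
Proof.
rewrite /zeta (_ : 2 * pi * (N / 2) / N = pi); last by field; rewrite -natrD N_neq0.
by rewrite /expi cospi sinpi; apply/eqP; rewrite eq_complex /= oppr0 !eqxx.
Qed.

End Zeta.

(** * The Bethe roots and their complement *)

Section UnityProduct.
Variables (F : fieldType) (N : nat) (b : 'I_N -> F) (c : F).
Hypotheses (N0 : (0 < N)%N) (b_inj : injective b) (b0 : forall m, b m != 0)
  (bN : forall m, b m ^+ N = c).

(** The difference of the two sides has degree at most N and vanishes at 0 and
at the N inverses of the b_m. *)
Lemma unity_prod : \prod_m (1 - b m *: 'X) = 1 - c *: 'X^N :> {poly F}.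
Proof.
apply/eqP; rewrite -subr_eq0; set G := _ - _.
have sG : (size G <= N.+1)%N.
  apply: leq_trans (size_polyD _ _) _; rewrite geq_max size_polyN.
  apply/andP; split; last first.
    apply: leq_trans (size_polyD _ _) _; rewrite geq_max size_poly1 size_polyN /=.
    by apply: leq_trans (size_scale_leq _ _) _; rewrite size_polyXn.
  rewrite (eq_bigr (fun m => 1 + (- b m) *: 'X)) => [|m _]; last by rewrite scaleNr.
  by apply/leq_sizeP => j jN; rewrite coef_prod_1DX_gt.
apply/negPn/negP => G0; have rs : all (root G) (0 :: [seq (b m)^-1 | m : 'I_N]).
  rewrite /= rootE; apply/andP; split.
    rewrite /G !hornerE horner_prod big1 => [|m _].
      by rewrite expr0n eqn0Ngt N0 mulr0 subr0 subrr.
    by rewrite !hornerE ?mulr0 ?oppr0 ?subr0 ?addr0.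
  apply/allP => _ /mapP [m _ ->]; rewrite rootE /G !hornerE horner_prod.
  rewrite (bigD1 m) //= !hornerE mulfV // subrr mul0r sub0r oppr_eq0.
  by rewrite -(bN m) exprVn mulfV ?subrr // expf_neq0.
have := max_poly_roots G0 rs; rewrite /= size_map size_enum_ord ltnNge sG.
move=> /(_ _)/negP; apply => //.
rewrite map_inj_uniq ?enum_uniq ?andbT; last by move=> i j /invr_inj; apply: b_inj.
by apply/mapP => -[m _ /esym/eqP]; rewrite invr_eq0 (negbTE (b0 m)).
Qed.

(** The quotient of 1 - a^N X^N by 1 - a X is a geometric sum. *)
Lemma geometric_coef (a : F) (p : {poly F}) m : a ^+ N = c ->
  (1 - a *: 'X) * p = 1 - c *: 'X^N -> (m < N)%N -> p`_m = a ^+ m.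
Proof.
move=> aN pE mN; have /(congr1 (fun q : {poly F} => q`_m)) : p = \poly_(r < N) a ^+ r.
  have a1 : 1 - a *: 'X != 0 :> {poly F}.
    apply/negP => /eqP/(congr1 (fun q : {poly F} => q`_0)).
    by rewrite coefB coefZ coefX mulr0 subr0 coef1 coef0 => /eqP; rewrite oner_eq0.
  apply: (mulfI a1); rewrite pE; apply/polyP => j.
  rewrite coefB coefZ coef1 coefXn mulrBl mul1r coefB -scalerAl coefZ coefXM !coef_poly.
  case: j => [|j]; first by rewrite N0 /= (ltn_eqF N0) !mulr0 !subr0.
  rewrite /= mulr0n sub0r; case: (ltngtP j.+1 N) => jN.
  - by rewrite -exprS mulr0 subrr oppr0.
  - by rewrite !mulr0 subrr oppr0.
  - by rewrite -exprS jN aN mulr1 sub0r.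
by rewrite coef_poly mN.
Qed.

End UnityProduct.

Lemma conjc_count n (s : seq nat) j : (size s <= n)%N ->
  conjc n (nth 0%N s) j = count (fun p => (j < p)%N) s.
Proof.
move=> sn; rewrite /conjc -sum1_count (big_nth 0%N) [RHS]big_mkcond /= big_mkord.
rewrite (big_ord_widen n (fun i => if (j < nth 0%N s i)%N then 1%N else 0%N)) //.
rewrite [RHS]big_mkcond; apply: eq_bigr => i _.
case: (ltnP i (size s)) => h; last by rewrite nth_default.
by case: (j < _)%N.
Qed.

Lemma part_homo s : is_partition s ->
  {homo nth 0%N s : i j / (i <= j)%N >-> (j <= i)%N}.
Proof.
move=> sP i j ij; case: (ltnP j (size s)) => js; last by rewrite nth_default.
apply: (sorted_leq_nth rev_leq_trans _ 0%N sP) => //=; first exact: leqnn.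
by rewrite inE; apply: leq_ltn_trans js.
Qed.

Section BetheRoots.
Variables (R : realType) (n' k : nat) (s : seq nat).
Local Notation n := n'.+2.
Local Notation C := R[i].
Local Notation Z := (@zeta R n k).
Hypotheses (sP : is_partition s) (ssz : (size s <= n.-1)%N)
  (sk : (nth 0%N s 0 <= k)%N).

(** The points where the characters are evaluated; w is the tuple of their
conjugates, that is of their inverses. *)
Definition yroot (i : 'I_n) : C := Z (xi_pt R n s i).
Definition wroot (i : 'I_n) : C := (yroot i)^*.

Let N0 : (0 < k + n)%N. Proof. by rewrite addnC. Qed.
Let q : R := (sumn s)%:R / n%:R.
Let e0 : R := - q + (1 - n%:R) / 2.
Let b (m : 'I_(n + k)) : C := Z (e0 + m%:R).

Lemma run_inj : injective b.
Proof.
move=> m1 m2 /eqP; rewrite -subr_eq0 subr_eq add0r => /eqP e; apply: val_inj.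
have : Z (m1%:R - m2%:R) = 1.
  rewrite (_ : m1%:R - m2%:R = (e0 + m1%:R) - (e0 + m2%:R)); last by ring.
  by rewrite zetaD -/(b m1) e /b -zetaD // subrr zeta0.
case/(zeta_eq1 N0) => z; have := ltn_ord m1; have := ltn_ord m2 => h2 h1.
have -> : (k + n)%:R * z%:~R = ((k + n)%:Z * z)%:~R :> R by rewrite intrM.
have -> : m1%:R - m2%:R = (m1%:Z - m2%:Z)%:~R :> R by rewrite rmorphB.
move/intr_inj => h; case: (ltgtP z 0) => z0; last by move: h; rewrite z0 mulr0 /=; lia.
  have : (k + n)%:Z * z <= (k + n)%:Z * (- 1) by rewrite ler_pM2l; lia.
  by rewrite -h /= ; lia.
have : (k + n)%:Z * 1 <= (k + n)%:Z * z by rewrite ler_pM2l; lia.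
by rewrite -h /=; lia.
Qed.

Let c : C := Z (e0 * (n + k)%:R).

Lemma run_period m : b m ^+ (n + k) = c.
Proof.
rewrite /b zetaX mulrDl zetaD /c.
rewrite [X in _ * Z X](_ : _ = (k + n)%:R * (m%:Z)%:~R).
  by rewrite zeta_int // mulr1.
by rewrite mulrC; congr (_%:R * _); rewrite addnC.
Qed.

Lemma wrootE i : wroot i = Z (e0 + ((nth 0%N s i + (n - i.+1))%N)%:R).
Proof.
rewrite /wroot /yroot zeta_conj; congr (Z _); rewrite /xi_pt opprK /e0 /q natrD.
rewrite natrB // -[n.+1%:R]natr1; set nn : R := n%:R; set ii : R := i.+1%:R.
set ss : R := _ / nn; by field.
Qed.

Lemma xptE (j : 'I_k) : (xpt R n k s j)^-1 =
  - Z (e0 + n%:R + (rev_ord j)%:R - (nth 0%N (conj_part s) (rev_ord j))%:R).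
Proof.
rewrite /xpt -zetaD -zetaN -[RHS]mulN1r.
have -> : - 1 = Z (- ((k + n)%:R / 2)) by rewrite zetaN zeta_half // invrN invr1.
rewrite -zetaD; congr (Z _); rewrite /Itup /e0 -/q natrD -[k.+1%:R]natr1.
rewrite -[(rev_ord j).+1%:R]natr1; set a := (nth _ _ _)%:R; set r := (rev_ord j)%:R.
by field.
Qed.

(** The w_i have exponents s_i + n - 1 - i, and the -1/x_j have exponents n + j
- s'_j, up to the same constant e0; the complementarity of [maya_perm] then
applies. The half integers in the tuple I and the sign of -1/x_j combine into
integers. *)
Lemma bethe_roots_perm : exists sp : 'S_(n + k),
  (forall i : 'I_n, wroot i = b (sp (lshift k i))) /\
  (forall j : 'I_k, (xpt R n k s j)^-1 = - b (sp (rshift n (rev_ord j)))).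
Proof.
have [s0 H] := maya_perm n k.
have [|sp [m1 m2] _] := H (nth 0%N s) (part_homo sP) _ sk.
  by rewrite nth_default // (leq_trans ssz).
exists sp; split=> [i|j]; first by rewrite wrootE /b m1.
rewrite xptE /b; congr (- Z _); have := m2 (rev_ord j).
rewrite conjc_count ?(leq_trans ssz) // -nth_conj_part //.
move=> /(congr1 (fun a => a%:R : R)); rewrite !natrD => e.
by rewrite -[e0 + _ + _]addrA -e; ring.
Qed.

Lemma wroot_inj : injective wroot.
Proof.
have [sp [wE _]] := bethe_roots_perm => i j; rewrite !wE => /run_inj /perm_inj.
exact: lshift_inj.
Qed.

Lemma wroot_per i : wroot i ^+ (n + k) = c.
Proof. by have [sp [-> _]] := bethe_roots_perm; exact: run_period. Qed.

Lemma yroot_wroot i : yroot i * wroot i = 1.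
Proof. by rewrite /wroot /yroot zeta_conj mulrC zetaVl. Qed.

(** The two families together run through the N roots, so this is [unity_prod]. *)
Lemma roots_product :
  (\prod_j (1 + (xpt R n k s j)^-1 *: 'X)) * \prod_i (1 - wroot i *: 'X) =
  1 - c *: 'X^(n + k) :> {poly C}.
Proof.
have [sp [wE xE]] := bethe_roots_perm.
rewrite -(unity_prod _ run_inj _ run_period); [|by []|by move=> m; apply: zeta_neq0].
rewrite [RHS](reindex_inj (@perm_inj _ sp)) big_split_ord mulrC /=; congr (_ * _).
  by apply: eq_bigr => i _; rewrite wE.
rewrite [LHS](reindex_inj rev_ord_inj); apply: eq_bigr => j _.
by rewrite xE rev_ordK scaleNr.
Qed.

(** By [roots_product], the product of the 1 + X/x_j and of all 1 - w_l X with l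
different from i is (1 - c X^N) / (1 - w_i X), whose coefficients below N are
the powers of w_i; so [alt_jt] applies. *)
Lemma bethe_alt (m : weight n) : level m = k ->
  \det (alt (tail m) wroot) =
  \det (alt (fun=> 0%N) wroot) *
  jt n (tail m) (\prod_j (1 + (xpt R n k s j)^-1 *: 'X)).
Proof.
move=> mk; apply: (@alt_jt _ _ (n + k) _ _
   (fun i => \prod_(l | l != i) (1 - wroot l *: 'X))) => //.
- move=> i; apply: leq_trans (size_poly_prod_leq _ _) _.
  have cn : #|[pred l | l != i]| = n.-1 by have := cardC1 i; rewrite card_ord.
  have : (\sum_(l | l != i) size (1 - wroot l *: 'X : {poly C})%R <= \sum_(l | l != i) 2)%N.
    apply: leq_sum => l _; apply: leq_trans (size_polyD _ _) _.
    rewrite geq_max size_poly1 size_polyN /=.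
    by apply: leq_trans (size_scale_leq _ _) _; rewrite size_polyX.
  rewrite sum_nat_const (eq_card (B := [pred l | l != i])) // cn => hS.
  by apply: (leq_trans (leq_sub2r _ (hS : (_ < (n.-1 * 2).+1)%N))); lia.
- rewrite -horner_coef0 horner_prod big1 // => j _.
  by rewrite !hornerE.
- move=> i a ak; apply: (@geometric_coef _ _ c _ _ _ a) ak => //.
  + exact: wroot_per.
  + by rewrite -roots_product [in RHS](bigD1 i) //= mulrCA.
- exact: leq_addr.
- move=> j jn; have := tail_homo m (leq0n j); rewrite tail0 mk; lia.
Qed.

Lemma alt_conj (d : nat -> nat) : (\det (alt d yroot))^* = \det (alt d wroot).
Proof.
rewrite -det_map_mx; congr (\det _); apply/matrixP => i j.
by rewrite !mxE rmorphXn.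
Qed.

End BetheRoots.

(** * Bethe vectors: characters and eigenvalues *)

Lemma det_alt0 (F : comNzRingType) n (w : 'I_n -> F) : exists sg : bool,
  \det (alt (fun=> 0%N) w) =
  (-1) ^+ sg * \prod_(i < n) \prod_(j < n | (i < j)%N) (w j - w i).
Proof.
pose V := Vandermonde n (\row_j w j).
pose rv : 'S_n := perm (@rev_ord_inj n); exists (odd_perm rv).
have -> : alt (fun=> 0%N) w = (row_perm rv V)^T.
  by apply/matrixP => i j; rewrite !mxE permE add0n.
rewrite det_tr row_permE det_mulmx det_perm det_Vandermonde; congr (_ * _).
by apply: eq_bigr => i _; apply: eq_bigr => j _; rewrite !mxE.
Qed.

Lemma sumn_nth n (s : seq nat) : (size s <= n)%N ->
  sumn s = (\sum_(i < n) nth 0 s i)%N.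
Proof.
move=> sn; rewrite sumnE (big_nth 0%N) big_mkord.
rewrite (big_ord_widen n (nth 0%N s)) // big_mkcond /=.
by apply: eq_bigr => i _; case: ltnP => // h; rewrite nth_default.
Qed.

(** A strictly decreasing tuple is determined by the set of its entries. *)
Lemma strict_dec_eq n (f g : 'I_n -> nat) (h : 'I_n -> 'I_n) :
  {homo f : i j / (i < j)%N >-> (j < i)%N} ->
  {homo g : i j / (i < j)%N >-> (j < i)%N} ->
  injective h -> (forall i, f i = g (h i)) -> f =1 g.
Proof.
move=> fd gd hi fg.
have srt (e : 'I_n -> nat) : {homo e : i j / (i < j)%N >-> (j < i)%N} ->
    sorted gtn [seq e i | i : 'I_n].
  move=> ed; rewrite /image_mem -(map_id (enum 'I_n)) in |- *.
  have : sorted ltn [seq val i | i <- enum 'I_n] by rewrite val_enum_ord iota_ltn_sorted.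
  by rewrite map_id !sorted_map; apply: sub_sorted => i j; apply: ed.
have E : [seq f i | i : 'I_n] = [seq g i | i : 'I_n].
  have gtn_trans : transitive gtn by move=> a b c ba cb; apply: ltn_trans cb ba.
  apply: (irr_sorted_eq gtn_trans ltnn (srt f fd) (srt g gd)) => a.
  apply/mapP/mapP => -[i _ ->].
    by exists (h i); rewrite ?mem_enum ?fg.
  by exists (invF hi i); rewrite ?mem_enum // fg f_invF.
by move=> i; apply: ((eq_in_map f g (enum 'I_n)).2 E); rewrite mem_enum.
Qed.

Lemma nth_part_of_weight n (l : weight n.+2) (i : nat) :
  nth 0%N (part_of_weight l) i = (\sum_(j < n.+2 | (i < j)%N) l j)%N.
Proof.
rewrite /part_of_weight; case: (ltnP i n.+1) => iN; first by rewrite nth_mkseq.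
rewrite nth_default ?size_mkseq // big_pred0 // => j; have := ltn_ord j; move: iN => /=; lia.
Qed.

Lemma part_of_weight_partition n (l : weight n.+2) : is_partition (part_of_weight l).
Proof.
apply/(sortedP 0%N) => i; rewrite size_mkseq => iN; rewrite !nth_part_of_weight.
rewrite /= [X in (X <= _)%N]big_mkcond [X in (_ <= X)%N]big_mkcond /=.
by apply: leq_sum => j _; case: ltnP => // h; rewrite (ltnW h).
Qed.

Section BetheVectors.
Variables (R : realType) (n' k : nat).
Local Notation n := n'.+2.
Local Notation C := R[i].
Implicit Types (s : seq nat).

(** The exponents xi_i add up to 0: subtracting the mean |sigma|/n and centring
the staircase serve this purpose. *)
Lemma prod_wroot s : (size s <= n)%N -> \prod_i wroot R k s (i : 'I_n) = 1.
Proof.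
move=> ssz; rewrite (eq_bigr (fun i => zeta n k (- xi_pt R n s i))); last first.
  by move=> i _; rewrite /wroot /yroot zeta_conj.
rewrite zeta_sum -(zeta0 R n k); congr (zeta _ _ _).
rewrite sumrN; apply/eqP; rewrite oppr_eq0 /xi_pt sumrN oppr_eq0; apply/eqP.
pose nn : R := n%:R; have nn0 : nn != 0 by rewrite pnatr_eq0.
transitivity (\sum_(i < n) ((nth 0%N s i)%:R - (sumn s)%:R / nn) +
              \sum_(i < n) ((nn - 1) / 2 - i%:R) : R).
  rewrite -big_split /=; apply: eq_bigr => i _.
  rewrite -[n.+1%:R]natr1 -[i.+1%:R]natr1 -/nn; clearbody nn.
  by set q := _ / nn; lra.
rewrite !sumrB !sumr_const card_ord -[_ *+ n]mulr_natr -/nn -natr_sum -sumn_nth //.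
rewrite divfK // subrr add0r -mulr_natr -/nn.
have : \sum_(i < n) (i%:R : R) = \sum_(i < n) (nn - 1 - i%:R).
  rewrite [LHS](reindex_inj rev_ord_inj); apply: eq_bigr => i _ /=.
  by rewrite natrB // -[i.+1%:R]natr1 -/nn; ring.
rewrite sumrB sumr_const card_ord -mulr_natr -/nn => e.
by apply/eqP; rewrite subr_eq0; apply/eqP; move: e; set S := \sum_(i < n) _; lra.
Qed.

Section OneRoot.
Variable s : seq nat.
Hypotheses (sP : is_partition s) (ssz : (size s <= n.-1)%N)
  (sk : (nth 0%N s 0 <= k)%N).
Local Notation y := (@yroot R n' k s).
Local Notation w := (@wroot R n' k s).
Local Notation d0 := (\det (alt (fun=> 0%N) w)).

Lemma alt0_neq0 : d0 != 0.
Proof.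
have [sg ->] := det_alt0 w; rewrite mulf_neq0 ?signr_eq0 //.
apply/prodf_neq0 => i _; apply/prodf_neq0 => j ij; rewrite subr_eq0.
by apply/eqP => /(wroot_inj sP ssz sk) e; rewrite e ltnn in ij.
Qed.

Lemma norm_alt0 : `|d0| = \prod_(i < n) \prod_(j < n | (i < j)%N) `|w j - w i|.
Proof.
have [sg ->] := det_alt0 w; rewrite normrM normrX normrN1 expr1n mul1r.
by rewrite normr_prod; apply: eq_bigr => i _; rewrite normr_prod.
Qed.

(** Particles at site 0 multiply row a of the alternant by a power of w_a, and
the product of the w_a is 1. *)
Lemma alt_tail (l : weight n) :
  \det (alt (tail l) w) = \det (alt (nth 0%N (part_of_weight l)) w).
Proof.
have -> : alt (tail l) w =
    \matrix_(a, j) (w a ^+ (l ord0) * 1 * alt (nth 0%N (part_of_weight l)) w a j).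
  apply/matrixP => a j; rewrite !mxE mulr1 -exprD nth_part_of_weight.
  by rewrite /tail ltn_ord addnCA addnA.
rewrite det_scale_row_col; under eq_bigr do rewrite mulr1.
by rewrite prodrXl prod_wroot ?expr1n ?mul1r // (leq_trans ssz).
Qed.

(** The classical quotient formula: both the tableau sum and the quotient of
alternants are determinants of elementary symmetric polynomials. *)
Lemma schur_alt (l : weight n) :
  \det (alt (nth 0%N (part_of_weight l)) y) =
  \det (alt (fun=> 0%N) y) * schur (part_of_weight l) y.
Proof.
have lP := part_of_weight_partition l.
rewrite schur_jt // (dual_jacobi_trudi (b := head 0%N (part_of_weight l)) y (part_homo lP)).
- congr (_ * _); apply: eq_jt => i _.
  by rewrite nth_conj_part // conjc_count // size_mkseq.
- by rewrite nth_default // size_mkseq.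
- by rewrite nth0.
Qed.

Lemma bethe_chi (l : weight n) :
  (bethe n (xpt R n k s))@_l =
  if level l == k then (chi k (part_of_weight l) (xi_pt R n s))^* else 0.
Proof.
rewrite bethe_coef; case: eqP => // lk.
apply: (mulfI alt0_neq0); rewrite -bethe_alt // alt_tail -alt_conj schur_alt.
by rewrite rmorphM /= alt_conj.
Qed.

Lemma bethe_alt_coef (l : weight n) :
  (bethe n (xpt R n k s))@_l =
  if level l == k then \det (alt (tail l) w) / d0 else 0.
Proof.
rewrite bethe_coef; case: eqP => // lk.
by rewrite bethe_alt // mulrC mulKf // alt0_neq0.
Qed.

Definition esym_yroot (r : nat) : C := (\prod_i (1 + y i *: 'X))`_r.

(** The coefficients of the Bethe vector are alternants in w divided by a
constant, and the action of e_r on coefficients is the left side of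
[cyclic_pieri]. *)
Lemma nce_bethe (r : nat) :
  nce R n r (bethe n (xpt R n k s)) = esym_yroot r *: bethe n (xpt R n k s).
Proof.
apply/malgP => m; rewrite mcoeffZ nce_coef bethe_alt_coef.
case: (eqVneq (level m) k) => mk; last first.
  rewrite mulr0 big1 // => I _; case: ifP => // mI.
  by rewrite bethe_alt_coef level_move_preimage // (negbTE mk).
rewrite mulrA -(cyclic_pieri (yroot_wroot _ _ s) _ (wroot_per _ sP ssz sk)) //; last first.
  by rewrite prod_wroot // (leq_trans ssz).
rewrite mulr_suml; apply: eq_bigr => I _; case: ifP => mI; last by rewrite mul0r.
by rewrite bethe_alt_coef level_move_preimage // mk eqxx.
Qed.

End OneRoot.
End BetheVectors.

(** * Separation of the spectrum *)

Section Separation.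
Variables (R : realType) (n' k : nat).
Local Notation n := n'.+2.

(** Equal values of all e_r mean that the roots y of s and of t agree up to a
permutation h. Comparing exponents, the shifted parts F of s and of t differ by
a constant D modulo N. Both tuples lie in [0, N) and contain 0, and the sums of
the exponents are normalised to 0; this leaves no multiple of N and forces D =
0, so the shifted parts coincide as sets, and both are decreasing. *)
Lemma esym_yroot_inj (s t : seq nat) :
  is_partition s -> size s = n.-1 -> (nth 0 s 0 <= k)%N ->
  is_partition t -> size t = n.-1 -> (nth 0 t 0 <= k)%N ->
  (forall r, esym_yroot R n' k s r = esym_yroot R n' k t r) -> s = t.
Proof.
move=> sP ss sk tP ts tk st.
have polyE : \prod_i (1 + @yroot R n' k s i *: 'X) = \prod_i (1 + @yroot R n' k t i *: 'X).
  by apply/polyP => r; apply: st.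
have /fin_all_exists [h hE] i : exists j, @wroot R n' k s i = @wroot R n' k t j.
  have : (\prod_i (1 + @yroot R n' k t i *: 'X)).[- @wroot R n' k s i] = 0.
    rewrite -polyE horner_prod (bigD1 i) //= !hornerE.
    by rewrite mulrN yroot_wroot subrr mul0r.
  rewrite horner_prod => /eqP/prodf_eq0 [j _]; rewrite !hornerE mulrN subr_eq0 => /eqP e.
  exists j; apply: (@mulfI _ (@yroot R n' k t j)); last by rewrite yroot_wroot -e.
  by apply: zeta_neq0.
have N0 : (0 < k + n)%N by rewrite addnC.
(* The shifted parts: strictly decreasing, below N, and ending with 0. *)
pose F (u : seq nat) (i : 'I_n) := (nth 0 u i + (n - i.+1))%N.
have Flt (u : seq nat) i : is_partition u -> (nth 0 u 0 <= k)%N -> (F u i < k + n)%N.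
  move=> uP uk; rewrite /F; have := part_homo uP (leq0n i); have := ltn_ord i; lia.
have Fdec (u : seq nat) : is_partition u ->
    {homo F u : i j / (i < j)%N >-> (j < i)%N}.
  move=> uP i j ij; rewrite /F; have := part_homo uP (ltnW ij).
  have := ltn_ord j; lia.
pose qs : R := (sumn s)%:R / n%:R; pose qt : R := (sumn t)%:R / n%:R.
have /fin_all_exists [z zE] i : exists z : int,
    qt - qs + (F s i)%:R - (F t (h i))%:R = (k + n)%:R * z%:~R.
  apply: (zeta_eq1 N0); have := hE i; rewrite !wrootE -/qs -/qt -!/(F _ _) => e.
  rewrite (_ : _ - _ = (- qs + (1 - n%:R) / 2 + (F s i)%:R) -
     (- qt + (1 - n%:R) / 2 + (F t (h i))%:R)); last by ring.
  by rewrite zetaD e -zetaD // subrr zeta0.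
have h_inj : injective h.
  move=> i j e; apply: (@wroot_inj R n' k s sP _ sk); first by rewrite ss.
  by rewrite !hE e.
have Fl u : size u = n.-1 -> F u ord_max = 0%N.
  by move=> us; rewrite /F nth_default ?us //= subnn.
pose D : int := (F t (h ord_max))%:Z + (k + n)%:Z * z ord_max.
have DE : qt - qs = D%:~R.
  have := zE ord_max; rewrite Fl // mulr0n addr0 => e.
  by rewrite /D intrD intrM -e [RHS]addrC subrK.
have zE' i : D + (F s i)%:Z - (F t (h i))%:Z = (k + n)%:Z * z i.
  by have := zE i; rewrite DE => e; apply: (@intr_inj R); rewrite [RHS]intrM -[RHS]e !intrD mulrNz.
have nD : n%:Z * D = (sumn t)%:Z - (sumn s)%:Z.
  apply: (@intr_inj R); rewrite intrM -DE intrD mulrNz /qt /qs mulrBr.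
  by rewrite !mulrA ![n%:Z%:~R * _]mulrC !mulfK // pnatr_eq0.
(* Summing over i, the difference of the sums of shifted parts is n D. *)
have sumz : \sum_i z i = 0.
  have : \sum_i (D + (F s i)%:Z - (F t (h i))%:Z) = (k + n)%:Z * \sum_i z i.
    by rewrite mulr_sumr; apply: eq_bigr => i _; apply: zE'.
  rewrite sumrB big_split /= sumr_const card_ord -mulr_natl.
  rewrite -(reindex_inj h_inj (P := xpredT) (F := fun i => (F t i)%:Z)) /=.
  have FS u : size u = n.-1 ->
      \sum_(i < n) (F u i)%:Z = (sumn u)%:Z + (\sum_(i < n) (n - i.+1))%N%:Z.
    move=> us; rewrite -PoszD (@sumn_nth n) ?us // -big_split /=.
    by rewrite (big_morph Posz PoszD (erefl _)).
  rewrite !FS // => e; have : (k + n)%:Z * \sum_i z i = 0.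
    by rewrite -e natz nD; ring.
  by move/eqP; rewrite mulf_eq0 => /orP [|/eqP //]; lia.
(* If D >= 0 the left side exceeds - N, so no z_i is negative; if D < 0 none
   is positive. The sum being 0, all of them vanish. *)
have z0 : forall i, z i = 0.
  case: (lerP 0 D) => D0 i.
    have z_ge0 j : 0 <= z j.
      rewrite leNgt; apply/negP => zj; have := zE' j; have := Flt t (h j) tP tk.
      have : (k + n)%:Z * z j <= (k + n)%:Z * (- 1) by rewrite ler_pM2l; lia.
      lia.
    by move/eqP: sumz; rewrite psumr_eq0 // => /allP/(_ i (mem_index_enum _))/eqP.
  have z_le0 j : 0 <= - z j.
    rewrite oppr_ge0 leNgt; apply/negP => zj; have := zE' j; have := Flt s j sP sk.
    have : (k + n)%:Z * 1 <= (k + n)%:Z * z j by rewrite ler_pM2l; lia.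
    lia.
  have /eqP : \sum_i - z i = 0 by rewrite sumrN sumz oppr0.
  by rewrite psumr_eq0 // => /allP/(_ i (mem_index_enum _)); rewrite oppr_eq0 => /eqP.
have D0 : D = 0.
  have h1 := zE' ord_max; have h2 := zE' (invF h_inj ord_max).
  move: h1 h2; rewrite f_invF !z0 !mulr0 !Fl //; lia.
have FE i : F s i = F t (h i).
  by have := zE' i; rewrite z0 D0 mulr0; lia.
have FE' := strict_dec_eq (Fdec s sP) (Fdec t tP) h_inj FE.
apply: (eq_from_nth (x0 := 0%N)); first by rewrite ss.
move=> i; rewrite ss => iN; have iN' : (i < n)%N by apply: leq_trans iN _.
by have := FE' (Ordinal iN'); rewrite /F /= => /addIn.
Qed.

End Separation.

(** * Weights, partitions and exponent functions *)

Section PkWeights.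
Variables (n' k : nat).
Local Notation n := n'.+2.

Lemma level_Pk (m : Pk n k) : level m = k.
Proof.
by apply: etrans (eqP (valP m)); apply: eq_bigr => i _; rewrite ffunE.
Qed.

Lemma Pk_weight_inj : injective (@Pk_weight n k).
Proof.
move=> l m e; apply: val_inj; apply/ffunP => i; apply: val_inj.
by have := congr1 (fun u : weight n => u i) e; rewrite !ffunE.
Qed.

Lemma Pk_of_weight (w : weight n) : level w = k -> exists m : Pk n k, Pk_weight m = w.
Proof.
move=> wk; have wi i : (w i <= k)%N by rewrite -wk /level (bigD1 i) //= leq_addr.
have H : (\sum_i [ffun i : 'I_n => inord (w i) : 'I_k.+1] i == k)%N.
  rewrite -[X in _ == X]wk; apply/eqP; apply: eq_bigr => i _.
  by rewrite ffunE inordK // ltnS.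
pose m : Pk n k := exist (fun g : {ffun 'I_n -> 'I_k.+1} => (\sum_i g i == k)%N) _ H.
by exists m; apply/ffunP => i; rewrite !ffunE /= inordK // ltnS.
Qed.

Lemma part_of_weightS (w : weight n) (i : 'I_n) : (i.+1 < n)%N ->
  nth 0%N (part_of_weight w) i = (w (ordS i) + nth 0%N (part_of_weight w) i.+1)%N.
Proof.
move=> iN; rewrite !nth_part_of_weight (bigD1 (ordS i)) /= ?modn_small //.
by congr (_ + _)%N; apply: eq_bigl => j; rewrite -val_eqE /= modn_small //; lia.
Qed.

Lemma part_of_weight0 (w : weight n) :
  level w = (w ord0 + nth 0%N (part_of_weight w) 0)%N.
Proof.
rewrite nth_part_of_weight /level (bigD1 ord0) //=; congr (_ + _)%N.
by apply: eq_bigl => j; rewrite lt0n.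
Qed.

Lemma part_of_weight_inj (v w : weight n) : level v = level w ->
  part_of_weight v = part_of_weight w -> v = w.
Proof.
move=> lvw pvw; apply/ffunP => j; rewrite -[j]ord_predK; set i := ord_pred j.
case: (ltnP i.+1 n) => iN.
  by have := part_of_weightS v iN; rewrite pvw (part_of_weightS w iN) => /addIn.
have -> : ordS i = ord0 by apply: ordS_last.
by move: lvw; rewrite !part_of_weight0 pvw => /addIn.
Qed.

Lemma size_part_of_weight (w : weight n) : size (part_of_weight w) = n.-1.
Proof. by rewrite size_mkseq. Qed.

Lemma part_of_weight_le (w : weight n) : level w = k ->
  (nth 0 (part_of_weight w) 0 <= k)%N.
Proof. by rewrite part_of_weight0 => <-; rewrite leq_addl. Qed.

(** The multiplicities are the successive differences of the parts, and site 0
takes the particles that are missing to level k. *)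
Lemma weight_of_part (s : seq nat) : is_partition s -> size s = n.-1 ->
  (nth 0 s 0 <= k)%N -> exists m : Pk n k, part_of_weight m = s.
Proof.
move=> sP ss sk.
pose w : weight n := [ffun i => if i == ord0 then (k - nth 0 s 0)%N
                       else (nth 0 s i.-1 - nth 0 s i)%N].
have sle := part_homo sP.
have wE d (i : nat) : (n.-1 - i)%N = d -> nth 0%N (part_of_weight w) i = nth 0%N s i.
  elim: d i => [|d IH] i di.
    by rewrite !nth_default ?size_part_of_weight ?ss //; lia.
  have iN : (i < n)%N by lia.
  have iN' : ((Ordinal iN).+1 < n)%N by rewrite /=; lia.
  have e : nth 0%N (part_of_weight w) i =
      (w (ordS (Ordinal iN)) + nth 0%N (part_of_weight w) i.+1)%N.
    exact: (part_of_weightS w iN').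
  rewrite e IH; last by lia.
  rewrite ffunE -val_eqE /= modn_small //=.
  by have := sle i i.+1 (leqnSn _); lia.
have wk : level w = k.
  by rewrite part_of_weight0 (wE _ _ erefl) ffunE eqxx subnK.
have [m me] := Pk_of_weight wk; exists m; rewrite me.
apply: (eq_from_nth (x0 := 0%N)); first by rewrite size_part_of_weight ss.
by move=> i _; apply: wE.
Qed.

Lemma card_Pk : #|{: Pk n k}| = 'C(n.-1 + k, n.-1).
Proof.
rewrite -card_ord_partitions card_sig.
pose f (t : n.-tuple 'I_k.+1) : {ffun 'I_n -> 'I_k.+1} := [ffun i => tnth t i].
have fb : bijective f.
  exists (fun g : {ffun 'I_n -> 'I_k.+1} => [tuple g i | i < n]) => [t|g].
    by apply: eq_from_tnth => i; rewrite tnth_mktuple ffunE.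
  by apply/ffunP => i; rewrite ffunE tnth_mktuple.
pose Q := [pred g : {ffun 'I_n -> 'I_k.+1} | (\sum_i g i == k)%N].
transitivity #|Q|; first exact: eq_card.
rewrite -(on_card_preimset (f := f) (R := Q)); last exact: onW_bij.
apply: eq_card => t; rewrite !inE big_tuple; congr (_ == _).
by apply: eq_bigr => i _; rewrite ffunE.
Qed.

Definition shifted_part (m : weight n) (j : 'I_n) : nat :=
  (nth 0 (part_of_weight m) j + (n - j.+1))%N.

Lemma shifted_part_lt (m : Pk n k) j : (shifted_part m j < n + k)%N.
Proof.
have := part_homo (part_of_weight_partition m) (leq0n j).
have := part_of_weight_le (level_Pk m); rewrite /shifted_part.
have := ltn_ord j; lia.
Qed.

Lemma shifted_part_dec (m : weight n) :
  {homo shifted_part m : i j / (i < j)%N >-> (j < i)%N}.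
Proof.
move=> i j ij; rewrite /shifted_part.
have := part_homo (part_of_weight_partition m) (ltnW ij); have := ltn_ord j; lia.
Qed.

Lemma shifted_part_inj (m : weight n) : injective (shifted_part m).
Proof.
move=> i j e; apply: val_inj; case: (ltngtP i j) => // h;
by have := shifted_part_dec m h; rewrite e ltnn.
Qed.

Lemma shifted_part_max (m : weight n) : shifted_part m ord_max = 0%N.
Proof. by rewrite /shifted_part nth_default ?size_part_of_weight // subnn. Qed.

(** The shifted parts of the partition of m, permuted by s: an injective
exponent function with values below N that takes the value 0. *)
Definition arrange (ms : Pk n k * 'S_n) : {ffun 'I_n -> 'I_(n + k)} :=
  [ffun j => Ordinal (shifted_part_lt ms.1 (ms.2 j))].

Lemma arrange_inj : injective arrange.
Proof.
move=> [l s] [m t] e.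
have E j : shifted_part l (s j) = shifted_part m (t j).
  by have := congr1 (fun f : {ffun 'I_n -> 'I_(n + k)} => val (f j)) e; rewrite !ffunE.
have lm : shifted_part l =1 shifted_part m.
  apply: (@strict_dec_eq _ _ _ (fun i => t (s^-1 i)%g)).
  - exact: shifted_part_dec.
  - exact: shifted_part_dec.
  - by move=> i j /perm_inj /perm_inj.
  - by move=> i; rewrite -E permKV.
have elm : l = m.
  apply: Pk_weight_inj; apply: part_of_weight_inj; first by rewrite !level_Pk.
  apply: (eq_from_nth (x0 := 0%N)); first by rewrite !size_part_of_weight.
  move=> i; rewrite size_part_of_weight => iN; have iN' : (i < n)%N by apply: leq_trans iN _.
  by have := lm (Ordinal iN'); rewrite /shifted_part => /addIn.
congr (_, _) => //; apply/permP => j; apply: (@shifted_part_inj m).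
by rewrite -E elm.
Qed.

Definition hits0 (f : {ffun 'I_n -> 'I_(n + k)}) : bool :=
  injectiveb f && [exists j, f j == 0 :> nat]%N.

Lemma arrange_hits0 ms : hits0 (arrange ms).
Proof.
case: ms => m s; apply/andP; split.
  apply/injectiveP => i j; rewrite !ffunE => /(congr1 val) /=.
  by move/shifted_part_inj/perm_inj.
by apply/existsP; exists (s^-1 ord_max)%g; rewrite ffunE /= permKV shifted_part_max.
Qed.

(** All injective functions minus those with nonzero values: N (N-1) ... (N-n+1)
- (N-1) ... (N-n) = n (N-1) ... (N-n+1), which is n! times the number of
weights. *)
Lemma card_hits0 : #|[pred f | hits0 f]| = (#|{: Pk n k}| * n`!)%N.
Proof.
pose X := [set f : {ffun 'I_n -> 'I_(n + k)} | injectiveb f].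
pose P0 := [pred a : 'I_(n + k) | a != 0 :> nat]%N.
pose Y := [set f : {ffun 'I_n -> 'I_(n + k)} in ffun_on P0 | injectiveb f].
have YX : Y \subset X by apply/subsetP => f; rewrite !inE => /andP [].
have cP0 : #|P0| = (n.-1 + k)%N.
  pose z : 'I_(n + k) := Ordinal (isT : (0 < n + k)%N).
  have := cardC1 z; rewrite card_ord => e; apply: etrans e.
  by apply: eq_card => a; rewrite !inE.
have -> : #|[pred f | hits0 f]| = #|X :\: Y|.
  apply: eq_card => f; rewrite !inE /hits0 andbC negb_and.
  case: (injectiveb f); rewrite ?andbF ?andbT //= orbF.
  apply/existsP/idP => [[j /eqP j0]|H].
    by apply/negP => /ffun_onP/(_ j); rewrite inE j0.
  apply/existsP; rewrite -[[exists _, _]]negbK negb_exists; apply/negP => /forallP H'.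
  by case/negP: H; apply/ffun_onP => j; rewrite inE.
rewrite cardsD (setIidPr YX) card_inj_ffuns card_inj_ffuns_on cP0 !card_ord card_Pk.
have -> : (n + k = (n.-1 + k).+1)%N by [].
rewrite ffactSS [((n.-1 + k) ^_ n)%N]ffactnSr factS mulnC -mulnBr -bin_ffact.
rewrite -mulnA; congr (_ * _)%N; rewrite mulnC; congr (_ * _)%N; lia.
Qed.

End PkWeights.

(** * Sums of products of alternants *)

Lemma perm_eq_off n (s t : 'S_n) (j0 : 'I_n) :
  (forall j, j != j0 -> s j = t j) -> s = t.
Proof.
move=> H; apply/permP => j; case: (eqVneq j j0) => [->|/H //].
pose l := (t^-1 (s j0))%g; case: (eqVneq l j0) => [e|lj].
  by rewrite -[in RHS]e permKV.
have := H l lj; rewrite permKV => /perm_inj e.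
by rewrite e eqxx in lj.
Qed.

Section MinorSums.
Variables (F : fieldType) (n N : nat) (w y : 'I_n -> F) (c : F).
Hypotheses (wy : forall i, w i * y i = 1) (w_inj : injective w)
  (wN : forall i, w i ^+ N = c).

(** The ratio w_p y_q of two roots is an N-th root of unity. *)
Lemma geometric_sum p q :
  \sum_(a < N) (w p * y q) ^+ a = if p == q then N%:R else 0.
Proof.
case: eqP => [->|pq].
  under eq_bigr do rewrite wy expr1n.
  by rewrite sumr_const card_ord.
have t1 : w p * y q - 1 != 0.
  rewrite subr_eq0; apply/eqP => e; apply: pq; apply: w_inj.
  by rewrite -[LHS]mulr1 -(wy q) mulrCA e mulr1.
apply: (mulfI t1); rewrite mulr0 -subrX1 exprMn wN -(wN q) -exprMn wy expr1n.
by rewrite subrr.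
Qed.

Definition minor (v : 'I_n -> F) (f : {ffun 'I_n -> 'I_N}) : F :=
  \det (\matrix_(i, j) v i ^+ f j).

Lemma minorE v f : minor v f = \sum_(s : 'S_n) (-1) ^+ s * \prod_j v (s j) ^+ f j.
Proof.
rewrite /minor -det_tr; apply: eq_bigr => s _; congr (_ * _).
by apply: eq_bigr => j _; rewrite !mxE.
Qed.

(** Expanding both determinants, the sum over the entries other than j0 factors
into geometric sums, which force the two permutations to agree off j0, hence
everywhere. *)
Lemma fixed_entry_sum (j0 : 'I_n) : (0 < N)%N ->
  \sum_(f : {ffun 'I_n -> 'I_N} | f j0 == 0 :> nat) minor w f * minor y f =
  n`!%:R * N%:R ^+ n.-1.
Proof.
move=> N0.
transitivity (\sum_(s : 'S_n) \sum_(t : 'S_n) (-1) ^+ s * (-1) ^+ t *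
   \sum_(f : {ffun 'I_n -> 'I_N} | f j0 == 0 :> nat)
     \prod_j (w (s j) * y (t j)) ^+ f j).
  under eq_bigr => f _ do rewrite !minorE big_distrlr /=.
  rewrite exchange_big /=; apply: eq_bigr => s _.
  rewrite exchange_big /=; apply: eq_bigr => t _.
  rewrite mulr_sumr; apply: eq_bigr => f _; rewrite mulrACA -big_split /=.
  by congr (_ * _); apply: eq_bigr => j _; rewrite exprMn.
have inner (s t : 'S_n) :
    \sum_(f : {ffun 'I_n -> 'I_N} | f j0 == 0 :> nat)
     \prod_j (w (s j) * y (t j)) ^+ f j = if s == t then N%:R ^+ n.-1 else 0 :> F.
  pose G j (a : 'I_N) := if (j == j0) ==> (a == 0 :> nat)%N
                         then (w (s j) * y (t j)) ^+ a else 0.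
  transitivity (\sum_(f : {ffun 'I_n -> 'I_N}) \prod_j G j (f j)).
    rewrite big_mkcond /=; apply: eq_bigr => f _; case: ifPn => f0.
      apply: eq_bigr => j _; rewrite /G; case: (eqVneq j j0) => [->|//].
      by rewrite f0.
    by rewrite (bigD1 j0) //= {1}/G eqxx (negbTE f0) mul0r.
  rewrite -bigA_distr_bigA /= (bigD1 j0) //= {1}/G eqxx /=.
  rewrite -big_mkcond /= (big_pred1 (Ordinal N0)) => [|a] /=; last first.
    by apply/eqP/eqP => [h|->]; [apply: val_inj|].
  rewrite expr0 mul1r.
  have GE j : j != j0 -> \sum_a G j a = if s j == t j then N%:R else 0.
    by move=> jj; rewrite -geometric_sum; apply: eq_bigr => a _; rewrite /G (negbTE jj).
  rewrite (eq_bigr _ GE); case: eqP => [->|st].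
    under eq_bigr do rewrite eqxx.
    rewrite prodr_const; congr (_ ^+ _).
    by have := cardC1 j0; rewrite card_ord => e; apply: etrans e; apply: eq_card.
  have [j /andP [jj /negbTE sj]] : exists j, (j != j0) && (s j != t j).
    apply/existsP; rewrite -[[exists _, _]]negbK negb_exists; apply/negP => /forallP H.
    apply: st; apply: (@perm_eq_off _ _ _ j0) => j jj.
    by have := H j; rewrite jj negbK => /eqP.
  by rewrite (bigD1 j) //= sj mul0r.
rewrite (eq_bigr (fun _ => N%:R ^+ n.-1)) => [|s _].
  by rewrite sumr_const card_Sn mulr_natl.
rewrite (eq_bigr (fun t => if t == s then N%:R ^+ n.-1 else 0)) => [|t _].
  by rewrite -big_mkcond big_pred1_eq.
rewrite inner eq_sym; case: eqP => [->|_]; last by rewrite mulr0.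
by rewrite -signr_addb addbb mul1r.
Qed.

Lemma minor_notinj v (f : {ffun 'I_n -> 'I_N}) : ~~ injectiveb f -> minor v f = 0.
Proof.
case/injectivePn => i [j ij e]; rewrite /minor -det_tr.
by apply: (determinant_alternate ij) => a; rewrite !mxE e.
Qed.

End MinorSums.

Section SumAlternants.
Variables (F : numFieldType) (n' k : nat).
Local Notation n := n'.+2.
Variables (w y : 'I_n -> F) (c : F).
Hypotheses (wy : forall i, w i * y i = 1) (w_inj : injective w)
  (wN : forall i, w i ^+ (n + k) = c).

Lemma minor_arrange (v : 'I_n -> F) (m : Pk n k) (s : 'S_n) :
  minor v (arrange (m, s)) = \det (alt (nth 0%N (part_of_weight m)) v) * (-1) ^+ s.
Proof.
rewrite /minor -[odd_perm s]odd_permV -det_perm -det_mulmx -col_permE.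
by congr (\det _); apply/matrixP => i j; rewrite !mxE ffunE.
Qed.

(** Summed over its n! arrangements, each weight contributes n! times its term,
and the arrangements are all injective exponent functions with one value 0
([card_hits0]). Since the determinant vanishes at the other functions, the sum
over them splits according to the place j0 of the value 0, with n equal
contributions. *)
Lemma sum_alt_alt :
  \sum_(m : Pk n k) \det (alt (nth 0%N (part_of_weight m)) w) *
                    \det (alt (nth 0%N (part_of_weight m)) y) =
  n%:R * (n + k)%:R ^+ n.-1.
Proof.
pose H (f : {ffun 'I_n -> 'I_(n + k)}) : F := minor w f * minor y f.
have fact0 : n`!%:R != 0 :> F by rewrite pnatr_eq0 -lt0n fact_gt0.
apply: (mulfI fact0).
transitivity (\sum_(f | hits0 f) H f); last first.
  transitivity (\sum_(j0 < n) \sum_(f : {ffun 'I_n -> 'I_(n + k)} | f j0 == 0 :> nat) H f);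
    last first.
    rewrite (eq_bigr (fun _ => n`!%:R * (n + k)%:R ^+ n.-1)) => [|j0 _]; last first.
      exact: (fixed_entry_sum wy w_inj wN).
    by rewrite sumr_const card_ord -[LHS]mulr_natl mulrCA.
  rewrite (exchange_big_dep xpredT) //= big_mkcond /=; apply: eq_bigr => f _.
  case: (boolP (injectiveb f)) => fi; last first.
    rewrite /hits0 (negbTE fi) big1 // => j _.
    by rewrite /H minor_notinj // mul0r.
  rewrite /hits0 fi /=; case: existsP => [[j /eqP fj]|H0].
    rewrite (big_pred1 j) // => l; apply/eqP/eqP => [fl|-> //].
    by move/injectiveP: fi; apply; apply: val_inj; rewrite /= fj.
  by rewrite big_pred0 // => j; apply/negbTE/negP => fj; apply: H0; exists j.
have -> : \sum_(f | hits0 f) H f = \sum_(ms : Pk n k * 'S_n) H (arrange ms).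
  transitivity (\sum_(f in @arrange n' k @: [set: _]) H f); last first.
    rewrite big_imset /=; last by move=> a b _ _; apply: arrange_inj.
    by apply: eq_bigl => ms; rewrite inE.
  (* An injective map between sets of the same cardinality is onto. *)
  apply: eq_bigl => f; symmetry; move: f; apply/subset_cardP; last first.
    by apply/subsetP => _ /imsetP [ms _ ->]; apply: arrange_hits0.
  rewrite card_imset; last exact: arrange_inj.
  by rewrite cardsT card_prod card_Sn; symmetry; apply: card_hits0.
rewrite -(pair_bigA _ (fun m s => H (arrange (m, s)))) /= mulr_sumr.
apply: eq_bigr => m _.
under eq_bigr => s _.
  rewrite /H !minor_arrange mulrACA -signr_addb addbb mulr1.
  over.
by rewrite sumr_const card_Sn mulr_natl.
Qed.

End SumAlternants.

(** * Orthogonality and norms of Bethe vectors *)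

Lemma fin_inverse (F : fieldType) (J : finType) (A B : J -> J -> F) :
  (forall s t, \sum_l A s l * B l t = (s == t)%:R) ->
  forall l m, \sum_s B l s * A s m = (l == m)%:R.
Proof.
move=> AB; pose MA : 'M[F]_#|J| := \matrix_(i, j) A (enum_val i) (enum_val j).
pose MB : 'M[F]_#|J| := \matrix_(i, j) B (enum_val i) (enum_val j).
have e1 : MA *m MB = 1%:M.
  apply/matrixP => i j; rewrite !mxE -(inj_eq enum_val_inj) -AB.
  rewrite [RHS](reindex (@enum_val J predT)) /=; last first.
    by apply: onW_bij; apply: enum_val_bij.
  by apply: eq_bigr => l _; rewrite !mxE.
move=> l m; have /matrixP/(_ (enum_rank l) (enum_rank m)) := mulmx1C e1.
rewrite !mxE (inj_eq enum_rank_inj) => <-.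
rewrite [LHS](reindex (@enum_val J predT)) /=; last first.
  by apply: onW_bij; apply: enum_val_bij.
by apply: eq_bigr => s _; rewrite !mxE !enum_rankK.
Qed.

(** Moving one particle from every site changes nothing, so the moves of the
complement undo those of I. *)
Lemma move_preimage_setC n' (I : {set 'I_n'.+2}) (m : weight n'.+2) : movable I m ->
  movable (~: I) (move_preimage I m) /\ move_preimage (~: I) (move_preimage I m) = m.
Proof.
move/movableP => H; split.
  apply/movableP => j; rewrite !inE negbK => pj jI.
  by rewrite ffunE jI (negbTE pj) subn0 addn1.
apply/ffunP => j; rewrite !ffunE !inE; have := H j.
by case: (j \in I); case: (_ \in I) => //= H'; try have := H' isT isT; lia.
Qed.

Section Hilbert.
Variables (R : realType) (n' k : nat).
Local Notation n := n'.+2.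
Local Notation C := R[i].
Local Notation Hsp := {malg C[weight n]}.
Local Notation opH := (endo Hsp).
Implicit Types (u v : Hsp) (f g : opH) (s t : seq nat).

Lemma big_msupp_Pk (u : Hsp) (G : weight n -> C) : in_Hk k u ->
  (forall m, u@_m = 0 -> G m = 0) ->
  \sum_(m <- msupp u) G m = \sum_(l : Pk n k) G l.
Proof.
move=> uk G0; pose S := [seq Pk_weight l | l : Pk n k].
rewrite (_ : \sum_(l : Pk n k) G l = \sum_(m <- S) G m); last by rewrite big_image.
rewrite [RHS](bigID (mem (msupp u))) /= [X in _ = _ + X]big1 ?addr0; last first.
  by move=> m /mcoeff_outdom /G0.
rewrite -[RHS]big_filter; apply: perm_big; apply: uniq_perm.
- exact: fset_uniq.
- by apply: filter_uniq; rewrite map_inj_uniq ?enum_uniq //; apply: Pk_weight_inj.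
move=> m; rewrite mem_filter /=; apply/idP/andP => [mu|[]//]; split=> //.
have [l <-] := Pk_of_weight (uk m mu).
by apply/mapP; exists l => //; rewrite mem_enum.
Qed.

Lemma dotH_Pk u v : in_Hk k u ->
  dotH u v = \sum_(l : Pk n k) (u@_(Pk_weight l))^* * v@_(Pk_weight l).
Proof.
by move=> uk; apply: big_msupp_Pk => // m ->; rewrite conjC0 mul0r.
Qed.

(** Term by term: the moves of I are injective on the configurations where they
are possible, and their inverse is given by the complementary moves
([move_preimage_setC]). *)
Lemma nce_adjoint (r : nat) u v : (r <= n)%N ->
  \sum_(l : Pk n k) ((nce R n r u)@_(Pk_weight l))^* * v@_(Pk_weight l) =
  \sum_(l : Pk n k) (u@_(Pk_weight l))^* * (nce R n (n - r)%N v)@_(Pk_weight l).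
Proof.
(* The moves as a map on weights of level k; the value l where the moves are
   impossible is a default. *)
move=> rn; pose mv (I : {set 'I_n}) (l : Pk n k) : Pk n k :=
  odflt l [pick l' : Pk n k | Pk_weight l' == move_preimage I l].
have mvE I (l : Pk n k) : movable I l -> Pk_weight (mv I l) = move_preimage I l.
  move=> Il; rewrite /mv; case: pickP => [l' /eqP //|H].
  have [l' e] : exists l' : Pk n k, Pk_weight l' = move_preimage I l.
    by apply: Pk_of_weight; rewrite level_move_preimage // level_Pk.
  by have := H l'; rewrite e eqxx.
transitivity (\sum_(I : {set 'I_n} | #|I| == r)
   \sum_(l : Pk n k | movable I l) (u@_(move_preimage I l))^* * v@_(Pk_weight l)).
  under eq_bigr => l _ do rewrite nce_coef rmorph_sum mulr_suml.
  rewrite exchange_big /=; apply: eq_bigr => I _.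
  rewrite [RHS]big_mkcond /=; apply: eq_bigr => l _.
  by case: ifP => // _; rewrite rmorph0 mul0r.
under [RHS]eq_bigr => l _ do rewrite nce_coef mulr_sumr.
rewrite [RHS]exchange_big /= [RHS](reindex_inj (@setC_inj _)) /=.
apply: eq_big => [I|I _].
  have := cardsC I; rewrite card_ord => e.
  apply/eqP/eqP => h; apply/eqP.
    by rewrite -(eqn_add2l #|I|) e h subnKC.
  by rewrite -(eqn_add2r #|~: I|) e h subnKC.
rewrite [LHS](reindex_onto (mv (~: I)) (mv I)) /=; last first.
  move=> l Il; apply: Pk_weight_inj; have [h1 h2] := move_preimage_setC Il.
  by rewrite mvE mvE.
rewrite [LHS]big_mkcond /=; apply: eq_bigr => l _.
case: (boolP (movable (~: I) l)) => Il.
  have [h1 h2] := move_preimage_setC Il; rewrite setCK in h1 h2.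
  rewrite !mvE // h1 /= h2.
  case: eqP => //; case; apply: Pk_weight_inj; rewrite mvE mvE //.
rewrite mulr0; case: ifP => // /andP [h1 /eqP e]; case/negP: Il.
have [h _] := move_preimage_setC h1; move: h; rewrite -mvE // e.
by [].
Qed.

Definition fits_box s := [/\ is_partition s, size s = n.-1 & (nth 0 s 0 <= k)%N].
Local Notation bv s := (bethe n (xpt R n k s)).

Lemma fits_box_weight (m : Pk n k) : fits_box (part_of_weight m).
Proof.
split; [exact: part_of_weight_partition|exact: size_part_of_weight|].
by apply: part_of_weight_le; apply: level_Pk.
Qed.

Lemma bethe_in_Hk s : in_Hk k (bv s).
Proof.
move=> m; rewrite -mcoeff_neq0 bethe_coef.
by case: (level m =P k) => // _; rewrite eqxx.
Qed.

Lemma bethe_dot s t : dotH (bv s) (bv t) =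
  \sum_(l : Pk n k) ((bv s)@_(Pk_weight l))^* * (bv t)@_(Pk_weight l).
Proof. by apply: dotH_Pk; apply: bethe_in_Hk. Qed.

Definition nce_val s (r : int) : C :=
  if r is Posz a then esym_yroot R n' k s a else 0.

Lemma nce_eig s (r : int) : fits_box s ->
  nce R n r (bv s) = nce_val s r *: bv s.
Proof.
case=> sP ss sk; case: r => a; first by rewrite nce_bethe // ss.
by rewrite scale0r.
Qed.

(** The coefficients of the Bethe vector are alternants in w over a constant,
and conjugation exchanges w and y, so [sum_alt_alt] evaluates the norm. *)
Lemma bethe_norm s : fits_box s ->
  dotH (bv s) (bv s) = n%:R * (n + k)%:R ^+ n.-1 /
    `|\det (alt (fun=> 0%N) (@wroot R n' k s))| ^+ 2.
Proof.
case=> sP ss sk; have ss' : (size s <= n.-1)%N by rewrite ss.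
have wy i : @wroot R n' k s i * yroot R k s i = 1 by rewrite mulrC yroot_wroot.
rewrite bethe_dot -(sum_alt_alt wy (wroot_inj sP ss' sk) (wroot_per R sP ss' sk)).
rewrite mulr_suml; apply: eq_bigr => l _.
rewrite bethe_alt_coef // level_Pk eqxx alt_tail //.
have quotient_norm (a d : C) : (a / d)^* * (a / d) = a * a^* / `|d| ^+ 2.
  by rewrite normCK rmorphM fmorphV /= invfM; ring.
have conj_w d : (\det (alt d (@wroot R n' k s)))^* = \det (alt d (@yroot R n' k s)).
  by rewrite -alt_conj conjCK.
by rewrite quotient_norm conj_w.
Qed.

Lemma bethe_norm_neq0 s : fits_box s -> dotH (bv s) (bv s) != 0.
Proof.
move=> sok; rewrite bethe_norm //; case: sok => sP ss sk.
rewrite mulf_neq0 ?invr_eq0 ?expf_neq0 ?pnatr_eq0 ?normr_eq0 ?alt0_neq0 ?ss //.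
by rewrite mulf_neq0 ?expf_neq0 ?pnatr_eq0.
Qed.

Lemma dotH_eig s t (r : nat) : fits_box s -> fits_box t -> (r <= n)%N ->
  (esym_yroot R n' k s r)^* * dotH (bv s) (bv t) =
  esym_yroot R n' k t (n - r) * dotH (bv s) (bv t).
Proof.
move=> sok tok rn; rewrite !bethe_dot; have := nce_adjoint (bv s) (bv t) rn.
rewrite (nce_eig r sok) (nce_eig (n - r)%N tok) => e.
transitivity (\sum_(l : Pk n k)
  ((esym_yroot R n' k s r *: bv s)@_(Pk_weight l))^* * (bv t)@_(Pk_weight l)).
  by rewrite mulr_sumr; apply: eq_bigr => l _; rewrite mcoeffZ rmorphM mulrA.
by rewrite e mulr_sumr; apply: eq_bigr => l _; rewrite mcoeffZ mulrCA.
Qed.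

(** If the product of two Bethe vectors were nonzero, [dotH_eig] for the pair
and for s with itself would show that all eigenvalues agree, against
[esym_yroot_inj]. *)
Lemma bethe_orthogonal s t : fits_box s -> fits_box t -> s != t ->
  dotH (bv s) (bv t) = 0.
Proof.
move=> sok tok st; apply/eqP; apply: contraNT st => d0; apply/eqP.
have ee r : (r <= n)%N -> (esym_yroot R n' k s (n - r)) = esym_yroot R n' k t (n - r).
  move=> rn; apply: (mulIf d0); rewrite -dotH_eig //; congr (_ * _).
  by apply: (mulIf (bethe_norm_neq0 sok)); rewrite -dotH_eig.
case: sok tok => sP ss sk [tP ts tk].
apply: (@esym_yroot_inj R n' k) => // r; case: (leqP r n) => rn.
  by have := ee (n - r)%N (leq_subr _ _); rewrite subKn.
by rewrite /esym_yroot !coef_prod_1DX_gt.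
Qed.

(** The exponents of the roots w_i are the entries of the tuple I in reverse
order, up to a common factor of modulus 1; so the product of differences in S0
is the modulus of the alternant in the norm. *)
Lemma S0_bethe_norm (m : Pk n k) :
  S0 R k m ^+ 2 * dotH (bv (part_of_weight m)) (bv (part_of_weight m)) = 1 /\
  S0 R k m != 0.
Proof.
have ok := fits_box_weight m; set s := part_of_weight m in ok *.
have [sP ss sk] := ok.
have d0n : `|\det (alt (fun=> 0%N) (@wroot R n' k s))| != 0.
  by rewrite normr_eq0 alt0_neq0 ?ss.
have E : \prod_(i < n) \prod_(j < n | (i < j)%N)
    `|zeta n k (Itup R s i) - zeta n k (Itup R s j)| =
    `|\det (alt (fun=> 0%N) (@wroot R n' k s))|.
  rewrite norm_alt0.
  pose A (i j : 'I_n) : C := `|zeta n k (Itup R s i) - zeta n k (Itup R s j)|.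
  have AE i j : `|@wroot R n' k s j - wroot R k s i| = A (rev_ord i) (rev_ord j).
    rewrite /A distrC.
    have wE l : @wroot R n' k s l =
        zeta n k (- ((sumn s)%:R / n%:R) : R) * zeta n k (Itup R s (rev_ord l)).
      rewrite -zetaD wrootE /Itup rev_ordK; congr (zeta _ _ _).
      rewrite natrD natrB // -[n.+1%:R]natr1.
      by set q := _ / _; set a := (nth _ _ _)%:R; set nn := n%:R; set ll := l.+1%:R; lra.
    by rewrite !wE -mulrBr normrM norm_zeta ?mul1r // addnC.
  under [RHS]eq_bigr => i _ do under eq_bigr => j _ do rewrite AE.
  rewrite [RHS](reindex_inj rev_ord_inj) /=.
  under [RHS]eq_bigr => i _ do rewrite (reindex_inj rev_ord_inj) /=.
  rewrite [LHS](exchange_big_dep xpredT) //=.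
  apply: eq_bigr => i _; apply: eq_big => [j|j _].
    by have := ltn_ord i; have := ltn_ord j; lia.
  by rewrite !rev_ordK /A distrC.
have P0 : n%:R * (n + k)%:R ^+ n.-1 != 0 :> C.
  by rewrite mulf_neq0 ?expf_neq0 ?pnatr_eq0.
split; last first.
  by rewrite /S0 E mulf_neq0 // invr_eq0 sqrtC_eq0.
rewrite bethe_norm // /S0 E exprMn exprVn sqrtCK.
move: P0 d0n; move: (n%:R * _) (`|_|) => P D P0 D0.
by field; rewrite P0 D0.
Qed.

End Hilbert.

(** * Completeness and the Verlinde formula *)

Section Expansion.
Variables (R : realType) (n' : nat).
Local Notation n := n'.+2.
Local Notation C := R[i].
Local Notation Hsp := {malg C[weight n]}.
Local Notation opH := (endo Hsp).
Local Notation bv k s := (bethe n (xpt R n k s)).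

Lemma malg_ket (v : Hsp) : v = \sum_(m <- msupp v) v@_m *: ket m.
Proof.
apply/malgP => m; rewrite raddf_sum /=.
rewrite (eq_bigr (fun m' => v@_m' * (m' == m)%:R)) => [|m' _]; last first.
  by rewrite mcoeffZ ketE.
case: (boolP (m \in msupp v)) => mv; last first.
  rewrite (mcoeff_outdom mv) big_seq big1 // => m' m'v.
  by case: eqP => [e|_]; [rewrite -e m'v in mv | rewrite mulr0].
rewrite (big_rem m) //= eqxx mulr1 big_seq big1 ?addr0 // => m'.
rewrite mem_rem_uniq ?fset_uniq // inE => /andP [/negbTE -> _].
by rewrite mulr0.
Qed.

(** The orthogonality relations say that the matrix of coefficients of the Bethe
vectors has a left inverse. It is square, since both families are indexed by the
weights of level k, so the same matrix is a right inverse: this is the expansion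
of the basis vectors. *)
Lemma ket_bethe k (m : Pk n k) : ket m =
  \sum_(s : Pk n k) (S0 R k s ^+ 2 * ((bv k (part_of_weight s))@_(Pk_weight m))^*)
     *: bv k (part_of_weight s).
Proof.
pose b (s : Pk n k) := bv k (part_of_weight s).
pose A (s l : Pk n k) : C := S0 R k s ^+ 2 * ((b s)@_(Pk_weight l))^*.
pose B (l s : Pk n k) : C := (b s)@_(Pk_weight l).
have AB s t : \sum_l A s l * B l t = (s == t)%:R.
  transitivity (S0 R k s ^+ 2 * dotH (b s) (b t)).
    by rewrite bethe_dot mulr_sumr; apply: eq_bigr => l _; rewrite mulrA.
  case: (eqVneq s t) => [<-|st]; first by have [-> _] := S0_bethe_norm R s.
  rewrite bethe_orthogonal ?mulr0 //; try exact: fits_box_weight.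
  apply: contra st => /eqP e; apply/eqP/Pk_weight_inj/part_of_weight_inj => //.
  by rewrite !level_Pk.
have BA := fin_inverse AB.
apply/malgP => w; rewrite ketE raddf_sum /=.
under eq_bigr => s _ do rewrite mcoeffZ.
case: (eqVneq (level w) k) => [wk|wk].
  have [l <-] := Pk_of_weight wk.
  rewrite (inj_eq (@Pk_weight_inj _ _)) eq_sym -BA.
  by apply: eq_bigr => s _; rewrite mulrC.
rewrite big1 => [|s _]; last by rewrite [X in _ * X]bethe_coef (negbTE wk) mulr0.
by case: eqP => // e; rewrite -e level_Pk eqxx in wk.
Qed.

(** The Bethe vectors of all levels span the whole space. *)
Lemma op_ext (f g : opH) :
  (forall k s, fits_box n' k s -> f (bv k s) = g (bv k s)) -> f = g.
Proof.
move=> fg; apply: endoP => v; rewrite (malg_ket v) !linear_sum.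
apply: eq_bigr => m _; rewrite !linearZ /=; congr (_ *: _).
have [l <-] := Pk_of_weight (erefl (level m)).
rewrite ket_bethe !linear_sum; apply: eq_bigr => s _; rewrite !linearZ /=.
by rewrite fg //; apply: fits_box_weight.
Qed.

Lemma endo_scaler (f : opH) (c : C) (v : Hsp) : f (c *: v) = c *: f v.
Proof. exact: linearZ. Qed.

Lemma mul_eig (f g : opH) (c d : C) (v : Hsp) :
  f v = c *: v -> g v = d *: v -> (f * g) v = (c * d) *: v.
Proof.
move=> fv gv; rewrite endo_mulE gv endo_scaler fv scalerA mulrC; exact: erefl.
Qed.

Lemma scale_eig (f : opH) (c d : C) (v : Hsp) :
  f v = c *: v -> (d *: f) v = (d * c) *: v.
Proof. move=> fv; rewrite endo_scaleE fv scalerA; exact: erefl. Qed.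

Lemma prod_eig (J : Type) (r : seq J) (f : J -> opH) (c : J -> C) (v : Hsp) :
  (forall j, f j v = c j *: v) -> (\prod_(j <- r) f j) v = (\prod_(j <- r) c j) *: v.
Proof.
move=> fc; elim: r => [|j r IH].
  rewrite !big_nil scale1r; exact: erefl.
rewrite [X in _ = X *: _]big_cons [X in endo_fun X]big_cons.
exact: mul_eig (fc j) IH.
Qed.

Lemma sign_endo (e : bool) (f : opH) (v : Hsp) :
  ((-1) ^+ e * f) v = (-1) ^+ e *: f v.
Proof.
case: e; last by rewrite !expr0 mul1r scale1r.
by rewrite !expr1 mulN1r scaleN1r.
Qed.

Definition ncschur_val k s lam : C :=
  \det (\matrix_(i < head 0%N lam, j < head 0%N lam) nce_val R n' k s
     ((nth 0%N (conj_part lam) i)%:Z - (i : nat)%:Z + (j : nat)%:Z)).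

(** On a common eigenvector each product of operators acts by the product of the
eigenvalues, whatever the order of the factors. *)
Lemma ncschur_order_eig k s lam
    (tau : 'S_(head 0%N lam) -> 'S_(head 0%N lam)) : fits_box n' k s ->
  (\sum_(t : 'S_(head 0%N lam)) (-1) ^+ t *
     \prod_i ncschur_mx R n lam (tau t i) (t (tau t i))) (bv k s) =
  ncschur_val k s lam *: bv k s.
Proof.
move=> ok; rewrite endo_sumE /ncschur_val /determinant scaler_suml.
apply: eq_bigr => t _; rewrite sign_endo -scalerA; congr (_ *: _).
set M := \matrix_(i, j) _.
rewrite (prod_eig _ (c := fun i => M (tau t i) (t (tau t i)))) => [|i].
  by congr (_ *: _); rewrite [RHS](reindex_inj (@perm_inj _ (tau t))).
by rewrite !mxE nce_eig.
Qed.

Lemma ncschur_eig k s lam : fits_box n' k s ->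
  ncschur R n lam (bv k s) = ncschur_val k s lam *: bv k s.
Proof.
move=> ok; rewrite -(@ncschur_order_eig k s lam (fun=> 1%g)) //.
rewrite /ncschur /determinant; congr (endo_fun _ _); apply: eq_bigr => t _.
by congr (_ * _); apply: eq_bigr => i _; rewrite perm1.
Qed.

(** The eigenvalues e_r(y) put into the determinant give the determinant of
[schur_jt]. *)
Lemma ncschur_val_schur k s lam : is_partition lam ->
  ncschur_val k s lam = chi k lam (xi_pt R n s).
Proof.
move=> lamP; rewrite /chi schur_jt //; congr (\det _); apply/matrixP => i j.
rewrite !mxE coefMXn /nce_val /esym_yroot; case: ltnP => h.
  case E : (_ + _) => [a|a] //; move: E; lia.
case E : (_ + _) => [a|a]; last by move: E; lia.
by congr (_`_ _); move: E; lia.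
Qed.

Lemma Top_eig k s u : fits_box n' k s ->
  Top n u (bv k s) = (\sum_(r < n.+1) u ^+ r * nce_val R n' k s r) *: bv k s.
Proof.
move=> ok; rewrite Top_nce endo_sumE scaler_suml; apply: eq_bigr => r _.
exact: scale_eig (nce_eig R r ok).
Qed.

Lemma chi_bethe k s (l : Pk n k) : fits_box n' k s ->
  (bv k s)@_(Pk_weight l) = (chi k (part_of_weight l) (xi_pt R n s))^*.
Proof.
by case=> sP ss sk; rewrite bethe_chi ?ss // level_Pk eqxx.
Qed.

Lemma ord_oppK : involutive (@ord_opp n).
Proof.
move=> i; apply: val_inj => /=; have := ltn_ord i.
case: (posnP i) => [->|i0] iN; first by rewrite subn0 modnn subn0 modnn.
rewrite (@modn_small (n - i)); last by lia.
by rewrite modn_small; lia.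
Qed.

(** Taking the dual weight complements the partition in the rectangle whose
width is its first part, and turns it upside down. *)
Lemma part_of_dual_weight (nu : weight n) (i : 'I_n) :
  (nth 0 (part_of_weight (dual_weight nu)) i +
   nth 0 (part_of_weight nu) (rev_ord i))%N = nth 0%N (part_of_weight nu) 0.
Proof.
rewrite !nth_part_of_weight [in RHS](bigID (fun j : 'I_n => (j <= rev_ord i)%N)) /=.
congr (_ + _)%N.
  rewrite [LHS](reindex_inj (can_inj ord_oppK)).
  apply: eq_big => [j|j _]; last by rewrite ffunE ord_oppK.
  have := ltn_ord j; have := ltn_ord i; rewrite /=.
  case: (posnP j) => [->|j0] h1 h2; first by rewrite subn0 modnn; lia.
  by rewrite modn_small; lia.
by apply: eq_bigl => j; lia.
Qed.

(** If the exponents of c and d are complementary to K in reverse order, then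
y^d = y^K w^c entry by entry, and the powers y_a^K of the rows have product 1. *)
Lemma alt_reverse k s (c d : nat -> nat) (K : nat) : (size s <= n)%N ->
  (forall j : 'I_n, (d j + (n - j.+1) + (c (rev_ord j) + (n - (rev_ord j).+1)) = K)%N) ->
  \det (alt d (@yroot R n' k s)) =
  \det (alt c (@wroot R n' k s)) * (-1) ^+ perm (@rev_ord_inj n).
Proof.
move=> ss cd; pose rv : 'S_n := perm (@rev_ord_inj n).
have prod_y : \prod_i yroot R k s (i : 'I_n) = 1.
  transitivity ((\prod_i yroot R k s (i : 'I_n)) * \prod_i @wroot R n' k s i).
    by rewrite prod_wroot // mulr1.
  by rewrite -big_split /= big1 // => i _; apply: yroot_wroot.
rewrite -[odd_perm _]odd_permV -det_perm -det_mulmx -col_permE.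
have -> : alt d (@yroot R n' k s) =
    \matrix_(a, j) (yroot R k s a ^+ K * 1 * (col_perm rv (alt c (@wroot R n' k s))) a j).
  apply/matrixP => a j; rewrite !mxE permE mulr1 -(cd j) [in RHS]exprD -mulrA -exprMn.
  by rewrite yroot_wroot expr1n mulr1.
rewrite det_scale_row_col; under eq_bigr do rewrite mulr1.
by rewrite prodrXl prod_y expr1n mul1r.
Qed.

(** Both alternants in the quotient formula for the character are reversed by
[alt_reverse], and the signs cancel. *)
Lemma chi_dual k s (nu : weight n) : fits_box n' k s ->
  chi k (part_of_weight (dual_weight nu)) (xi_pt R n s) =
  (chi k (part_of_weight nu) (xi_pt R n s))^*.
Proof.
case=> sP ss sk; have ss' : (size s <= n.-1)%N by rewrite ss.
have ss2 : (size s <= n)%N by rewrite ss.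
have d0 := alt0_neq0 R sP ss' sk.
pose K := (nth 0 (part_of_weight nu) 0 + n.-1)%N.
have e1 : \det (alt (nth 0%N (part_of_weight (dual_weight nu))) (@yroot R n' k s)) =
    \det (alt (nth 0%N (part_of_weight nu)) (@wroot R n' k s)) * (-1) ^+ perm (@rev_ord_inj n).
  apply: (@alt_reverse k s _ _ K ss2) => j.
  by have := part_of_dual_weight nu j; have := ltn_ord j; rewrite /K /=; lia.
have e2 : \det (alt (fun=> 0%N) (@yroot R n' k s)) =
    \det (alt (fun=> 0%N) (@wroot R n' k s)) * (-1) ^+ perm (@rev_ord_inj n).
  apply: (@alt_reverse k s _ _ n.-1 ss2) => j.
  by have := ltn_ord j; rewrite /=; lia.
move: e1; rewrite schur_alt // e2.
rewrite -(@alt_conj R n' k s (nth 0%N (part_of_weight nu))) schur_alt // rmorphM /= alt_conj.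
rewrite [in RHS]mulrAC -!mulrA => /(mulfI d0) /mulfI; apply.
by rewrite signr_eq0.
Qed.

Lemma Hk_expand k (v : Hsp) : in_Hk k v ->
  v = \sum_(m : Pk n k) v@_(Pk_weight m) *: ket (Pk_weight m).
Proof.
move=> vk; rewrite [LHS]malg_ket.
apply/malgP => w; rewrite !raddf_sum /=.
under eq_bigr => m _ do rewrite mcoeffZ ketE.
under [RHS]eq_bigr => m _ do rewrite mcoeffZ ketE.
by apply: big_msupp_Pk => // m ->; rewrite mul0r.
Qed.

Lemma dotH_ket (l : weight n) (v : Hsp) : dotH (ket l) v = v@_l.
Proof.
by rewrite /dotH /ket msuppU oner_eq0 big_seq_fset1 mcoeffU eqxx conjC1 mul1r.
Qed.

(** Pair a linear relation with each vector of the family. *)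
Lemma orthogonal_free k (J : finType) (b : J -> Hsp) (c : J -> C) :
  (forall j, in_Hk k (b j)) -> is_orthogonal_family b ->
  (forall j, dotH (b j) (b j) != 0) ->
  \sum_j c j *: b j = 0 -> forall j, c j = 0.
Proof.
move=> bk orth norm0 c0 j.
have : dotH (b j) (\sum_i c i *: b i) = c j * dotH (b j) (b j).
  rewrite (dotH_Pk _ (bk j)); transitivity (\sum_i c i * dotH (b j) (b i)).
    under [RHS]eq_bigr => i _ do rewrite (dotH_Pk _ (bk j)) mulr_sumr.
    rewrite exchange_big /=; apply: eq_bigr => l _.
    rewrite raddf_sum mulr_sumr /=; apply: eq_bigr => i _.
    by rewrite mcoeffZ mulrCA.
  rewrite (bigD1 j) //= big1 ?addr0 // => i ij.
  by rewrite orth ?mulr0 // eq_sym.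
rewrite c0 (dotH_Pk _ (bk j)) big1 => [|l _]; last by rewrite mcoeff0 mulr0.
by move=> /esym/eqP; rewrite mulf_eq0 (negbTE (norm0 j)) orbF => /eqP.
Qed.

Lemma bethe_span k (v : Hsp) : in_Hk k v -> exists c : Pk n k -> C,
  v = \sum_(s : Pk n k) c s *: bv k (part_of_weight s).
Proof.
move=> vk; exists (fun s => \sum_(m : Pk n k) v@_(Pk_weight m) *
  (S0 R k s ^+ 2 * ((bv k (part_of_weight s))@_(Pk_weight m))^*)).
rewrite {1}(Hk_expand vk).
transitivity (\sum_(m : Pk n k) \sum_(s : Pk n k) (v@_(Pk_weight m) *
    (S0 R k s ^+ 2 * ((bv k (part_of_weight s))@_(Pk_weight m))^*))
    *: bv k (part_of_weight s)).
  apply: eq_bigr => m _; rewrite ket_bethe scaler_sumr; apply: eq_bigr => s _.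
  exact: scalerA.
by rewrite exchange_big; apply: eq_bigr => s _; rewrite scaler_suml.
Qed.

Lemma box_part_fits k (s : box n.-1 k) : fits_box n' k (box_part s).
Proof.
case: s => -[s ssz] sP; split; rewrite ?size_map //=; first exact/eqP.
by case: s ssz sP => //= a s _ _; rewrite -ltnS ltn_ord.
Qed.

Lemma box_part_inj k : injective (@box_part n.-1 k).
Proof. by move=> s t e; apply/val_inj/val_inj; apply: (inj_map val_inj). Qed.

Lemma box_of_weight k : exists2 g : Pk n k -> box n.-1 k,
  bijective g & forall m, box_part (g m) = part_of_weight m.
Proof.
have /fin_all_exists [g gE] (m : Pk n k) :
    exists s : box n.-1 k, box_part s = part_of_weight m.
  have [mP ms mk] := fits_box_weight m.
  have szt : size (map (fun a => inord a : 'I_k.+1) (part_of_weight m)) == n.-1.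
    by rewrite size_map ms.
  have e : map val (map (fun a => inord a : 'I_k.+1) (part_of_weight m)) = part_of_weight m.
    rewrite -map_comp -[RHS]map_id; apply/eq_in_map => a /(nthP 0%N) [i _ <-] /=.
    by rewrite inordK // ltnS (leq_trans (part_homo mP (leq0n i))).
  have tP : is_partition (map val (Tuple szt)) by move: mP; rewrite -{1}e.
  by exists (exist _ (Tuple szt) tP).
have g_inj : injective g.
  move=> l m e; apply/Pk_weight_inj/part_of_weight_inj; first by rewrite !level_Pk.
  by rewrite -!gE e.
have /fin_all_exists [h hK] (s : box n.-1 k) : exists m, g m = s.
  have [sP ss sk] := box_part_fits s; have [m me] := weight_of_part sP ss sk.
  by exists m; apply: box_part_inj; rewrite gE me.
by exists g => //; exists h => // m; apply: g_inj; rewrite hK.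
Qed.

(** The coefficient of b(x_sigma) in the expansion of ket m, the eigenvalue, and
a coefficient of b(x_sigma) itself: each is a character or its conjugate, and
conj chi_nu is chi at the dual weight. *)
Lemma verlinde_coef k (l m nu s : Pk n k) :
  S0 R k s ^+ 2 * ((bv k (part_of_weight s))@_(Pk_weight m))^* *
    ncschur_val k (part_of_weight s) (part_of_weight l) *
    (bv k (part_of_weight s))@_(Pk_weight nu) =
  Smx R k l s * Smx R k m s * Smx R k (dual_weight nu) s / S0 R k s.
Proof.
have ok := fits_box_weight s; have [_ S00] := S0_bethe_norm R s.
rewrite (chi_bethe m ok) (chi_bethe nu ok) conjCK /Smx (chi_dual nu ok).
rewrite ncschur_val_schur; last exact: part_of_weight_partition.
move: (S0 R k s) S00 => S S00.
by move: (chi _ _ _) (chi _ _ _) (_^*) => x y z; field.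
Qed.

Lemma verlinde k (l m : Pk n k) : fusion R l m =
  \sum_(nu : Pk n k)
    (\sum_(s : Pk n k)
       Smx R k l s * Smx R k m s * Smx R k (dual_weight nu) s / S0 R k s) *: ket nu.
Proof.
transitivity (\sum_(s : Pk n k) \sum_(nu : Pk n k)
   (Smx R k l s * Smx R k m s * Smx R k (dual_weight nu) s / S0 R k s) *: ket nu);
  last first.
  by rewrite exchange_big; apply: eq_bigr => nu _; rewrite scaler_suml.
rewrite /fusion ket_bethe linear_sum; apply: eq_bigr => s _.
rewrite /= endo_scaler (ncschur_eig _ (fits_box_weight s)).
rewrite scalerA [X in _ *: X](Hk_expand (@bethe_in_Hk R n' k _)).
rewrite scaler_sumr; apply: eq_bigr => nu _; rewrite -(verlinde_coef l m nu s).
exact: scalerA.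
Qed.

End Expansion.

Theorem theorem1p2 (R : realType) (n k : nat) (hn : (2 <= n)%N)
    (hk : (1 <= k)%N) :
  (* (1) *)
  (forall u : R[i], Top n u = \sum_(r < n.+1) u ^+ r *: nce R n r) /\
  (* (2) *)
  ((forall u v : R[i], Top n u * Top n v = Top n v * Top n u) /\
   (forall r s : int, nce R n r * nce R n s = nce R n s * nce R n r) /\
   (* the value of the determinant does not depend on the order in which the
      factors of each of its terms are multiplied *)
   (forall lam : seq nat, is_partition lam ->
      forall tau : 'S_(head 0%N lam) -> 'S_(head 0%N lam),
        \sum_(s : 'S_(head 0%N lam)) (-1) ^+ s *
           \prod_i ncschur_mx R n lam (tau s i) (s (tau s i))
        = ncschur R n lam)) /\
  (* (3) *)
  (is_basis_Hk k (fun s : box n.-1 k => bethe n (xpt R n k s)) /\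
   is_orthogonal_family (fun s : box n.-1 k => bethe n (xpt R n k s)) /\
   (forall (s : box n.-1 k) (lam : seq nat), is_partition lam ->
      is_eigenvector (ncschur R n lam) (bethe n (xpt R n k s)))) /\
  (* (4) *)
  ((forall (l : Pk n k) (s : box n.-1 k),
      dotH (ket l) (bethe n (xpt R n k s))
      = (chi k (part_of_weight l) (xi_pt R n s))^*) /\
   (forall l m : Pk n k,
      fusion R l m =
      \sum_(nu : Pk n k)
        (\sum_(s : Pk n k)
           Smx R k l s * Smx R k m s * Smx R k (dual_weight nu) s / S0 R k s)
        *: ket nu)).
Proof.
case: n hn => [//|[//|n']] _ {hk}.
have orth : is_orthogonal_family
    (fun s : box n'.+1 k => bethe n'.+2 (xpt R n'.+2 k s)).
  move=> s t st; apply: bethe_orthogonal; [exact: box_part_fits|exact: box_part_fits|].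
  by apply: contra st => /eqP/box_part_inj ->.
have norm0 (s : box n'.+1 k) :
    dotH (bethe n'.+2 (xpt R n'.+2 k s)) (bethe n'.+2 (xpt R n'.+2 k s)) != 0.
  by apply: bethe_norm_neq0; apply: box_part_fits.
split; first exact: Top_nce.
split.
  split.
    move=> u v; apply: op_ext => q s ok.
    by rewrite (mul_eig (Top_eig u ok) (Top_eig v ok))
               (mul_eig (Top_eig v ok) (Top_eig u ok)) mulrC.
  split.
    move=> r t; apply: op_ext => q s ok.
    by rewrite (mul_eig (nce_eig R r ok) (nce_eig R t ok))
               (mul_eig (nce_eig R t ok) (nce_eig R r ok)) mulrC.
  move=> lam _ tau; apply: op_ext => q s ok.
  by rewrite ncschur_order_eig // ncschur_eig.
split; last first.
  split=> [l s|l m]; last exact: verlinde.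
  by rewrite dotH_ket; apply: chi_bethe; apply: box_part_fits.
split; last split=> //.
  split=> [s|c|v vk]; first exact: bethe_in_Hk.
    by apply: (orthogonal_free (k := k)) => // s; apply: bethe_in_Hk.
  have [g [h gK hK] gE] := box_of_weight n' k; have [c ->] := bethe_span vk.
  exists (fun s => c (h s)); rewrite [RHS](reindex g) /=; last first.
    by apply: onW_bij; exists h.
  by apply: eq_bigr => s _; rewrite gK gE.
move=> s lam lamP; split; last first.
  by exists (ncschur_val R n' k s lam); apply: ncschur_eig; apply: box_part_fits.
move=> b0; have := norm0 s; rewrite (dotH_Pk _ (@bethe_in_Hk R n' k _)).
by rewrite b0 big1 ?eqxx // => l _; rewrite mcoeff0 mulr0.
Qed.
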